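(* Let $\beta\in\mathbb R$, $m_j\in\mathbb N$, and let $\delta$ be a dyadic number. Then for any $1<p<\infty$, $$\bigg\|\Big(\sum_{k\in\mathbb Z}\big|(f*\Phi_{j,k,\delta})\big(\cdot-2^{-m_jk}\delta^{-1}\beta\big)\big|^2\Big)^{1/2}\bigg\|_{L^p(\mathbb R)}\le C\,\log(10+|\beta|)\,\|f\|_{L^p(\mathbb R)}$$ holds for all $f\in L^p(\mathbb R)$, where the constant $C$ is independent of $f$, $\delta$, $\beta$ and $m_j\in\mathbb N$.
   Context: A dyadic number is $2^l$ with $l\in\mathbb Z$; $\mathbb N$ is the set of positive integers. $\Phi$ is a fixed Schwartz function on $\mathbb R$ whose Fourier transform is supported in $\{\xi:1/2\le|\xi|\le2\}$, and $\Phi_{j,k,\delta}$ is defined by $\widehat{\Phi_{j,k,\delta}}(\xi)=\widehat\Phi\big(\xi/(2^{m_jk}\delta)\big)$ (the index $j$ enters only through $m_j$). The constant $C$ may depend on $p$ and $\Phi$. *)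

(* Defs.v *)
From HB Require Import structures.
From mathcomp Require Import all_boot all_order all_algebra.
From mathcomp Require Import all_classical all_reals all_analysis.
From mathcomp Require Import complex.
Set Implicit Arguments.
Unset Strict Implicit.
Unset Printing Implicit Defensive.
Import Order.TTheory GRing.Theory Num.Theory.
Import numFieldNormedType.Exports.
Import ComplexField.Normc.
Local Open Scope classical_set_scope.
Local Open Scope ring_scope.
Local Open Scope complex_scope.

Section defs.
Variable R : realType.
Implicit Types (f g Phi : R -> R[i]).

Local Notation mu := (@lebesgue_measure R).

Definition cintegral g : R[i] :=
  Rintegral mu setT (fun x => complex.Re (g x)) +i*
  Rintegral mu setT (fun x => complex.Im (g x)).

Definition expi (t : R) : R[i] := cos t +i* sin t.

(* Normalisation: hat g(xi) = int g(x) exp(-2 pi i x xi) dx. *)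
Definition fourier g (xi : R) : R[i] :=
  cintegral (fun x => g x * expi (- (2 * pi * x * xi))).

Definition convolution f g (x : R) : R[i] :=
  cintegral (fun y => f y * g (x - y)).

Definition schwartzR (u : R -> R) : Prop :=
  (forall (n : nat) (x : R), derivable (u^`(n))%classic x 1) /\
  (forall k n : nat, exists M : R,
     forall x : R, `|x| ^+ k * `|(u^`(n))%classic x| <= M).

Definition schwartz g : Prop :=
  schwartzR (fun x => complex.Re (g x)) /\
  schwartzR (fun x => complex.Im (g x)).

Definition dyadic (delta : R) : Prop := exists l : int, delta = 2 ^ l.

Definition annulus : set R := [set xi | 1 / 2 <= `|xi| <= 2].

Definition fourier_supported_in g (A : set R) : Prop :=
  closure [set xi | fourier g xi != 0] `<=` A.

(* g is the Schwartz function whose Fourier transform is that of Phi dilated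
   by s. *)
Definition is_dilation Phi (s : R) g : Prop :=
  schwartz g /\ forall xi : R, fourier g xi = fourier Phi (xi / s).

Definition Lp_norm (p : R) f : \bar R :=
  Lnorm mu p%:E (fun x => (normc (f x))%:E).

(* Elements of L^p are represented by Borel functions, the measurable
   structure carried by R in the library. *)
Definition in_Lp (p : R) f : Prop :=
  [/\ measurable_fun setT (fun x => complex.Re (f x)),
      measurable_fun setT (fun x => complex.Im (f x)) &
      (Lp_norm p f < +oo)%E].

(* (sum_(k in Z) |h_k(x)|^2)^(1/2), with value +oo if the series diverges. *)
Definition square_function (h : int -> R -> R[i]) (x : R) : \bar R :=
  sqrte (esum [set: int] (fun k : int => ((normc (h k x)) ^+ 2)%:E)).

End defs.

(* Main.v *)
Require Import Defs.
From HB Require Import structures.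
From mathcomp Require Import all_boot all_order all_algebra.
From mathcomp Require Import all_classical all_reals all_analysis.
From mathcomp Require Import complex.
From mathcomp Require Import measurable_realfun.
From mathcomp Require Import zify ring lra.
Import Order.TTheory GRing.Theory Num.Theory.
Import numFieldNormedType.Exports.
Local Open Scope classical_set_scope.
Local Open Scope ring_scope.
Set Implicit Arguments.
Unset Strict Implicit.
Unset Printing Implicit Defensive.

(** Why the estimate holds. With s_k = 2^(m_j k) delta, the shifted convolution
    (f * Phi_(j,k,delta))(x - beta / s_k) is the convolution of f with the
    kernel psi_k(x) = s_k Phi(s_k x - beta): injectivity of the Fourier
    transform ([fourier_injective], [is_dilationE]) identifies the function
    with transform hat Phi (xi / s_k). Separating real and imaginary parts, Phi
    may be replaced by a real profile phi. About the scales only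
    2 s_k <= s_(k+1) is used, which makes the constant independent of m_j and
    delta.

    The point is that a sum of the psi_k with arbitrary signs is a
    Calderon-Zygmund kernel whose constants are O(log (10 + |beta|)), uniformly
    in the signs and in the number of terms ([cz_kernel_lacunary]).
    - On L^2 there is no loss. The transform of psi_k is supported where |xi|
      is comparable to s_k, so distant scales are orthogonal
      ([orthogonal_scales_of_annulus]), and the operators are almost orthogonal
      ([L2_signed_sum]).
    - In the Hormander condition, put t = s_k |z|. The integral of
      |psi_k(x - z) - psi_k(x)| over |x| >= 2 |z| is O(t) by smoothness, O(1)
      by size and, once t >= 2 |beta|, O(1 / t) by decay
      ([hormander_dilate]). As s_k doubles, only about log (10 + |beta|) scales
      lie between the two decaying regimes; [lacunary_sum_le] makes this
      precise by comparing each term with an increment of a potential bounded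
      by log (10 + |beta|).

    The Calderon-Zygmund decomposition gives weak type (1,1) ([weak_type_11]),
    Marcinkiewicz interpolation the range 1 < p < 2 ([marcinkiewicz]) and
    duality the range p > 2, with a bound growing linearly in the constants of
    the kernel ([conv_Lp]). Averaging over the signs by Khintchine's inequality
    ([khintchine]) turns the bound for signed sums into one for the square
    function ([square_function_bddint]), with the first power of the logarithm.

    This is done for finite sums and bounded integrable f. Fatou's lemma
    extends it to f in L^p ([square_function_Lp]) and monotone convergence to
    the sum over all integers k ([integral_esum_int_le]). *)

(** * Affine changes of variables *)

Section change_of_variables.
Variable R : realType.
Local Notation mu := (@lebesgue_measure R).
Local Open Scope ereal_scope.

Lemma measurable_affine (s a : R) :
  measurable_fun setT (fun x : R => s * x + a)%R.
Proof. by apply: measurable_funD => //; exact: measurable_funM. Qed.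

Lemma affine_preimage_itv (s a c d : R) : (0 < s)%R ->
  (fun x => s * x + a)%R @^-1` `]c, d]%classic =
  `](c - a) / s, (d - a) / s]%classic%R.
Proof.
move=> s0; apply/seteqP; split => x /=; rewrite !in_itv/= => /andP[h1 h2];
  apply/andP; split.
- by rewrite ltr_pdivrMr// mulrC; lra.
- by rewrite ler_pdivlMr// mulrC; lra.
- by move: h1; rewrite ltr_pdivrMr// mulrC; lra.
- by move: h2; rewrite ler_pdivlMr// mulrC; lra.
Qed.

(** The image measure rescaled by s agrees with the Lebesgue measure on
    half-open intervals, hence everywhere by uniqueness. *)
Lemma lebesgue_measure_affine (s a : R) (A : set R) : (0 < s)%R ->
  measurable A -> mu A = s%:E * mu ((fun x => s * x + a)%R @^-1` A).
Proof.
move=> s0 mA.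
pose phi : R -> measurableTypeR R := (fun x => s * x + a)%R.
have mphi : measurable_fun setT phi by exact: measurable_affine.
pose m' := [the measure _ _ of pushforward mu phi].
pose nu := mscale (NngNum (ltW s0)) (m' mphi).
have := @lebesgue_measure_unique R [the measure _ _ of nu].
apply => // _ [[c d]] /= _ <-.
rewrite /mscale/= /pushforward affine_preimage_itv//.
rewrite !lebesgue_measure_itv/= !lte_fin ltr_pM2r ?invr_gt0// ltrD2r.
case: ifPn => cd; last by rewrite mule0.
by rewrite -!EFinD -EFinM; congr (_ %:E); field; rewrite gt_eqF.
Qed.

Lemma ge0_integral_affine (s a : R) (f : R -> \bar R) : (0 < s)%R ->
  measurable_fun setT f -> (forall x, 0 <= f x) ->
  \int[mu]_x f x = s%:E * \int[mu]_x f (s * x + a)%R.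
Proof.
move=> s0 mf f0.
pose phi : R -> measurableTypeR R := (fun x => s * x + a)%R.
have mphi : measurable_fun setT phi by exact: measurable_affine.
pose m' := [the measure _ _ of pushforward mu phi].
pose nu := mscale (NngNum (ltW s0)) (m' mphi).
transitivity (\int[nu]_x f x).
  apply: eq_measure_integral => A mA _.
  exact: (lebesgue_measure_affine a s0).
rewrite (ge0_integral_mscale (m' mphi) measurableT (NngNum (ltW s0)))//=.
by rewrite ge0_integral_pushforward.
Qed.

Lemma ge0_integral_opp (f : R -> \bar R) :
  measurable_fun setT f -> (forall x, 0 <= f x) ->
  \int[mu]_x f x = \int[mu]_x f (- x)%R.
Proof.
move=> mf f0.
have mphi : measurable_fun setT (-%R : R -> measurableTypeR R) by [].
pose m' := [the measure _ _ of pushforward mu (-%R : R -> measurableTypeR R)].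
transitivity (\int[m' mphi]_x f x).
  apply: eq_measure_integral => A mA _.
  by apply/esym; exact: lebesgue_measureN.
by rewrite ge0_integral_pushforward.
Qed.

Lemma ge0_integral_shift (a : R) (f : R -> \bar R) :
  measurable_fun setT f -> (forall x, 0 <= f x) ->
  \int[mu]_x f (x + a)%R = \int[mu]_x f x.
Proof.
move=> mf f0; rewrite [RHS](ge0_integral_affine a (@ltr01 R))// mul1e.
by apply: eq_integral => x _; rewrite mul1r.
Qed.

Lemma integral_shift (a : R) (f : R -> \bar R) : measurable_fun setT f ->
  \int[mu]_x f (x + a)%R = \int[mu]_x f x.
Proof.
move=> mf; rewrite integralE [RHS]integralE.
congr (_ - _).
  rewrite (funepos_comp f (fun x => x + a)%R).
  exact: (ge0_integral_shift a (measurable_funepos mf) (@funepos_ge0 _ _ f)).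
rewrite (funeneg_comp f (fun x => x + a)%R).
exact: (ge0_integral_shift a (measurable_funeneg mf) (@funeneg_ge0 _ _ f)).
Qed.

Lemma integral_opp (f : R -> \bar R) : measurable_fun setT f ->
  \int[mu]_x f (- x)%R = \int[mu]_x f x.
Proof.
move=> mf; rewrite integralE [RHS]integralE.
congr (_ - _).
  rewrite (funepos_comp f (fun x => - x)%R).
  exact/esym/(ge0_integral_opp (measurable_funepos mf) (@funepos_ge0 _ _ f)).
rewrite (funeneg_comp f (fun x => - x)%R).
exact/esym/(ge0_integral_opp (measurable_funeneg mf) (@funeneg_ge0 _ _ f)).
Qed.

(** Integrability of f keeps the factor distributive over the difference of
    the positive and negative parts. *)
Lemma integral_affine (s a : R) (f : R -> \bar R) : (0 < s)%R ->
  mu.-integrable setT f ->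
  \int[mu]_x f (s * x + a)%R = (s^-1)%:E * \int[mu]_x f x.
Proof.
move=> s0 intf.
have mf : measurable_fun setT f by case/integrableP: intf.
rewrite integralE [in RHS]integralE.
have E (g : R -> \bar R) : measurable_fun setT g -> (forall x, 0 <= g x) ->
   \int[mu]_x g (s * x + a)%R = (s^-1)%:E * \int[mu]_x g x.
  move=> mg g0; rewrite [in RHS](ge0_integral_affine a s0)// muleA -EFinM.
  by rewrite mulVf ?gt_eqF// mul1e.
have E1 := E _ (measurable_funepos mf) (@funepos_ge0 _ _ f).
have E2 := E _ (measurable_funeneg mf) (@funeneg_ge0 _ _ f).
rewrite muleBr//; last first.
  apply: fin_num_adde_defl; rewrite fin_numN.
  exact: (integrable_neg_fin_num measurableT intf).
by rewrite -E1 -E2 (funepos_comp f (fun x => s * x + a)%R)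
  (funeneg_comp f (fun x => s * x + a)%R).
Qed.

End change_of_variables.

(** * Bounded integrable functions *)

Section bounded_integrable.
Variable R : realType.
Local Notation mu := (@lebesgue_measure R).
Implicit Types f g k l u w : R -> R.

(** The class on which the Calderon-Zygmund argument is run. It is stable
    under linear combinations, products, affine substitutions and convolution,
    so every integral that appears is finite and real-valued integrals can be
    used throughout; L^p is reached at the end by truncation. *)
Definition bddint f := [/\ measurable_fun setT f,
  exists M : R, forall x, `|f x| <= M & mu.-integrable setT (EFin \o f)].

Lemma bddint_measurable f : bddint f -> measurable_fun setT f.
Proof. by case. Qed.

Lemma bddint_integrable f : bddint f -> mu.-integrable setT (EFin \o f).
Proof. by case. Qed.

Lemma bddint_bounded f : bddint f -> exists2 M : R, 0 <= M & forall x, `|f x| <= M.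
Proof.
move=> [_ [M fM] _]; exists M => //.
by apply: le_trans (fM 0).
Qed.

Lemma bddint_dom f g (c : R) : bddint f -> measurable_fun setT g ->
  (forall x, `|g x| <= c * `|f x|) -> bddint g.
Proof.
move=> bf mg gf; have [M M0 fM] := bddint_bounded bf.
split => //.
  exists (`|c| * M) => x; apply: (le_trans (gf x)).
  apply: (@le_trans _ _ (`|c| * `|f x|)).
    by rewrite ler_wpM2r// ler_norm.
  by rewrite ler_wpM2l.
apply: (@le_integrable _ _ _ mu _ _ _ (fun x => c%:E * (`|f x|%:E))%E) => //.
- exact/measurable_EFinP.
- by move=> x _ /=; rewrite lee_fin (le_trans (gf x))// ler_norm.
- apply: integrableZl => //.
  exact: (integrable_norm (bddint_integrable bf)).
Qed.

Lemma bddintM f g : bddint f -> measurable_fun setT g ->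
  (exists M : R, forall x, `|g x| <= M) -> bddint (fun x => f x * g x).
Proof.
move=> bf mg [M gM]; apply: (@bddint_dom f _ M) => //.
  by apply: measurable_funM => //; exact: bddint_measurable.
by move=> x; rewrite normrM mulrC ler_wpM2r.
Qed.

Lemma bddintMb f g : bddint f -> bddint g -> bddint (fun x => f x * g x).
Proof. by move=> bf [mg Mg _]; exact: bddintM. Qed.

Lemma bddintD f g : bddint f -> bddint g -> bddint (fun x => f x + g x).
Proof.
move=> [mf [M fM] If] [mg [N gN] Ig]; split.
- exact: measurable_funD.
- by exists (M + N) => x; rewrite (le_trans (ler_normD _ _))// lerD.
- exact: (integrableD measurableT If Ig).
Qed.

Lemma bddintZ c f : bddint f -> bddint (fun x => c * f x).
Proof.
move=> bf; apply: (@bddint_dom f _ `|c|) => //.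
  by apply: measurable_funM => //; exact: bddint_measurable.
by move=> x; rewrite normrM.
Qed.

Lemma bddintN f : bddint f -> bddint (fun x => - f x).
Proof.
move=> /(bddintZ (-1)); congr bddint.
by apply/funext => x; rewrite mulN1r.
Qed.

Lemma bddintB f g : bddint f -> bddint g -> bddint (fun x => f x - g x).
Proof. by move=> bf /bddintN; exact: bddintD. Qed.

Lemma bddint_norm f : bddint f -> bddint (fun x => `|f x|).
Proof.
move=> bf; apply: (@bddint_dom f _ 1) => //.
  by apply: measurableT_comp => //; exact: bddint_measurable.
by move=> x; rewrite normr_id mul1r.
Qed.

Lemma bddint0 : bddint (fun=> 0).
Proof.
split => //; first by exists 0 => x; rewrite normr0.
exact: integrable0.
Qed.

Lemma bddint_sum I (r : seq I) (P : pred I) (F : I -> R -> R) :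
  (forall i, P i -> bddint (F i)) -> bddint (fun x => \sum_(i <- r | P i) F i x).
Proof.
move=> bF; elim: r => [|i r ih].
  rewrite (_ : (fun _ => _) = fun=> 0); first exact: bddint0.
  by apply/funext => x; rewrite big_nil.
rewrite (_ : (fun _ => _) = fun x => (if P i then F i x else 0) +
   \sum_(i <- r | P i) F i x); last first.
  by apply/funext => x; rewrite big_cons; case: ifP; rewrite ?add0r.
apply: bddintD => //; case: (P i) (bF i) => [h|_]; last exact: bddint0.
exact: h.
Qed.

Lemma integrable_affine (s a : R) f : 0 < s ->
  mu.-integrable setT (EFin \o f) ->
  mu.-integrable setT (EFin \o (fun x => f (s * x + a))).
Proof.
move=> s0 If; have /integrableP[mf foo] := If.
apply/integrableP; split.
  apply: (measurableT_comp mf); exact: measurable_affine.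
rewrite ltey; apply/eqP => Xoo; move: foo.
have mnf : measurable_fun setT (fun x => `|(f x)%:E|%E).
  exact: measurableT_comp.
have := ge0_integral_affine a s0 mnf (fun x => abse_ge0 _).
by rewrite Xoo gt0_muley ?lte_fin// => ->; rewrite ltxx.
Qed.

Lemma bddint_affine (s a : R) f : 0 < s -> bddint f ->
  bddint (fun x => f (s * x + a)).
Proof.
move=> s0 [mf [M fM] If]; split.
- by apply: (measurableT_comp mf); exact: measurable_affine.
- by exists M => x.
- exact: integrable_affine.
Qed.

Lemma bddint_opp f : bddint f -> bddint (fun x => f (- x)).
Proof.
move=> [mf [M fM] If]; split.
- exact: (measurableT_comp mf).
- by exists M => x.
- apply/integrableP; split.
    by apply/measurable_EFinP; exact: (measurableT_comp mf).
  have /integrableP[mf' foo] := If.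
  move: foo; rewrite ge0_integral_opp//.
  exact: measurableT_comp.
Qed.

Lemma bddint_shift (a : R) f : bddint f -> bddint (fun x => f (x + a)).
Proof.
move=> /(bddint_affine a ltr01); congr bddint.
by apply/funext => x; rewrite mul1r.
Qed.

Lemma bddint_reflect (a : R) f : bddint f -> bddint (fun x => f (a - x)).
Proof.
move=> /(bddint_shift a)/bddint_opp; congr bddint.
by apply/funext => x; rewrite addrC.
Qed.

Lemma Rintegral_shift (a : R) f : measurable_fun setT f ->
  \int[mu]_x f (x + a) = \int[mu]_x f x.
Proof.
move=> mf; rewrite /Rintegral; congr fine.
exact: (integral_shift a (f := EFin \o f) (measurableT_comp _ mf)).
Qed.

Lemma Rintegral_opp f : measurable_fun setT f ->
  \int[mu]_x f (- x) = \int[mu]_x f x.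
Proof.
move=> mf; rewrite /Rintegral; congr fine.
exact: (integral_opp (f := EFin \o f) (measurableT_comp _ mf)).
Qed.

Lemma Rintegral_reflect (a : R) f : measurable_fun setT f ->
  \int[mu]_x f (a - x) = \int[mu]_x f x.
Proof.
move=> mf; rewrite -(Rintegral_shift a mf) -(@Rintegral_opp (fun x => f (x + a))).
  by apply: eq_Rintegral => x _; rewrite addrC.
by apply: (measurableT_comp mf); exact: measurable_funD.
Qed.

Lemma Rintegral_affine (s a : R) f : 0 < s -> mu.-integrable setT (EFin \o f) ->
  \int[mu]_x f (s * x + a) = s^-1 * \int[mu]_x f x.
Proof.
move=> s0 If; rewrite /Rintegral.
have -> : (\int[mu]_x (f (s * x + a))%:E = s^-1%:E * \int[mu]_x (f x)%:E)%E.
  exact: (integral_affine a s0 If).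
by rewrite fineM//; exact: integrable_fin_num.
Qed.

Lemma EFin_Rintegral f : mu.-integrable setT (EFin \o f) ->
  (\int[mu]_x f x)%:E = (\int[mu]_x (f x)%:E)%E.
Proof. by move=> If; rewrite /Rintegral fineK//; exact: integrable_fin_num. Qed.

Lemma RintD f g : bddint f -> bddint g ->
  \int[mu]_x (f x + g x) = \int[mu]_x f x + \int[mu]_x g x.
Proof. by move=> [_ _ If] [_ _ Ig]; exact: RintegralD. Qed.

Lemma RintB f g : bddint f -> bddint g ->
  \int[mu]_x (f x - g x) = \int[mu]_x f x - \int[mu]_x g x.
Proof. by move=> [_ _ If] [_ _ Ig]; exact: RintegralB. Qed.

Lemma RintZ c f : bddint f -> \int[mu]_x (c * f x) = c * \int[mu]_x f x.
Proof. by move=> [_ _ If]; exact: RintegralZl. Qed.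

Lemma Rint_sum I (r : seq I) (P : pred I) (F : I -> R -> R) :
  (forall i, P i -> bddint (F i)) ->
  \int[mu]_x (\sum_(i <- r | P i) F i x) = \sum_(i <- r | P i) \int[mu]_x F i x.
Proof.
move=> bF; elim: r => [|i r ih].
  rewrite big_nil (@eq_Rintegral _ _ _ mu setT (fun=> 0)); last by move=> x _; rewrite big_nil.
  by rewrite /Rintegral integral0.
rewrite big_cons; case: ifPn => Pi.
  rewrite -ih -RintD; [|exact: bF|exact: bddint_sum].
  by apply: eq_Rintegral => x _; rewrite big_cons Pi.
by rewrite -ih; apply: eq_Rintegral => x _; rewrite big_cons (negbTE Pi).
Qed.

Lemma le_Rint f g : bddint f -> bddint g -> (forall x, f x <= g x) ->
  \int[mu]_x f x <= \int[mu]_x g x.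
Proof. by move=> [_ _ If] [_ _ Ig] fg; apply: le_Rintegral. Qed.

Lemma Rint_ge0 f : (forall x, 0 <= f x) -> 0 <= \int[mu]_x f x.
Proof. by move=> f0; apply: Rintegral_ge0. Qed.

Lemma le_norm_Rint f : bddint f -> `|\int[mu]_x f x| <= \int[mu]_x `|f x|.
Proof. by move=> [_ _ If]; exact: le_normr_Rintegral. Qed.

End bounded_integrable.

(** * Convolution *)

Section convolution.
Variable R : realType.
Local Notation mu := (@lebesgue_measure R).
Implicit Types f g k l u w : R -> R.

Lemma measurable_fst_comp f : measurable_fun setT f ->
  measurable_fun setT (fun z : R * R => f z.1).
Proof. by move=> mf; apply: (measurableT_comp mf); exact: measurable_fst. Qed.

Lemma measurable_snd_comp f : measurable_fun setT f ->
  measurable_fun setT (fun z : R * R => f z.2).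
Proof. by move=> mf; apply: (measurableT_comp mf); exact: measurable_snd. Qed.

Lemma measurable_diff_comp f : measurable_fun setT f ->
  measurable_fun setT (fun z : R * R => f (z.1 - z.2)).
Proof.
move=> mf; apply: (measurableT_comp mf).
by apply: measurable_funB; [exact: measurable_fst|exact: measurable_snd].
Qed.

Lemma integrable_prod_dom (F : R * R -> R) f g (M : R) :
  measurable_fun setT F -> mu.-integrable setT (EFin \o f) ->
  mu.-integrable setT (EFin \o g) ->
  (forall x y, `|F (x, y)| <= M * (`|f x| * `|g y|)) ->
  (mu \x mu)%E.-integrable setT (EFin \o F).
Proof.
move=> mF If Ig FM; apply/integrable12ltyP; first exact/measurable_EFinP.
have /integrableP[mf foo] := If; have /integrableP[mg goo] := Ig.
have mnf := measurableT_comp (@abse_measurable R setT) mf.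
have mng := measurableT_comp (@abse_measurable R setT) mg.
have mFF : measurable_fun setT (fubini_F mu (abse \o (EFin \o F))).
  apply: measurable_fun_fubini_tonelli_F; last by move=> z; exact: abse_ge0.
  by apply: measurableT_comp => //; exact/measurable_EFinP.
apply: (@le_lt_trans _ _ (\int[mu]_x (`|M|%:E *
    (`|(f x)%:E| * \int[mu]_y `|(g y)%:E|)))%E).
  apply: ge0_le_integral => //.
  - by move=> x _; apply: integral_ge0.
  - apply: emeasurable_funM => //; apply: emeasurable_funM => //.
  - move=> x _; rewrite -ge0_integralZl//.
    have mFs : measurable_fun setT (fun y => `|(F (x, y))%:E|%E).
      apply: measurableT_comp => //; apply/measurable_EFinP.
      exact: (measurableT_comp mF (pair1_measurable x)).
    rewrite -ge0_integralZl//; last by apply: emeasurable_funM.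
    apply: ge0_le_integral => //.
    + by apply: emeasurable_funM => //; apply: emeasurable_funM.
    + move=> y _; rewrite -!EFinM lee_fin (le_trans (FM x y))//.
      by rewrite ler_wpM2r ?mulr_ge0// ler_norm.
rewrite ge0_integralZl//=; last first.
- by move=> x _; rewrite mule_ge0// integral_ge0.
- by apply: emeasurable_funM.
rewrite ge0_integralZr//; last by apply: integral_ge0.
by rewrite lte_mul_pinfty// ?lte_mul_pinfty// ?fin_num_abs ?gee0_abs//;
  rewrite integral_ge0.
Qed.

(** Translation invariance of the inner integral reduces this domination to
    the L^1 norms of k and u. *)
Lemma integrable_conv_dom (F : R * R -> R) k u (M : R) :
  measurable_fun setT F -> bddint k -> bddint u ->
  (forall x y, `|F (x, y)| <= M * (`|k (x - y)| * `|u y|)) ->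
  (mu \x mu)%E.-integrable setT (EFin \o F).
Proof.
move=> mF bk bu FM; apply/integrable21ltyP; first exact/measurable_EFinP.
have /integrableP[mu' uoo] := bddint_integrable bu.
have mnu := measurableT_comp (@abse_measurable R setT) mu'.
have /integrableP[mk koo] := bddint_integrable bk.
have mnk := measurableT_comp (@abse_measurable R setT) mk.
have mFF : measurable_fun setT (fubini_G mu (abse \o (EFin \o F))).
  apply: measurable_fun_fubini_tonelli_G; last by move=> z; exact: abse_ge0.
  by apply: measurableT_comp => //; exact/measurable_EFinP.
apply: (@le_lt_trans _ _ (\int[mu]_y (`|M|%:E *
    (`|(u y)%:E| * \int[mu]_x `|(k x)%:E|)))%E).
  apply: ge0_le_integral => //.
  - by move=> x _; apply: integral_ge0.
  - by apply: emeasurable_funM => //; apply: emeasurable_funM.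
  - move=> y _.
    have mFs : measurable_fun setT (fun x => `|(F (x, y))%:E|%E).
      apply: measurableT_comp => //; apply/measurable_EFinP.
      exact: (measurableT_comp mF (pair2_measurable y)).
    have -> : (\int[mu]_x `|(k x)%:E| = \int[mu]_x `|(k (x - y))%:E|)%E.
      by apply/esym; exact: (ge0_integral_shift (- y) mnk (fun x => abse_ge0 _)).
    have mnk' : measurable_fun setT (fun x : R => `|(k (x - y))%:E|%E).
      by apply: (measurableT_comp mnk); exact: measurable_funB.
    rewrite -ge0_integralZl//.
    rewrite -ge0_integralZl//; last by apply: emeasurable_funM.
    apply: ge0_le_integral => //.
    + by apply: emeasurable_funM => //; apply: emeasurable_funM.
    + move=> x _; rewrite -!EFinM lee_fin (le_trans (FM x y))//.
      by rewrite [X in _ <= _ * X]mulrC ler_wpM2r ?mulr_ge0// ler_norm.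
rewrite ge0_integralZl//=; last first.
- by move=> x _; rewrite mule_ge0// integral_ge0.
- by apply: emeasurable_funM.
rewrite ge0_integralZr//; last by apply: integral_ge0.
by rewrite lte_mul_pinfty// ?lte_mul_pinfty// ?fin_num_abs ?gee0_abs//;
  rewrite integral_ge0.
Qed.

Lemma Rfubini (F : R * R -> R) : (mu \x mu)%E.-integrable setT (EFin \o F) ->
  (forall x, mu.-integrable setT (EFin \o (fun y => F (x, y)))) ->
  (forall y, mu.-integrable setT (EFin \o (fun x => F (x, y)))) ->
  \int[mu]_x \int[mu]_y F (x, y) = \int[mu]_y \int[mu]_x F (x, y).
Proof.
move=> IF I1 I2; rewrite {1 3}/Rintegral; congr fine.
transitivity (\int[mu]_x \int[mu]_y (F (x, y))%:E)%E.
  by apply: eq_integral => x _; exact: EFin_Rintegral.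
rewrite (Fubini IF).
by apply: eq_integral => x _; apply/esym; exact: EFin_Rintegral.
Qed.

Lemma integrable_Rint1 (F : R * R -> R) :
  (mu \x mu)%E.-integrable setT (EFin \o F) ->
  (forall x, mu.-integrable setT (EFin \o (fun y => F (x, y)))) ->
  mu.-integrable setT (EFin \o (fun x => \int[mu]_y F (x, y))).
Proof.
move=> IF I1; rewrite (_ : _ \o _ = fun x => (\int[mu]_y (F (x, y))%:E)%E).
  exact: (integrable_fubini_F IF).
by apply/funext => x; exact: EFin_Rintegral.
Qed.

Definition conv k u (x : R) : R := \int[mu]_y (k (x - y) * u y).

Lemma bddint_conv_integrand k u x : bddint k -> bddint u ->
  bddint (fun y => k (x - y) * u y).
Proof. by move=> bk bu; apply: bddintMb => //; exact: bddint_reflect. Qed.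

Lemma measurable_conv_integrand k u : bddint k -> bddint u ->
  measurable_fun setT (fun z : R * R => k (z.1 - z.2) * u z.2).
Proof.
move=> bk bu; apply: measurable_funM.
  by apply: measurable_diff_comp; exact: bddint_measurable.
by apply: measurable_snd_comp; exact: bddint_measurable.
Qed.

Lemma bddint_conv k u : bddint k -> bddint u -> bddint (conv k u).
Proof.
move=> bk bu; have I1 := fun x => bddint_integrable (bddint_conv_integrand x bk bu).
have IF : (mu \x mu)%E.-integrable setT
    (EFin \o (fun z : R * R => k (z.1 - z.2) * u z.2)).
  apply: (@integrable_conv_dom _ k u 1) => //.
    exact: measurable_conv_integrand.
  by move=> x y /=; rewrite mul1r normrM.
have Ic := integrable_Rint1 IF I1.
split => //.
  by have /integrableP[/measurable_EFinP] := Ic.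
have [M M0 kM] := bddint_bounded bk.
exists (M * \int[mu]_y `|u y|) => x.
rewrite (le_trans (le_norm_Rint (bddint_conv_integrand x bk bu)))//.
rewrite -RintZ; last exact: bddint_norm.
apply: le_Rint.
- by apply: bddint_norm; exact: bddint_conv_integrand.
- by apply: bddintZ; exact: bddint_norm.
- by move=> y; rewrite normrM ler_wpM2r.
Qed.

Lemma convDr k u w x : bddint k -> bddint u -> bddint w ->
  conv k (fun y => u y + w y) x = conv k u x + conv k w x.
Proof.
move=> bk bu bw; rewrite /conv -RintD; [|exact: bddint_conv_integrand..].
by apply: eq_Rintegral => y _; rewrite mulrDr.
Qed.

Lemma conv_suml I (r : seq I) (P : pred I) (K : I -> R -> R) u x :
  (forall i, P i -> bddint (K i)) -> bddint u ->
  conv (fun z => \sum_(i <- r | P i) K i z) u x = \sum_(i <- r | P i) conv (K i) u x.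
Proof.
move=> bK bu; rewrite /conv -Rint_sum; last first.
  by move=> i Pi; apply: bddint_conv_integrand => //; exact: bK.
by apply: eq_Rintegral => y _; rewrite mulr_suml.
Qed.

Lemma convZl c k u x : bddint k -> bddint u ->
  conv (fun z => c * k z) u x = c * conv k u x.
Proof.
move=> bk bu; rewrite /conv -RintZ; last exact: bddint_conv_integrand.
by apply: eq_Rintegral => y _; rewrite mulrA.
Qed.

(** Fubini's theorem for a convolution against a bounded weight.
    Associativity, the adjoint of a convolution and the transform of a
    convolution are the three choices of w made below. *)
Lemma Rint_weight_conv k u w : bddint k -> bddint u ->
  measurable_fun setT w -> (exists M : R, forall x, `|w x| <= M) ->
  \int[mu]_x (conv k u x * w x) =
  \int[mu]_y (\int[mu]_x (k (x - y) * w x) * u y).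
Proof.
move=> bk bu mw bw; have [M wM] := bw.
pose F (z : R * R) := k (z.1 - z.2) * u z.2 * w z.1.
transitivity (\int[mu]_x \int[mu]_y F (x, y)).
  apply: eq_Rintegral => x _; rewrite [RHS](_ : _ =
      \int[mu]_y (w x * (k (x - y) * u y))); last first.
    by apply: eq_Rintegral => y _; rewrite mulrC.
  by rewrite RintZ ?(mulrC (w x))//; exact: bddint_conv_integrand.
rewrite Rfubini.
- apply: eq_Rintegral => y _; rewrite mulrC -RintZ; last first.
    by apply: bddintM => //; apply: bddint_shift.
  by apply: eq_Rintegral => x _; rewrite /F/=; ring.
- apply: (@integrable_conv_dom _ k u M) => //.
    apply: measurable_funM; first exact: measurable_conv_integrand.
    exact: measurable_fst_comp.
  by move=> x y; rewrite /F/= !normrM mulrC ler_wpM2r ?mulr_ge0.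
- move=> x; apply: bddint_integrable.
  apply: (@bddintM _ (fun y => k (x - y) * u y) (fun=> w x)) => //.
    exact: bddint_conv_integrand.
  by exists M.
- move=> y; apply: bddint_integrable; apply: bddintM => //.
  rewrite (_ : (fun x => _) = fun x => u y * k (x - y)); last first.
    by apply/funext => x/=; rewrite mulrC.
  by apply: bddintZ; exact: bddint_shift.
Qed.

Lemma convA k l u x : bddint k -> bddint l -> bddint u ->
  conv k (conv l u) x = conv (conv k l) u x.
Proof.
move=> bk bl bu; rewrite /conv.
have bk' := bddint_reflect x bk.
have [mk' Mk' _] := bk'.
transitivity (\int[mu]_y (conv l u y * k (x - y))).
  by apply: eq_Rintegral => y _; rewrite mulrC.
rewrite (Rint_weight_conv bl bu mk' Mk'); apply: eq_Rintegral => z _.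
congr (_ * _).
rewrite -(@Rintegral_shift _ z).
  by apply: eq_Rintegral => y _; rewrite mulrC; congr (k _ * l _); ring.
apply: bddint_measurable; apply: bddintMb => //.
exact: bddint_shift.
Qed.

Lemma Rint_conv_adj k u w : bddint k -> bddint u -> bddint w ->
  \int[mu]_x (conv k u x * w x) =
  \int[mu]_y (conv (fun z => k (- z)) w y * u y).
Proof.
move=> bk bu bw; have [mw Mw _] := bw.
rewrite (Rint_weight_conv bk bu mw Mw); apply: eq_Rintegral => y _; congr (_ * _).
by apply: eq_Rintegral => x _; rewrite opprB.
Qed.

Lemma conv_reflect k u x : bddint k -> bddint u ->
  conv (fun z => k (- z)) u x = conv k (fun z => u (- z)) (- x).
Proof.
move=> bk bu; rewrite /conv -Rintegral_opp.
  by apply: eq_Rintegral => y _; rewrite opprB addrC.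
apply: bddint_measurable; apply: (@bddint_conv_integrand (fun z => k (- z))) => //.
exact: bddint_opp.
Qed.

End convolution.

(** * Almost orthogonality in L^2 *)

Section L2_theory.
Variable R : realType.
Local Notation mu := (@lebesgue_measure R).
Implicit Types f g k l u w : R -> R.

(** Two inequalities of Cauchy-Schwarz type follow from this, one for a pair
    of functions and one for a convolution. *)
Lemma discriminant_le (a b c : R) : 0 <= a ->
  (forall t, 0 <= a * t ^+ 2 - 2 * b * t + c) -> b ^+ 2 <= a * c.
Proof.
move=> a0 H; have [a_eq0|a_neq0] := eqVneq a 0.
  have [->|b0] := eqVneq b 0; first by rewrite a_eq0 mul0r expr0n.
  have := H ((c + 1) / (2 * b)); rewrite a_eq0 mul0r add0r.
  have -> : 2 * b * ((c + 1) / (2 * b)) = c + 1.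
    by field; rewrite b0.
  by move=> h; exfalso; lra.
have ap : 0 < a by rewrite lt_neqAle eq_sym a_neq0.
have := H (b / a).
have -> : a * (b / a) ^+ 2 - 2 * b * (b / a) + c = (a * c - b ^+ 2) / a.
  by field.
by rewrite pmulr_lge0 ?invr_gt0// subr_ge0.
Qed.

Lemma bddint_sqr f : bddint f -> bddint (fun x => f x ^+ 2).
Proof. by move=> bf; exact: (bddintMb bf bf). Qed.

Lemma Rint_cauchy_schwarz f g : bddint f -> bddint g ->
  (\int[mu]_x (f x * g x)) ^+ 2 <= \int[mu]_x (f x ^+ 2) * \int[mu]_x (g x ^+ 2).
Proof.
move=> bf bg; have bfg := bddintMb bf bg.
have bf2 := bddint_sqr bf; have bg2 := bddint_sqr bg.
apply: discriminant_le; first by apply: Rint_ge0 => x; exact: sqr_ge0.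
move=> t; have -> : \int[mu]_x (f x ^+ 2) * t ^+ 2 -
    2 * (\int[mu]_x (f x * g x)) * t + \int[mu]_x (g x ^+ 2) =
    \int[mu]_x ((t * f x - g x) ^+ 2).
  rewrite mulrC -mulrA -(mulrC t) -RintZ // -RintZ//.
  rewrite -RintZ; last exact: bddintZ.
  rewrite -RintB; [|exact: bddintZ|by do 2 apply: bddintZ].
  rewrite -RintD//; last by apply: bddintB; do ?apply: bddintZ.
  by apply: eq_Rintegral => x _; ring.
by apply: Rint_ge0 => x; exact: sqr_ge0.
Qed.

Lemma Rint_conv k u : bddint k -> bddint u ->
  \int[mu]_x conv k u x = \int[mu]_x k x * \int[mu]_x u x.
Proof.
move=> bk bu.
transitivity (\int[mu]_x (conv k u x * 1)).
  by apply: eq_Rintegral => x _; rewrite mulr1.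
rewrite (@Rint_weight_conv _ _ _ (fun=> 1))//; last first.
  by exists 1 => _; rewrite normr1.
rewrite -(RintZ _ bu); apply: eq_Rintegral => y _; congr (_ * _).
rewrite -(Rintegral_shift (- y) (bddint_measurable bk)).
by apply: eq_Rintegral => x _; rewrite mulr1.
Qed.

Lemma convC k u x : bddint k -> bddint u -> conv k u x = conv u k x.
Proof.
move=> bk bu; rewrite /conv -(@Rintegral_reflect _ x).
  by apply: eq_Rintegral => y _; rewrite mulrC; congr (_ * k _); ring.
by apply: bddint_measurable; apply: bddint_conv_integrand.
Qed.

(** Cauchy-Schwarz for the measure |k (x - y)| dy; integrating it in x gives
    Young's inequality in L^2. *)
Lemma conv_sqr_le k u x : bddint k -> bddint u ->
  (conv k u x) ^+ 2 <=
  \int[mu]_y `|k y| * conv (fun z => `|k z|) (fun y => u y ^+ 2) x.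
Proof.
move=> bk bu; have bnk := bddint_norm bk; have bnu := bddint_norm bu.
apply: (@le_trans _ _ (conv (fun z => `|k z|) (fun z => `|u z|) x ^+ 2)).
  rewrite -real_normK ?num_real// lerXn2r ?nnegrE//; last first.
    rewrite (le_trans (le_norm_Rint _))//; first exact: bddint_conv_integrand.
    rewrite /conv le_eqVlt; apply/orP; left; apply/eqP.
    by apply: eq_Rintegral => y _; rewrite normrM.
  by apply: Rint_ge0 => y; rewrite mulr_ge0.
apply: discriminant_le; first by apply: Rint_ge0 => y.
move=> t; rewrite -(Rintegral_reflect x (bddint_measurable bnk)).
have b1 := bddint_reflect x bnk.
have b2 : bddint (fun y => `|k (x - y)| * `|u y|) by exact: bddintMb.
have b3 : bddint (fun y => `|k (x - y)| * u y ^+ 2).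
  by apply: bddintMb => //; exact: bddint_sqr.
rewrite mulrC -mulrA -(mulrC t) /conv -RintZ// -RintZ// -RintZ; last exact: bddintZ.
rewrite -RintB; [|exact: bddintZ|by do 2 apply: bddintZ].
rewrite -RintD//; last by apply: bddintB; do ?apply: bddintZ.
apply: Rint_ge0 => y; rewrite (_ : _ + _ = `|k (x - y)| * (t - `|u y|) ^+ 2).
  by rewrite mulr_ge0// sqr_ge0.
by rewrite -[u y ^+ 2]real_normK ?num_real//; ring.
Qed.

Lemma young_L2 k u : bddint k -> bddint u ->
  \int[mu]_x (conv k u x ^+ 2) <=
  (\int[mu]_y `|k y|) ^+ 2 * \int[mu]_x (u x ^+ 2).
Proof.
move=> bk bu; have bnk := bddint_norm bk; have bu2 := bddint_sqr bu.
rewrite expr2 -mulrA -(Rint_conv bnk bu2) -RintZ; last exact: bddint_conv.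
apply: le_Rint.
- by apply: bddint_sqr; exact: bddint_conv.
- by apply: bddintZ; exact: bddint_conv.
- by move=> x; exact: conv_sqr_le.
Qed.

(** Moving k to the other factor turns the pairing into one with the
    convolution of the reflected kernel and l. *)
Lemma conv_orthogonal k l f g : bddint k -> bddint l -> bddint f -> bddint g ->
  (forall t, conv (fun z => k (- z)) l t = 0) ->
  \int[mu]_x (conv k f x * conv l g x) = 0.
Proof.
move=> bk bl bf bg H; rewrite Rint_conv_adj//; last exact: bddint_conv.
rewrite (@eq_Rintegral _ _ _ mu setT (fun=> 0)).
  by rewrite /Rintegral integral0.
move=> y _; rewrite convA//; last exact: bddint_opp.
rewrite (_ : conv _ _ _ = 0) ?mul0r// {1}/conv.
rewrite (@eq_Rintegral _ _ _ mu setT (fun=> 0)).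
  by rewrite /Rintegral integral0.
by move=> z _; rewrite H mul0r.
Qed.

(** Splitting the indices modulo 3 gives three orthogonal families, since
    distinct indices in the same class are at least 3 apart. *)
Lemma almost_orthogonal_sum (w : nat -> R -> R) (N : nat) :
  (forall i, bddint (w i)) ->
  (forall i j, (i + 2 < j)%N -> \int[mu]_x (w i x * w j x) = 0) ->
  \int[mu]_x ((\sum_(i < N) w i x) ^+ 2) <= 3 * \sum_(i < N) \int[mu]_x (w i x ^+ 2).
Proof.
move=> bw ow.
pose W r x := \sum_(i < N | (i %% 3)%N == r) w i x.
have bW r : bddint (W r) by apply: bddint_sum.
have ortho r n : \int[mu]_x ((\sum_(i < n | (i %% 3)%N == r) w i x) ^+ 2) =
    \sum_(i < n | (i %% 3)%N == r) \int[mu]_x (w i x ^+ 2).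
  elim: n => [|n ih].
    rewrite big_ord0 (@eq_Rintegral _ _ _ mu setT (fun=> 0)).
      by rewrite /Rintegral integral0.
    by move=> x _; rewrite big_ord0 expr0n.
  set S := fun x => \sum_(i < n | (i %% 3)%N == r) w i x.
  have recr (F : nat -> R) : \sum_(i < n.+1 | (i %% 3)%N == r) F i =
      \sum_(i < n | (i %% 3)%N == r) F i + (if (n %% 3)%N == r then F n else 0).
    by rewrite big_mkcond big_ord_recr/= -big_mkcond.
  rewrite (recr (fun i => \int[mu]_x (w i x ^+ 2))) -ih (@eq_Rintegral _ _ _ mu setT (fun x =>
    (S x + (if (n %% 3)%N == r then w n x else 0)) ^+ 2)); last first.
    by move=> x _; rewrite (recr (w ^~ x)).
  case: ifPn => [/eqP nr|_]; last first.
    by rewrite addr0; apply: eq_Rintegral => x _; rewrite addr0.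
  have bS : bddint S by apply: bddint_sum.
  transitivity (\int[mu]_x (S x ^+ 2 + 2 * (S x * w n x) + w n x ^+ 2)).
    by apply: eq_Rintegral => x _; rewrite /S; ring.
  have bSw : bddint (fun x => S x * w n x) by exact: bddintMb.
  rewrite RintD; last 2 first.
  - by apply: bddintD; [exact: bddint_sqr|exact: bddintZ].
  - exact: bddint_sqr.
  rewrite RintD ?RintZ//; [|exact: bddint_sqr|exact: bddintZ].
  rewrite [X in 2 * X](_ : _ = 0) ?mulr0 ?addr0// /S.
  under eq_Rintegral do rewrite mulr_suml.
  rewrite Rint_sum; last by move=> i _; exact: bddintMb.
  rewrite big1// => i /eqP ir; apply: ow.
  have := ltn_ord i; move: ir nr; move: (nat_of_ord i) => m.
  by move=> <- /eqP; rewrite eq_sym; move=> /eqP h1 h2; lia.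
have split3 (F : nat -> R) : \sum_(i < N) F i =
    \sum_(i < N | (i %% 3)%N == 0) F i + \sum_(i < N | (i %% 3)%N == 1) F i
    + \sum_(i < N | (i %% 3)%N == 2) F i.
  rewrite (big_mkcond (fun i : 'I_N => (i %% 3)%N == 0))
    (big_mkcond (fun i : 'I_N => (i %% 3)%N == 1))
    (big_mkcond (fun i : 'I_N => (i %% 3)%N == 2)) -!big_split/=; apply: eq_bigr => i _.
  have := ltn_pmod i (isT : (0 < 3)%N).
  by case: (i %% 3)%N => [|[|[|]]]//= _; rewrite ?addr0 ?add0r.
rewrite (split3 (fun i => \int[mu]_x (w i x ^+ 2))) -!ortho.
apply: (@le_trans _ _ (\int[mu]_x (3 * (W 0%N x ^+ 2 + W 1%N x ^+ 2 + W 2%N x ^+ 2)))).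
  apply: le_Rint.
  - by apply: bddint_sqr; exact: bddint_sum.
  - by apply: bddintZ; apply: bddintD; [apply: bddintD|]; exact: bddint_sqr.
  - move=> x; rewrite (split3 (w ^~ x)) -/(W 0%N x) -/(W 1%N x) -/(W 2%N x).
    rewrite -subr_ge0; set a := W 0%N x; set b := W 1%N x; set c := W 2%N x.
    rewrite (_ : _ - _ = (a - b) ^+ 2 + (b - c) ^+ 2 + (a - c) ^+ 2); last by ring.
    by rewrite !addr_ge0// sqr_ge0.
rewrite RintZ; last by apply: bddintD; [apply: bddintD|]; exact: bddint_sqr.
rewrite RintD; [|by apply: bddintD; exact: bddint_sqr|exact: bddint_sqr].
by rewrite RintD//; exact: bddint_sqr.
Qed.

Section square_function_L2.
Variables (psi : nat -> R -> R) (M : R) (N : nat).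
Hypothesis bpsi : forall i, bddint (psi i).
Hypothesis psiM : forall i, \int[mu]_x `|psi i x| <= M.
Hypothesis psio : forall i j, (i + 2 < j)%N || (j + 2 < i)%N ->
  forall t, conv (fun z => psi i (- z)) (psi j) t = 0.

Let M_ge0 : 0 <= M.
Proof. by apply: le_trans (psiM 0); apply: Rint_ge0. Qed.

(** Call X the left-hand side. It is the pairing of u with the sum of the w_i,
    where w_i applies the reflected kernel of psi i to conv (psi i) u. The w_i
    are almost orthogonal, so the squared L^2 norm of that sum is at most 3
    M^2 X; Cauchy-Schwarz then bounds X^2 by a multiple of X, and X cancels. *)
Lemma L2_square_function u : bddint u ->
  \sum_(i < N) \int[mu]_x (conv (psi i) u x ^+ 2) <=
  3 * M ^+ 2 * \int[mu]_x (u x ^+ 2).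
Proof.
move=> bu; set X := \sum_(i < N) _; set U := \int[mu]_x (u x ^+ 2).
pose v i := conv (psi i) u; have bv i : bddint (v i) by exact: bddint_conv.
pose w i := conv (fun z => psi i (- z)) (v i).
have bpsi' i : bddint (fun z => psi i (- z)) by exact: bddint_opp.
have bw i : bddint (w i) by exact: bddint_conv.
have X0 : 0 <= X.
  by apply: sumr_ge0 => i _; apply: Rint_ge0 => x; exact: sqr_ge0.
have U0 : 0 <= U by apply: Rint_ge0 => x; exact: sqr_ge0.
have XE : X = \int[mu]_x ((\sum_(i < N) w i x) * u x).
  under eq_Rintegral do rewrite mulr_suml.
  rewrite Rint_sum; last by move=> i _; exact: bddintMb.
  apply: eq_bigr => i _; rewrite -Rint_conv_adj//.
have ow i j : (i + 2 < j)%N -> \int[mu]_x (w i x * w j x) = 0.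
  move=> ij; apply: conv_orthogonal => // t.
  have -> : (fun z => psi i (- - z)) = psi i.
    by apply/funext => z; rewrite opprK.
  by rewrite convC//; apply: psio; rewrite ij orbT.
have wv i : \int[mu]_x (w i x ^+ 2) <= M ^+ 2 * \int[mu]_x (v i x ^+ 2).
  apply: (le_trans (young_L2 _ _)) => //.
  apply: ler_wpM2r; first by apply: Rint_ge0 => x; exact: sqr_ge0.
  rewrite lerXn2r ?nnegrE//; first by apply: Rint_ge0.
  by rewrite (Rintegral_opp (f := fun y => `|psi i y|))//; by apply: bddint_measurable; apply: bddint_norm.
have XX : X ^+ 2 <= X * (3 * M ^+ 2 * U).
  rewrite {1}XE.
  apply: (le_trans (Rint_cauchy_schwarz _ _)) => //; first exact: bddint_sum.
  rewrite -/U mulrA ler_wpM2r//.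
  apply: (le_trans (almost_orthogonal_sum N bw ow)).
  rewrite mulrCA; apply: ler_wpM2l => //.
  rewrite mulrC mulr_sumr; apply: ler_sum => i _; exact: wv.
have [->|Xn0] := eqVneq X 0; first by rewrite mulr_ge0// mulr_ge0// sqr_ge0.
by move: XX; rewrite expr2 ler_pM2l// lt_neqAle eq_sym Xn0.
Qed.

(** Signs preserve orthogonality, so almost_orthogonal_sum reduces the claim
    to L2_square_function. *)
Lemma L2_signed_sum (eps : nat -> R) u : (forall i, `|eps i| <= 1) -> bddint u ->
  \int[mu]_x (conv (fun z => \sum_(i < N) eps i * psi i z) u x ^+ 2) <=
  9 * M ^+ 2 * \int[mu]_x (u x ^+ 2).
Proof.
move=> e1 bu.
pose w i x := eps i * conv (psi i) u x.
have bw i : bddint (w i) by apply: bddintZ; exact: bddint_conv.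
have ow i j : (i + 2 < j)%N -> \int[mu]_x (w i x * w j x) = 0.
  move=> ij; transitivity (\int[mu]_x (eps i * eps j * (conv (psi i) u x * conv (psi j) u x))).
    by apply: eq_Rintegral => x _; rewrite /w; ring.
  rewrite RintZ; last by apply: bddintMb; exact: bddint_conv.
  by rewrite conv_orthogonal ?mulr0// => t; apply: psio; rewrite ij.
under eq_Rintegral.
  move=> x _; rewrite conv_suml//; last by move=> i _; exact: bddintZ.
  under eq_bigr do rewrite convZl//.
  over.
apply: (le_trans (almost_orthogonal_sum N bw ow)).
have -> : 9 * M ^+ 2 = 3 * (3 * M ^+ 2) by ring.
rewrite -mulrA ler_wpM2l//; apply: le_trans (L2_square_function bu).
apply: ler_sum => i _; apply: le_Rint.
- exact: bddint_sqr.
- by apply: bddint_sqr; exact: bddint_conv.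
- move=> x; rewrite /w exprMn -[leRHS]mul1r ler_wpM2r ?sqr_ge0//.
  by rewrite -real_normK ?num_real// exprn_ile1.
Qed.

End square_function_L2.
End L2_theory.

(** * Components of open sets and the maximal function *)

Section open_components.
Variable R : realType.
Local Notation mu := (@lebesgue_measure R).

Lemma open_interval_oo (I : set R) : open I -> is_interval I -> I !=set0 ->
  (mu I < +oo)%E -> exists a b, a < b /\ I = `]a, b[%classic.
Proof.
move=> oI iI [z0 Iz0] Ioo.
have mI : measurable I by exact: open_measurable.
have If : mu I \is a fin_num by rewrite ge0_fin_numE.
have len y z : I y -> I z -> y <= z -> z - y <= fine (mu I).
  move=> Iy Iz yz; rewrite -lee_fin fineK//.
  have -> : (z - y)%:E = mu `[y, z]%classic.
    rewrite lebesgue_measure_itv/= lte_fin; case: ltP => // zy.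
    by have -> : z = y; [apply/eqP; rewrite eq_le yz zy|rewrite subrr].
  apply: le_measure; rewrite ?inE//.
  by move=> t /=; rewrite in_itv/= => yzt; exact: (iI y z).
have supI : has_sup I.
  split; first by exists z0.
  exists (z0 + fine (mu I)) => z Iz; have [zz0|/ltW zz0] := leP z0 z.
    by rewrite -lerBlDl len.
  by rewrite (le_trans zz0)// lerDl fine_ge0.
have infI : has_inf I.
  split; first by exists z0.
  exists (z0 - fine (mu I)) => z Iz; have [zz0|/ltW zz0] := leP z z0.
    by rewrite lerBlDl -lerBlDr len.
  by rewrite (le_trans _ zz0)// gerBl fine_ge0.
have nb x : I x -> exists2 e, 0 < e & I (x - e) /\ I (x + e).
  move=> Ix; have /nbhs_ballP[e /= e0 eI] := oI x Ix.
  exists (e / 2); first by rewrite divr_gt0.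
  by split; apply: eI; rewrite /ball/= ?opprD ?opprB ?addrA ?subrr ?add0r ?normrN
    ?addrNK ?(addrC x) ?addrK ?subKr ?gtr0_norm ?divr_gt0 ?ltr_pdivrMr ?ltr_pMr ?ltr1n//;
    rewrite ?opprD ?opprK ?addNKr ?normrN ?gtr0_norm; lra.
have HI x : I x <-> inf I < x < sup I.
  split.
    move=> /nb[e e0 [I1 I2]]; apply/andP; split.
      by apply: le_lt_trans (ge_inf infI.2 I1) _; rewrite gtrBl.
    by apply: lt_le_trans (ub_le_sup supI.2 I2); rewrite ltrDl.
  move=> /andP[h1 h2].
  have [y Iy yx] := inf_lt infI.1 h1; have [z Iz xz] := sup_gt supI.1 h2.
  by apply: (iI y z) => //; rewrite (ltW yx) (ltW xz).
exists (inf I), (sup I); split.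
  by have /HI/andP[] := Iz0; exact: lt_trans.
by apply/seteqP; split => x; rewrite /= in_itv/= => /HI.
Qed.

(** The last clause is the point: the left endpoint of a nonempty component
    lies outside U, so that the maximal function is small there. Empty blocks
    pad the enumeration, whence the guard a n < b n. *)
Lemma open_components (U : set R) : open U -> (mu U < +oo)%E ->
  exists a b : nat -> R, [/\ trivIset setT (fun n => `]a n, b n[%classic),
    U = \bigcup_n `]a n, b n[%classic, (forall n, a n <= b n) &
    forall n, a n < b n -> ~ U (a n)].
Proof.
move=> oU Uoo.
pose I := open_disjoint_itv oU.
have UI := open_disjoint_itv_bigcup oU.
have tI := @open_disjoint_itv_trivIset _ _ oU.
have mU : measurable U by exact: open_measurable.
have key n : exists p : R * R, [/\ I n = `]p.1, p.2[%classic, p.1 <= p.2 &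
    (p.1 < p.2 -> ~ U p.1)].
  have oIn : open (I n) by exact: open_disjoint_itv_open.
  have [In0|/set0P In0] := eqVneq (I n) set0.
    exists (0, 0) => /=; split => //; last by rewrite ltxx.
    rewrite In0; apply/seteqP; split => // x/=.
    by rewrite in_itv/= => /andP[h1 h2]; have := lt_trans h1 h2; rewrite ltxx.
  have iIn : is_interval (I n) by exact: open_disjoint_itv_is_interval.
  have InU : I n `<=` U by rewrite UI; exact: bigcup_sup.
  have Inoo : (mu (I n) < +oo)%E.
    by apply: le_lt_trans Uoo; apply: le_measure; rewrite ?inE//;
      exact: open_measurable.
  have [a [b [ab Eab]]] := open_interval_oo oIn iIn In0 Inoo.
  exists (a, b) => /=; split => //; first exact: ltW.
  move=> _; rewrite UI => -[m _ Ima].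
  have nm : n != m.
    apply/eqP => nm; move: Ima; rewrite -nm -/(I n) Eab /=.
    by rewrite in_itv/= ltxx.
  have oIm : open (I m) by exact: open_disjoint_itv_open.
  have /nbhs_ballP[e /= e0 eI] := oIm a Ima.
  (* a point of the interval just to the right of a would lie in two components *)
  pose d := Num.min (e / 2) ((b - a) / 2).
  have d0 : 0 < d by rewrite lt_min !divr_gt0// subr_gt0.
  have de : d < e.
    by rewrite gt_min; apply/orP; left; rewrite ltr_pdivrMr// ltr_pMr// ltr1n.
  have db : d < b - a.
    rewrite gt_min; apply/orP; right; rewrite ltr_pdivrMr// ltr_pMr ?ltr1n//.
    by rewrite subr_gt0.
  have h1 : I m (a + d).
    apply: eI; rewrite /ball/= opprD addrA subrr add0r normrN gtr0_norm//.
  have h2 : I n (a + d).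
    by rewrite Eab/= in_itv/= ltrDl d0/= -ltrBrDl.
  move/trivIsetP : tI => /(_ n m Logic.I Logic.I nm).
  by apply/eqP/set0P; exists (a + d).
pose p n := sval (cid (key n)).
have pP n := svalP (cid (key n)).
have Ep : I = fun n => `](p n).1, (p n).2[%classic.
  by apply/funext => n; have [] := pP n.
exists (fun n => (p n).1), (fun n => (p n).2); split.
- by rewrite -Ep.
- by rewrite -Ep.
- by move=> n; have [] := pP n.
- by move=> n; have [] := pP n.
Qed.

End open_components.

Section maximal_function.
Variable R : realType.
Local Notation mu := (@lebesgue_measure R).
Implicit Type f : R -> R.

Lemma bddint_locally_integrable f : bddint f -> locally_integrable setT f.
Proof.
by move=> bf; apply: open_integrable_locally; [exact: openT|exact: bddint_integrable].
Qed.

Lemma HL_maximal_open f (l : R) : locally_integrable setT f ->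
  open [set x | (l%:E < HL_maximal f x)%E].
Proof.
by move=> /lower_semicontinuous_HL_maximal/lower_semicontinuousP; apply.
Qed.

(** At a Lebesgue point x, |f x| is at most the maximal function plus the
    average of |f - f x| over a ball, and that average tends to 0. *)
Lemma ae_le_HL_maximal f : locally_integrable setT f ->
  {ae mu, forall x, (`|f x|%:E <= HL_maximal f x)%E}.
Proof.
move=> lf; have [mf _ _] := lf.
apply: negligibleS (lebesgue_differentiation lf) => x /= nx fx; apply: nx.
have H r : 0 < r -> (`|f x|%:E <= HL_maximal f x + davg f x r)%E.
  move=> r0.
  have bm : (0 < mu (ball x r))%E.
    by rewrite lebesgue_measure_ball ?ltW// lte_fin mulrn_wgt0.
  have bf : mu (ball x r) \is a fin_num by rewrite lebesgue_measure_ball ?ltW.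
  have mb : measurable (ball x r) by exact: measurable_ball.
  have -> : (`|f x|%:E = iavg (f \+ (fun y => f x - f y))%R (ball x r))%E.
    rewrite /iavg.
    under eq_integral do rewrite /= addrC subrK.
    rewrite integral_cst// muleC -muleA divee ?mule1// gt_eqF//.
  apply: (le_trans (iavgD _ _ _ _)) => //.
  - by rewrite ltey_eq bf.
  - exact: measurable_funTS.
  - by apply: measurable_funTS; exact: measurable_funB.
  apply: leeD.
    by apply: ereal_sup_ubound; exists r => //=; rewrite in_itv/= r0.
  rewrite /davg /iavg le_eqVlt; apply/orP; left; apply/eqP; congr (_ * _)%E.
  by apply: eq_integral => y _; rewrite /= distrC.
have [->|HLfin] := eqVneq (HL_maximal f x) +oo%E; first exact: leey.
have HLf : HL_maximal f x \is a fin_num.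
  by rewrite ge0_fin_numE ?ltey//; exact: HL_maximalT_ge0.
suff : (`|f x|%:E - HL_maximal f x <= 0)%E by rewrite sube_le0.
rewrite /lebesgue_pt in fx.
apply: (@cvge_ge _ _ _ _ (fun r => davg f x r) _ _ _ fx).
near=> r; rewrite leeBlDl//; apply: H; near: r; exact: nbhs_right_gt.
Unshelve. all: by end_near. Qed.

End maximal_function.

(** * The Calderon-Zygmund decomposition *)

Section calderon_zygmund_decomposition.
Variable R : realType.
Local Notation mu := (@lebesgue_measure R).
Implicit Types f b c : R -> R.

Section decomposition.
Variables (f : R -> R) (lam : R) (U : set R) (l r : nat -> R).
Hypotheses (bf : bddint f) (lam_gt0 : 0 < lam).
Hypothesis UE : U = [set x | (lam%:E < HL_maximal f x)%E].
Local Notation J n := (`]l n, r n[%classic).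
Hypotheses (tJ : trivIset setT (fun n => J n)) (UJ : U = \bigcup_n J n)
  (lr : forall n, l n <= r n) (lU : forall n, l n < r n -> ~ U (l n)).

Let mf : measurable_fun setT f. Proof. exact: bddint_measurable. Qed.

Let mU : measurable U. Proof. by rewrite UJ; exact: bigcupT_measurable. Qed.

Let muJ n : mu (J n) = (r n - l n)%:E.
Proof.
rewrite lebesgue_measure_itv/= lte_fin; case: ltP => // rl.
by have -> : r n = l n; [apply/eqP; rewrite eq_le rl lr|rewrite subrr].
Qed.

Let idx y : nat := xget 0%N [set n | J n y].

Let idxE n y : J n y -> idx y = n.
Proof.
move=> Jy; rewrite /idx; case: xgetP => [m _ Jm|/(_ n)//].
apply/eqP; apply: contraT => mn; move/trivIsetP : tJ => /(_ m n Logic.I Logic.I mn) E.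
have : (J m `&` J n) y by split.
by rewrite E.
Qed.

(** Block averages and block centres are both functions of this form. *)
Definition blockwise (h : nat -> R) : R -> R := (fun y => h (idx y)) \_ U.

Let blockwise_in h n y : J n y -> blockwise h y = h n.
Proof.
move=> Jy; rewrite /blockwise patchE mem_set ?(idxE Jy)//.
by rewrite UJ; exists n.
Qed.

Let blockwise_out h y : ~ U y -> blockwise h y = 0.
Proof. by move=> Uy; rewrite /blockwise patchE memNset. Qed.

Lemma measurable_blockwise h : measurable_fun setT (blockwise h).
Proof.
apply/(measurable_restrictT _ mU); rewrite UJ.
apply/measurable_fun_bigcup => // n.
apply: (@eq_measurable_fun _ _ _ _ _ (cst (h n))) => //.
by move=> y /set_mem Jy; rewrite /= (idxE Jy).
Qed.

Definition block_mean n := (\int[mu]_(y in J n) f y) / (r n - l n).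

Let IfJ n : mu.-integrable (J n) (EFin \o f).
Proof. exact: (integrableS measurableT _ _ (bddint_integrable bf)). Qed.

(** The ball centred at the left endpoint with radius the length of the block
    contains the block. The endpoint lies outside U, so the average of |f|
    over that ball is at most lam. *)
Let block_norm n : (\int[mu]_(y in J n) `|f y|%:E <= (2 * lam * (r n - l n))%:E)%E.
Proof.
have [lrn|rln] := ltP (l n) (r n); last first.
  rewrite set_itv_ge ?integral_set0; last by rewrite bnd_simp -leNgt.
  by rewrite lee_fin mulr_ge0 ?subr_ge0// mulr_ge0// ltW.
have := lU lrn; rewrite {1}UE /= => /negP; rewrite -leNgt => HLl.
pose d := r n - l n; have d0 : 0 < d by rewrite subr_gt0.
have : (iavg f (ball (l n) d) <= lam%:E)%E.
  apply: le_trans HLl; apply: ereal_sup_ubound; exists d => //=.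
  by rewrite in_itv/= d0.
rewrite /iavg (lebesgue_measure_ball _ (ltW d0)) inver mulrn_eq0/= gt_eqF//.
rewrite lee_pdivrMl ?mulrn_wgt0// -EFinM => H.
apply: (@le_trans _ _ (\int[mu]_(y in ball (l n) d) `|(f y)%:E|)%E).
  apply: ge0_subset_integral => //.
  - exact: measurable_ball.
  - by apply/measurable_EFinP; apply: measurableT_comp => //; exact: measurable_funTS.
  - move=> y; rewrite /ball/= in_itv/= => /andP[h1 h2].
    by rewrite distrC ger0_norm ?subr_ge0 ?ltW// /d ltrD2r.
by apply: (le_trans H); rewrite lee_fin -/d mulr2n; lra.
Qed.

Let block_mean_norm n :
  (`|block_mean n|%:E * mu (J n) <= \int[mu]_(y in J n) `|f y|%:E)%E.
Proof.
rewrite muJ -EFinM.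
have [lrn|rln] := ltP (l n) (r n); last first.
  have -> : r n = l n by apply/eqP; rewrite eq_le rln lr.
  by rewrite subrr mulr0 integral_ge0.
rewrite normrM normfV (gtr0_norm (x := r n - l n)) ?subr_gt0//.
rewrite mulfVK ?gt_eqF ?subr_gt0// EFin_normr_Rintegral//.
apply: le_abse_integral => //; apply/measurable_EFinP.
exact: measurable_funTS.
Qed.

Let block_mean_le n : `|block_mean n| <= 2 * lam.
Proof.
have [lrn|rln] := ltP (l n) (r n); last first.
  have E : r n = l n by apply/eqP; rewrite eq_le rln lr.
  by rewrite /block_mean E subrr invr0 mulr0 normr0 mulr_ge0// ltW.
have := le_trans (block_mean_norm n) (block_norm n).
by rewrite muJ -EFinM lee_fin ler_pM2r// subr_gt0.
Qed.

Definition mean_part := blockwise block_mean.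

Let mean_part_le y : `|mean_part y| <= 2 * lam.
Proof.
have [[n _ Jy]|nU] : (\bigcup_n J n) y \/ ~ U y by rewrite -UJ; exact: EM.
  by rewrite /mean_part (blockwise_in _ Jy).
by rewrite /mean_part blockwise_out// normr0 mulr_ge0// ltW.
Qed.

Let measurable_absf (D : set R) : measurable_fun D (fun y => `|f y|%:E).
Proof.
by apply/measurable_EFinP; apply: measurableT_comp => //; exact: measurable_funTS.
Qed.

Let mean_part_norm :
  (\int[mu]_y `|mean_part y|%:E <= \int[mu]_(y in U) `|f y|%:E)%E.
Proof.
have mM : measurable_fun setT (fun y => `|mean_part y|%:E).
  by apply/measurable_EFinP; apply: measurableT_comp => //; exact: measurable_blockwise.
rewrite [leLHS](_ : _ = \int[mu]_(y in U) `|mean_part y|%:E)%E; last first.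
  rewrite [RHS]integral_mkcond; apply: eq_integral => y _.
  rewrite patchE; case: ifPn => // /negP; rewrite inE => nU.
  by rewrite /mean_part blockwise_out// normr0.
rewrite UJ ge0_integral_bigcup//; last exact: measurable_funTS.
rewrite ge0_integral_bigcup//; last exact: measurable_absf.
apply: lee_nneseries => [n _ _|n _]; first by apply: integral_ge0.
apply: le_trans (block_mean_norm n).
rewrite -integral_cst// le_eqVlt; apply/orP; left; apply/eqP.
by apply: eq_integral => y /set_mem Jy; rewrite /mean_part (blockwise_in _ Jy).
Qed.

Let U_norm_le : (\int[mu]_(y in U) `|f y|%:E <= (\int[mu]_y `|f y|)%:E)%E.
Proof.
rewrite EFin_Rintegral; last by apply: bddint_integrable; exact: bddint_norm.
by apply: ge0_subset_integral => //; exact: measurable_absf.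
Qed.

Lemma bddint_mean_part : bddint mean_part.
Proof.
split; [exact: measurable_blockwise|by exists (2 * lam)|].
apply/integrableP; split; first by apply/measurable_EFinP; exact: measurable_blockwise.
by apply: le_lt_trans (le_trans mean_part_norm U_norm_le) (ltry _).
Qed.

Definition bad_part := fun y => (f \_ U) y - mean_part y.

Let bddint_restrict (D : set R) : measurable D -> bddint (f \_ D).
Proof.
move=> mD; apply: (@bddint_dom _ f _ 1) => //.
  by apply/(measurable_restrictT _ mD); exact: measurable_funTS.
by move=> x; rewrite mul1r patchE; case: ifP => //; rewrite normr0.
Qed.

Lemma bddint_bad_part : bddint bad_part.
Proof. by apply: bddintB; [exact: bddint_restrict|exact: bddint_mean_part]. Qed.

Lemma bad_part_norm : \int[mu]_y `|bad_part y| <= 2 * \int[mu]_y `|f y|.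
Proof.
have bM := bddint_norm bddint_mean_part.
have bfU := bddint_norm (bddint_restrict mU).
apply: (@le_trans _ _ (\int[mu]_y (`|(f \_ U) y| + `|mean_part y|))).
  apply: le_Rint; [exact: bddint_norm bddint_bad_part|exact: bddintD|].
  by move=> x; exact: ler_normB.
rewrite RintD// mulr_natl mulr2n; apply: lerD.
  apply: le_Rint => //; first exact: bddint_norm.
  by move=> x; rewrite patchE; case: ifP => //; rewrite normr0.
rewrite -lee_fin EFin_Rintegral; last exact: bddint_integrable.
exact: (le_trans mean_part_norm).
Qed.

(** Off U the good part equals f, which is at most lam almost everywhere by
    ae_le_HL_maximal; on U it is a block average, at most 2 lam. Hence its
    square is at most 2 lam times its modulus. *)
Lemma good_part_sqr :
  \int[mu]_y ((f y - bad_part y) ^+ 2) <= 2 * lam * \int[mu]_y `|f y|.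
Proof.
have bg := bddintB bf bddint_bad_part.
have gE y : f y - bad_part y = (f \_ (~` U)) y + mean_part y.
  rewrite /bad_part opprB addrCA addrC; congr (_ + _).
  by rewrite !patchE in_setC; case: ifP => /=; rewrite ?subrr ?subr0.
have bM := bddint_norm bddint_mean_part.
have bfC := bddint_norm (bddint_restrict (measurableC mU)).
have gae : {ae mu, forall y, setT y ->
    ((f y - bad_part y) ^+ 2)%:E <= (2 * lam * `|f y - bad_part y|)%:E}%E.
  apply: negligibleS (ae_le_HL_maximal (bddint_locally_integrable bf)) => y /= nH H.
  apply: nH => _; rewrite lee_fin -real_normK ?num_real// expr2.
  rewrite ler_wpM2r// gE.
  have [Uy|nUy] := EM (U y).
    by rewrite patchE memNset ?add0r.
  rewrite /mean_part blockwise_out// addr0 patchE mem_set//.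
  move: nUy; rewrite {1}UE /= => /negP; rewrite -leNgt => /(le_trans H).
  by rewrite lee_fin => h; apply: (le_trans h); move: lam_gt0; lra.
apply: (@le_trans _ _ (2 * lam * \int[mu]_y `|f y - bad_part y|)).
  rewrite -RintZ; last exact: bddint_norm.
  rewrite -lee_fin !EFin_Rintegral; last 2 first.
  - by apply: bddint_integrable; apply: bddintZ; exact: bddint_norm.
  - by apply: bddint_integrable; exact: bddint_sqr.
  apply: ae_ge0_le_integral => //.
  - by move=> x _; rewrite lee_fin sqr_ge0.
  - by apply/measurable_EFinP; apply: bddint_measurable; exact: bddint_sqr.
  - by move=> x _; rewrite lee_fin !mulr_ge0// ltW.
  - apply/measurable_EFinP; apply: bddint_measurable; apply: bddintZ.
    exact: bddint_norm.
apply: ler_wpM2l; first by rewrite mulr_ge0// ltW.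
apply: (@le_trans _ _ (\int[mu]_y (`|(f \_ (~` U)) y| + `|mean_part y|))).
  apply: le_Rint; [exact: bddint_norm|exact: bddintD|].
  by move=> y; rewrite gE ler_normD.
rewrite RintD//; have bfU := bddint_norm (bddint_restrict mU).
rewrite [leRHS](_ : _ = \int[mu]_y (`|(f \_ (~` U)) y| + `|(f \_ U) y|)); last first.
  apply: eq_Rintegral => y _; rewrite !patchE in_setC.
  by case: (y \in U); rewrite /= ?normr0 ?addr0 ?add0r.
rewrite RintD// lerD2l -lee_fin !EFin_Rintegral; [|exact: bddint_integrable..].
apply: (le_trans mean_part_norm).
rewrite integral_mkcond le_eqVlt; apply/orP; left; apply/eqP.
by apply: eq_integral => y _; rewrite !patchE; case: ifP => //; rewrite normr0.
Qed.

Definition centre := blockwise (fun n => (l n + r n) / 2).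

(** The bad part has mean 0 on every block, and phi (centre y) is constant
    there. *)
Lemma bad_part_cancel (phi : R -> R) : measurable_fun setT phi ->
  (exists M : R, forall x, `|phi x| <= M) ->
  \int[mu]_y (bad_part y * phi (centre y)) = 0.
Proof.
move=> mphi [M phiM].
have bg : bddint (fun y => bad_part y * phi (centre y)).
  apply: bddintM; first exact: bddint_bad_part.
    by apply: (measurableT_comp mphi); exact: measurable_blockwise.
  by exists M.
have Ig := bddint_integrable bg.
rewrite /Rintegral [X in fine X](_ : _ = 0%E)//.
transitivity (\int[mu]_(y in U) (bad_part y * phi (centre y))%:E)%E.
  rewrite [RHS]integral_mkcond; apply: eq_integral => y _.
  rewrite patchE; case: ifPn => // /negP; rewrite inE => nU.
  by rewrite /bad_part patchE memNset// /mean_part blockwise_out// subrr mul0r.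
rewrite UJ integral_bigcup//; last first.
  by apply: (integrableS measurableT _ _ Ig) => //; exact: bigcupT_measurable.
rewrite eseries0// => n _ _.
transitivity (\int[mu]_(y in J n) (phi ((l n + r n) / 2) * (f y - block_mean n))%:E)%E.
  apply: eq_integral => y /set_mem Jy.
  rewrite /bad_part /mean_part /centre !(blockwise_in _ Jy) mulrC patchE mem_set//.
  by rewrite UJ; exists n.
have IC : mu.-integrable (J n) (EFin \o fun=> block_mean n).
  apply/integrableP; split.
    by apply/measurable_EFinP; exact: measurable_cst.
  apply: (@le_lt_trans _ _ (`|block_mean n|%:E * mu (J n))%E).
    by rewrite -integral_cst.
  by rewrite muJ -EFinM ltry.
have IB : mu.-integrable (J n) (EFin \o (fun y => f y - block_mean n)).
  exact: (integrableB _ (IfJ n) IC).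
rewrite -[LHS]fineK; last first.
  apply: integrable_fin_num => //.
  exact: (integrableZl _ _ IB).
rewrite -/(Rintegral mu (J n) (fun y => phi ((l n + r n) / 2) * (f y - block_mean n))).
rewrite RintegralZl// RintegralB// Rintegral_cst//.
rewrite [X in _ - _ * X](_ : _ = r n - l n); last exact: (congr1 fine (muJ n)).
rewrite /block_mean.
have [lrn|rln] := ltP (l n) (r n).
  by rewrite mulfVK ?gt_eqF ?subr_gt0// subrr mulr0.
have -> : r n = l n by apply/eqP; rewrite eq_le rln lr.
rewrite subrr mulr0 subr0 set_itv_ge ?Rintegral_set0 ?mulr0//.
by rewrite bnd_simp ltxx.
Qed.

Definition dilated_blocks := \bigcup_n ball ((l n + r n) / 2) (r n - l n).

Lemma measurable_dilated_blocks : measurable dilated_blocks.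
Proof. by apply: bigcupT_measurable => n; exact: measurable_ball. Qed.

Lemma measure_dilated_blocks :
  (mu dilated_blocks <= (6 / lam * \int[mu]_y `|f y|)%:E)%E.
Proof.
apply: (@le_trans _ _ (2%:E * mu U)%E).
  apply: (@le_trans _ _ (\sum_(n <oo) mu (ball ((l n + r n) / 2)%R (r n - l n)%R))%E).
    apply: measure_sigma_subadditive => //.
    - by move=> n; exact: measurable_ball.
    - exact: measurable_dilated_blocks.
  rewrite UJ measure_semi_bigcup//; last by rewrite -UJ.
  rewrite -nneseriesZl//; apply: lee_nneseries => // n _.
  rewrite [X in (_ <= _ * X)%E](_ : _ = (r n - l n)%:E); last exact: muJ.
  by rewrite lebesgue_measure_ball ?subr_ge0// -EFinM lee_fin mulr2n; lra.
rewrite UE; have lf := bddint_locally_integrable bf.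
apply: (@le_trans _ _ (2%:E * ((3 / lam)%:E * \int[mu]_y `|(f y)%:E|))%E).
  by rewrite lee_pmul2l//; exact: maximal_inequality.
rewrite muleA -EFinM -EFin_Rintegral; last by apply: bddint_integrable; exact: bddint_norm.
by rewrite -EFinM lee_fin le_eqVlt; apply/orP; left; apply/eqP; congr (_ * _); field; rewrite gt_eqF.
Qed.

(** A point of a block is within half its length of the centre, while a point
    outside dilated_blocks is at least the full length away. *)
Lemma away_from_centre x y : ~ dilated_blocks x -> bad_part y != 0 ->
  2 * `|y - centre y| <= `|x - centre y|.
Proof.
move=> nV by0; have [[n _ Jy]|nU] : (\bigcup_n J n) y \/ ~ U y.
- by rewrite -UJ; exact: EM.
- rewrite /centre (blockwise_in _ Jy).
  have : r n - l n <= `|x - (l n + r n) / 2|.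
    rewrite leNgt; apply/negP => h; apply: nV; exists n => //.
    by rewrite /ball/= distrC.
  apply: le_trans; move: Jy => /=; rewrite in_itv/= => /andP[h1 h2].
  by rewrite -ler_pdivlMl// ler_norml; apply/andP; split; lra.
- move: by0; rewrite /bad_part patchE memNset// /mean_part blockwise_out// subrr.
  by rewrite eqxx.
Qed.

End decomposition.

(** The blocks are the components of the set where the maximal function
    exceeds lam. V is the union of the blocks dilated by 2, b the bad part,
    and c y the centre of the block containing y; the last two clauses are the
    form in which the geometry and the cancellation of the bad part meet the
    kernel. *)
Lemma calderon_zygmund_decomposition f (lam : R) : bddint f -> 0 < lam ->
  exists (V : set R) (b c : R -> R),
  [/\ measurable V /\ (mu V <= (6 / lam * \int[mu]_y `|f y|)%:E)%E,
      bddint b /\ measurable_fun setT c,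
      \int[mu]_y ((f y - b y) ^+ 2) <= 2 * lam * \int[mu]_y `|f y| /\
      \int[mu]_y `|b y| <= 2 * \int[mu]_y `|f y|,
      forall x y, ~ V x -> b y != 0 -> 2 * `|y - c y| <= `|x - c y| &
      forall phi : R -> R, measurable_fun setT phi ->
        (exists M : R, forall x, `|phi x| <= M) ->
        \int[mu]_y (b y * phi (c y)) = 0].
Proof.
move=> bf lam0; have lf := bddint_locally_integrable bf.
pose U := [set x | (lam%:E < HL_maximal f x)%E].
have oU : open U by exact: HL_maximal_open.
have Uoo : (mu U < +oo)%E.
  apply: (le_lt_trans (maximal_inequality lf lam0)).
  rewrite -EFin_Rintegral ?ltry//.
  by apply: bddint_integrable; exact: bddint_norm.
have [l [r [tJ UJ lr lU]]] := open_components oU Uoo.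
exists (dilated_blocks l r), (bad_part f U l r), (centre U l r); split.
- split; first exact: measurable_dilated_blocks.
  exact: (measure_dilated_blocks bf lam0 erefl tJ UJ lr).
- split; first exact: (bddint_bad_part bf lam0 erefl tJ UJ lr lU).
  exact: (measurable_blockwise tJ UJ).
- split; first exact: (good_part_sqr bf lam0 erefl tJ UJ lr lU).
  exact: (bad_part_norm bf lam0 erefl tJ UJ lr lU).
- by move=> x y; exact: (away_from_centre tJ UJ).
- by move=> phi; exact: (bad_part_cancel bf lam0 erefl tJ UJ lr lU).
Qed.

End calderon_zygmund_decomposition.

(** * Weak type (1,1) *)

Section weak_type.
Variable R : realType.
Local Notation mu := (@lebesgue_measure R).
Implicit Types f g k u w : R -> R.

Lemma chebyshev (D : set R) (h : R -> R) (t : R) : measurable D ->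
  measurable_fun D h -> (forall x, D x -> 0 <= h x) -> 0 < t ->
  (mu (D `&` [set x | (t < h x)%R]) <= t^-1%:E * \int[mu]_(x in D) (h x)%:E)%E.
Proof.
move=> mD mh h0 t0; set S := D `&` _.
have mS : measurable S.
  rewrite /S (_ : [set x | t < h x] = h @^-1` `]t, +oo[%classic).
    by apply: mh.
  by apply/seteqP; split => x /=; rewrite in_itv/= andbT.
have mES : measurable_fun D (fun x => (h x)%:E) by exact/measurable_EFinP.
rewrite -(@lee_pmul2l _ t%:E) ?lte_fin// muleA -EFinM divff ?gt_eqF// mul1e.
apply: (@le_trans _ _ (\int[mu]_(x in S) (h x)%:E)%E); last first.
  apply: ge0_subset_integral => //.
  by move=> x [].
rewrite -integral_cst//; apply: ge0_le_integral => //.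
- by move=> x _; rewrite lee_fin ltW.
- by apply: measurable_funS mES => // x [].
- by move=> x [_ /=]; rewrite lee_fin => /ltW.
Qed.

Lemma measurable_superlevel (h : R -> R) (t : R) : measurable_fun setT h ->
  measurable [set x | t < `|h x|].
Proof.
move=> mh; rewrite (_ : [set _ | _] = setT `&` ((@Num.norm _ R) \o h) @^-1` `]t, +oo[%classic).
  by apply: (measurableT_comp (@normr_measurable R setT) mh).
by rewrite setTI; apply/seteqP; split => x /=; rewrite in_itv/= andbT.
Qed.

Lemma measurable_norm_ge (r : R) : measurable [set x : R | r <= `|x|].
Proof.
rewrite (_ : [set _ | _] = setT `&` (@Num.norm _ R) @^-1` `[r, +oo[%classic).
  exact: (@normr_measurable R setT).
by rewrite setTI; apply/seteqP; split => x /=; rewrite in_itv/= andbT.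
Qed.

Section kernel.
Variables (k : R -> R) (A B : R).
Hypothesis bk : bddint k.
Hypothesis A_ge0 : 0 <= A.
Hypothesis B_ge0 : 0 <= B.
Hypothesis kL2 : forall u, bddint u ->
  \int[mu]_x (conv k u x ^+ 2) <= B * \int[mu]_x (u x ^+ 2).
Hypothesis hormander : forall z, (\int[mu]_(x in [set x | (2 * `|z| <= `|x|)%R])
  `|k (x - z) - k x|%:E <= A%:E)%E.

(** Cancellation replaces k (x - y) by k (x - y) - k (x - c y). For x off V
    the Hormander condition with increment y - c y bounds the integral in x,
    and Tonelli integrates the result against |b|. *)
Lemma bad_part_estimate (V : set R) (b c : R -> R) : measurable V ->
  bddint b -> measurable_fun setT c ->
  (forall x y, ~ V x -> b y != 0 -> 2 * `|y - c y| <= `|x - c y|) ->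
  (forall phi : R -> R, measurable_fun setT phi ->
    (exists M : R, forall x, `|phi x| <= M) -> \int[mu]_y (b y * phi (c y)) = 0) ->
  (\int[mu]_(x in ~` V) `|conv k b x|%:E <= (A * \int[mu]_y `|b y|)%:E)%E.
Proof.
move=> mV bb mc far cancel.
have [mk Mk _] := bk; have mb := bddint_measurable bb.
have mVC : measurable (~` V) by exact: measurableC.
pose H (z : R * R) := \1_(~` V) z.1 * `|k (z.1 - z.2) - k (z.1 - c z.2)| * `|b z.2|.
have H0 z : 0 <= H z by rewrite /H !mulr_ge0.
have mH : measurable_fun setT H.
  apply: measurable_funM; last first.
    by apply: (measurable_snd_comp (f := fun y => `|b y|)); exact: measurableT_comp.
  apply: measurable_funM.
    by apply: measurable_fst_comp; exact: measurable_indic.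
  apply: measurableT_comp => //; apply: measurable_funB.
    exact: measurable_diff_comp.
  apply: (measurableT_comp mk); apply: measurable_funB.
    exact: measurable_fst.
  exact: measurable_snd_comp.
have mEH : measurable_fun setT (EFin \o H) by exact/measurable_EFinP.
have mFH : measurable_fun setT (fubini_F mu (EFin \o H)).
  by apply: measurable_fun_fubini_tonelli_F => // z; rewrite lee_fin.
have mGH : measurable_fun setT (fubini_G mu (EFin \o H)).
  by apply: measurable_fun_fubini_tonelli_G => // z; rewrite lee_fin.
apply: (@le_trans _ _ (\int[mu]_x \int[mu]_y (H (x, y))%:E)%E).
  rewrite integral_mkcond; apply: ge0_le_integral => //.
  - move=> x _; rewrite patchE; case: ifP => //.
  - apply/(measurable_restrictT _ mVC); apply/measurable_EFinP.
    apply: measurableT_comp => //; apply: measurable_funTS.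
    by apply: bddint_measurable; exact: bddint_conv.
  move=> x _; rewrite patchE; case: ifPn => [xV|_]; last first.
    by apply: integral_ge0 => y _; rewrite lee_fin.
  have b1 : bddint (fun y => k (x - y) * b y) by exact: bddint_conv_integrand.
  have mkc : measurable_fun setT (fun t : R => k (x - t)).
    by apply: (measurableT_comp mk); exact: measurable_funB.
  have Mkc : exists M : R, forall t, `|k (x - t)| <= M.
    by have [M kM] := Mk; exists M.
  have b2 : bddint (fun y => b y * k (x - c y)).
    apply: bddintM => //; first exact: (measurableT_comp mkc mc).
    by have [M kM] := Mk; exists M.
  have E : conv k b x = \int[mu]_y ((k (x - y) - k (x - c y)) * b y).
    transitivity (conv k b x - \int[mu]_y (b y * k (x - c y))).
      by rewrite (cancel (fun t => k (x - t)))// subr0.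
    by rewrite /conv -RintB//; apply: eq_Rintegral => y _; ring.
  have b3 : bddint (fun y => (k (x - y) - k (x - c y)) * b y).
    have := bddintB b1 b2; congr bddint.
    by apply/funext => y; ring.
  rewrite E; apply: (@le_trans _ _ (\int[mu]_y `|(k (x - y) - k (x - c y)) * b y|)%:E).
    by rewrite lee_fin; exact: le_norm_Rint.
  rewrite EFin_Rintegral; last by apply: bddint_integrable; exact: bddint_norm.
  rewrite le_eqVlt; apply/orP; left; apply/eqP.
  by apply: eq_integral => y _; rewrite /H/= indicE xV mul1r normrM.
have EH0 z : (0 <= (EFin \o H) z)%E by rewrite lee_fin.
have tonelli := @fubini_tonelli _ _ _ _ R mu mu (EFin \o H) mEH EH0.
apply: (@le_trans _ _ (\int[mu]_y \int[mu]_x (H (x, y))%:E)%E).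
  by rewrite le_eqVlt; apply/orP; left; apply/eqP; exact: tonelli.
apply: (@le_trans _ _ (\int[mu]_y (A%:E * `|b y|%:E))%E); last first.
  rewrite ge0_integralZl//.
    by rewrite -EFin_Rintegral//; apply: bddint_integrable; exact: bddint_norm.
  by apply/measurable_EFinP; exact: measurableT_comp.
apply: ge0_le_integral => //.
- by move=> x _; apply: integral_ge0 => y _; rewrite lee_fin.
- by apply/measurable_EFinP; apply: measurable_funM => //; exact: measurableT_comp.
move=> y _ /=.
have [b0|bn0] := eqVneq (b y) 0.
  rewrite b0 normr0 mule0 integral0_eq// => x _.
  by rewrite /H/= b0 normr0 mulr0.
pose P := [set x : R | 2 * `|y - c y| <= `|x|].
have mg : measurable_fun setT (fun x : R => `|k (x - (y - c y)) - k x|%:E).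
  apply/measurable_EFinP; apply: measurableT_comp => //.
  by apply: measurable_funB => //; apply: (measurableT_comp mk); exact: measurable_funB.
pose g := (fun x : R => `|k (x - (y - c y)) - k x|%:E) \_ P.
have mgP : measurable_fun setT g.
  by apply/(measurable_restrictT _ (measurable_norm_ge _)); exact: measurable_funTS.
have g0 x : (0 <= g x)%E by rewrite /g patchE; case: ifP.
have mgs : measurable_fun setT (fun x : R => g (x - c y)%R).
  by apply: (measurableT_comp mgP); exact: measurable_funB.
apply: (@le_trans _ _ (\int[mu]_x (`|b y|%:E * g (x - c y)%R))%E).
  apply: ge0_le_integral => //.
  - by move=> x _; rewrite lee_fin.
  - exact: (measurableT_comp mEH (pair2_measurable y)).
  - by apply: emeasurable_funM.
  move=> x _; rewrite /H/= /g patchE indicE.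
  have [Vx|nVx] := EM (V x).
    by rewrite memNset ?mul0r; [apply: mule_ge0 => //; case: ifP | apply].
  rewrite [x \in ~` V]mem_set// mul1r mem_set; last exact: far.
  rewrite -EFinM lee_fin mulrC; apply: ler_wpM2l => //.
  rewrite le_eqVlt; apply/orP; left; apply/eqP; congr (`| k _ - _ |); ring.
rewrite ge0_integralZl// muleC lee_wpmul2r//.
rewrite (ge0_integral_shift (- c y))// -integral_mkcond.
exact: hormander.
Qed.

(** The good part is handled by Chebyshev and the L^2 bound, the bad part by
    Chebyshev and bad_part_estimate off V, and V by its measure. *)
Lemma weak_type_11 f (lam : R) : bddint f -> 0 < lam ->
  (mu [set x | (lam < `|conv k f x|)%R] <=
   ((8 * B + 6 + 4 * A) / lam * \int[mu]_y `|f y|)%:E)%E.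
Proof.
move=> bf lam0.
have [V [b [c [[mV muV] [bb mc] [gL2 bL1] far cancel]]]] :=
  calderon_zygmund_decomposition bf lam0.
set N1 := \int[mu]_y `|f y|; rewrite -/N1 in muV gL2 bL1.
pose g y := f y - b y; have bg : bddint g by exact: bddintB.
have bTg := bddint_conv bk bg; have bTb := bddint_conv bk bb.
have Tf x : conv k f x = conv k g x + conv k b x.
  rewrite -convDr//; congr (conv k _ x); apply/funext => y.
  by rewrite /g subrK.
pose S1 := [set x | lam / 2 < `|conv k g x|].
pose S2 := ~` V `&` [set x | lam / 2 < `|conv k b x|].
have mS1 : measurable S1 by apply: measurable_superlevel; exact: bddint_measurable.
have mS2 : measurable S2.
  apply: measurableI; first exact: measurableC.
  by apply: measurable_superlevel; exact: bddint_measurable.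
apply: (@le_trans _ _ (mu (S1 `|` (V `|` S2)))).
  apply: le_measure; rewrite ?inE.
  - apply: measurable_superlevel; apply: bddint_measurable; exact: bddint_conv.
  - by apply: measurableU => //; exact: measurableU.
  - move=> x /= fx; have [|h1] := ltP (lam / 2) `|conv k g x|; first by left.
    right; have [Vx|nVx] := EM (V x); [by left|right; split => //=].
    by have := ler_normD (conv k g x) (conv k b x); rewrite -Tf; lra.
have E1 : (mu S1 <= (8 * B / lam * N1)%:E)%E.
  have -> : S1 = setT `&` [set x | (lam / 2) ^+ 2 < conv k g x ^+ 2].
    have sq (z : R) : ((lam / 2) ^+ 2 < z ^+ 2) = (lam / 2 < `|z|).
      have l2 : 0 <= lam / 2 by rewrite divr_ge0// ltW.
      by rewrite -[z ^+ 2]real_normK ?num_real// ltr_pXn2r// nnegrE.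
    by rewrite setTI; apply/seteqP; split => x /=; rewrite sq.
  apply: (le_trans (chebyshev _ _ _ _)) => //.
  - by apply: bddint_measurable; exact: bddint_sqr.
  - by move=> x _; exact: sqr_ge0.
  - by rewrite exprn_gt0// divr_gt0.
  rewrite -EFin_Rintegral; last by apply: bddint_integrable; exact: bddint_sqr.
  rewrite -EFinM lee_fin.
  apply: (@le_trans _ _ (((lam / 2) ^+ 2)^-1 * (B * (2 * lam * N1)))).
    rewrite ler_wpM2l// ?invr_ge0 ?sqr_ge0//; apply: (le_trans (kL2 bg)).
    exact: ler_wpM2l.
  by rewrite le_eqVlt; apply/orP; left; apply/eqP; field; rewrite gt_eqF.
have E2 : (mu S2 <= (4 * A / lam * N1)%:E)%E.
  apply: (le_trans (chebyshev _ _ _ _)) => //.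
  - exact: measurableC.
  - by apply: measurableT_comp => //; apply: measurable_funTS; exact: bddint_measurable.
  - by rewrite divr_gt0.
  apply: (@le_trans _ _ ((lam / 2)^-1%:E * (A * (2 * N1))%:E)%E).
    rewrite lee_pmul2l ?lte_fin ?invr_gt0 ?divr_gt0//.
    apply: (le_trans (bad_part_estimate mV bb mc far cancel)).
    by rewrite lee_fin ler_wpM2l.
  rewrite -EFinM lee_fin.
  by rewrite le_eqVlt; apply/orP; left; apply/eqP; field; rewrite gt_eqF.
apply: (@le_trans _ _ ((8 * B / lam * N1)%:E + ((6 / lam * N1)%:E + (4 * A / lam * N1)%:E))%E).
  apply: (le_trans (measureU2 _ _ _)) => //; first exact: measurableU.
  apply: leeD => //; apply: (le_trans (measureU2 _ _ _)) => //.
  exact: leeD.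
rewrite -!EFinD lee_fin.
by rewrite le_eqVlt; apply/orP; left; apply/eqP; ring.
Qed.

End kernel.
End weak_type.

(** * Marcinkiewicz interpolation *)

Section layers.
Variable R : realType.
Local Notation mu := (@lebesgue_measure R).

Lemma measurable_if_le (d : measure_display) (T : measurableType d)
    (a b h : T -> R) :
  measurable_fun setT a -> measurable_fun setT b -> measurable_fun setT h ->
  measurable_fun setT (fun t => if a t <= b t then h t else 0).
Proof.
by move=> ma mb mh; apply: measurable_fun_ifT => //; exact: measurable_fun_ler.
Qed.

Lemma integral_scale (c : R) (f : R -> \bar R) : 0 <= c ->
  measurable_fun setT f -> (forall x, (0 <= f x)%E) ->
  (\int[mu]_x (c%:E * f x) = c%:E * \int[mu]_x f x)%E.
Proof. by move=> c0 mf f0; rewrite ge0_integralZl. Qed.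

Lemma integral_le_lin2 (a b : R) (f g h : R -> \bar R) : 0 <= a -> 0 <= b ->
  measurable_fun setT f -> measurable_fun setT g -> measurable_fun setT h ->
  (forall x, (0 <= f x)%E) -> (forall x, (0 <= g x)%E) -> (forall x, (0 <= h x)%E) ->
  (forall x, (f x <= a%:E * g x + b%:E * h x)%E) ->
  (\int[mu]_x f x <= a%:E * \int[mu]_x g x + b%:E * \int[mu]_x h x)%E.
Proof.
move=> a0 b0 mf mg mh f0 g0 h0 fgh.
rewrite -(integral_scale a0 mg g0) -(integral_scale b0 mh h0).
have mag : measurable_fun setT (fun x => a%:E * g x)%E by exact: emeasurable_funM.
have mbh : measurable_fun setT (fun x => b%:E * h x)%E by exact: emeasurable_funM.
rewrite -ge0_integralD//.
- by apply: ge0_le_integral => //; exact: emeasurable_funD.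
- by move=> x _; rewrite mule_ge0.
- by move=> x _; rewrite mule_ge0.
Qed.

Lemma integral_exp_tail (a q : R) : 0 < q ->
  (\int[mu]_s (if a <= s then expR (- (q * s)) else 0)%:E =
   (expR (- (q * a)) / q)%:E)%E.
Proof.
move=> q0; set C := expR (- (q * a)) / q.
have C0 : 0 <= C by rewrite divr_ge0 ?expR_ge0// ltW.
have mp := @measurable_exponential_pdf R q.
have p0 x : 0 <= exponential_pdf q x by exact: exponential_pdf_ge0 (ltW q0) x.
transitivity (\int[mu]_s (C%:E * (exponential_pdf q (s + - a))%:E))%E.
  apply: eq_integral => s _; rewrite -EFinM; congr EFin.
  case: ifPn => sa.
    rewrite exponential_pdfE ?subr_ge0// /C.
    rewrite mulrA divfK ?gt_eqF// -expRD; congr expR; ring.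
  by rewrite lt0_exponential_pdf ?mulr0// subr_lt0 ltNge.
have mps : measurable_fun setT (fun s : R => (exponential_pdf q (s + - a))%:E).
  apply/measurable_EFinP; apply: (measurableT_comp mp).
  exact: measurable_funD.
rewrite ge0_integralZl//; last by move=> s _; rewrite lee_fin.
have mEp : measurable_fun setT (EFin \o exponential_pdf q) by exact/measurable_EFinP.
have Ep0 s : (0 <= (EFin \o exponential_pdf q) s)%E by rewrite lee_fin.
rewrite [X in (_ * X)%E](_ : _ = \int[mu]_s (exponential_pdf q s)%:E)%E; last first.
  exact: (ge0_integral_shift (- a) mEp Ep0).
by rewrite integral_exponential_pdf// mule1.
Qed.

Lemma expRN_le_ln (s t : R) : 0 < t -> (expR (- s) <= t) = (- ln t <= s).
Proof. by move=> t0; rewrite -{1}(lnK (x := t)) ?posrE// ler_expR lerNl. Qed.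

(** A layer-cake formula with the height written expR (- s): layers are then
    indexed by the whole line, and powers of the height are exponentials. *)
Lemma integral_layer_below (t q : R) : 0 < q -> 0 <= t ->
  (\int[mu]_s (if expR (- s) <= t then expR (- (q * s)) else 0)%:E =
   (t `^ q / q)%:E)%E.
Proof.
move=> q0; rewrite le_eqVlt => /predU1P[<-|t0].
  rewrite powR0 ?gt_eqF// mul0r integral0_eq// => s _.
  by rewrite leNgt expR_gt0.
rewrite -[in RHS](lnK (x := t)) ?posrE// -expRM.
under eq_integral do rewrite expRN_le_ln//.
by rewrite integral_exp_tail//; congr (expR _ / _)%:E; ring.
Qed.

Lemma integral_layer_above (t q : R) : 0 < q -> 0 < t ->
  (\int[mu]_s (if t <= expR (- s) then expR (q * s) else 0)%:E =
   (t `^ (- q) / q)%:E)%E.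
Proof.
move=> q0 t0.
rewrite -[in RHS](lnK (x := t)) ?posrE// -expRM.
transitivity (\int[mu]_s (if ln t <= - s then expR (- (q * - s)) else 0)%:E)%E.
  apply: eq_integral => s _; rewrite mulrN opprK.
  by rewrite -{1}(lnK (x := t)) ?posrE// ler_expR.
pose h (s : R) := (if ln t <= s then expR (- (q * s)) else 0)%:E.
have mh : measurable_fun setT h.
  apply/measurable_EFinP; apply: measurable_if_le => //.
  by apply: measurableT_comp => //; apply: measurableT_comp => //; exact: measurable_funM.
have h0 s : (0 <= h s)%E by rewrite /h; case: ifP; rewrite lee_fin// expR_ge0.
transitivity (\int[mu]_s h s)%E; first by apply/esym; exact: (ge0_integral_opp mh h0).
by rewrite integral_exp_tail//; congr (expR _ / _)%:E; ring.
Qed.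

Lemma powR_layer (t p : R) : 0 <= t -> 0 < p ->
  t `^ p = 2 `^ p * p * ((t / 2) `^ p / p).
Proof.
move=> t0 p0.
have E : t = 2 * (t / 2) by field.
have h0 : 0 <= t / 2 by rewrite divr_ge0.
have h2 : (0 : R) <= 2 by [].
have P := powRM p h2 h0.
rewrite {1}E P -[RHS]mulrA; congr (_ * _).
rewrite [RHS]mulrC.
by rewrite divfK// gt_eqF.
Qed.

End layers.

Section marcinkiewicz.
Variable R : realType.
Local Notation mu := (@lebesgue_measure R).
Variables (k : R -> R) (W B p : R).
Hypothesis bk : bddint k.
Hypotheses (W0 : 0 <= W) (B0 : 0 <= B) (p1 : 1 < p) (p2 : p < 2).
Hypothesis kL2 : forall u, bddint u ->
  \int[mu]_x (conv k u x ^+ 2) <= B * \int[mu]_x (u x ^+ 2).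
Hypothesis weak : forall f (lam : R), bddint f -> 0 < lam ->
  (mu [set x | (lam < `|conv k f x|)%R] <= (W / lam * \int[mu]_y `|f y|)%:E)%E.

(** Weak type (1,1) for the part of u above height lam, the L^2 bound and
    Chebyshev for the part below. *)
Lemma distribution_estimate u (lam : R) : bddint u -> 0 < lam ->
  (mu [set x | (2 * lam <= `|conv k u x|)%R] <=
   (2 * W / lam * \int[mu]_y (if lam <= `|u y| then `|u y| else 0) +
    4 * B / lam ^+ 2 * \int[mu]_y (if `|u y| <= lam then u y ^+ 2 else 0))%:E)%E.
Proof.
move=> bu lam0.
have mu' := bddint_measurable bu.
have mau : measurable_fun setT (fun y => `|u y|) by exact: measurableT_comp.
pose u2 y := if `|u y| <= lam then u y else 0.
pose u1 y := u y - u2 y.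
have bu2 : bddint u2.
  apply: (@bddint_dom _ u _ 1) => //; first exact: measurable_if_le.
  by move=> y; rewrite mul1r /u2; case: ifP; rewrite ?normr0.
have bu1 : bddint u1 by exact: bddintB.
have E x : conv k u x = conv k u1 x + conv k u2 x.
  rewrite -convDr//; congr (conv k _ x); apply/funext => y.
  by rewrite /u1 subrK.
have b1 := bddint_conv bk bu1; have b2 := bddint_conv bk bu2.
pose S1 := [set x | lam / 2 < `|conv k u1 x|].
pose S2 := setT `&` [set x | (lam / 2) ^+ 2 < conv k u2 x ^+ 2].
have S2E : S2 = [set x | lam / 2 < `|conv k u2 x|].
  have sq (z : R) : ((lam / 2) ^+ 2 < z ^+ 2) = (lam / 2 < `|z|).
    have l2 : 0 <= lam / 2 by rewrite divr_ge0// ltW.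
    by rewrite -[z ^+ 2]real_normK ?num_real// ltr_pXn2r// nnegrE.
  by rewrite /S2 setTI; apply/seteqP; split => x /=; rewrite sq.
have mS1 : measurable S1 by apply: measurable_superlevel; exact: bddint_measurable.
have mS2 : measurable S2.
  by rewrite S2E; apply: measurable_superlevel; exact: bddint_measurable.
have mS : measurable [set x | 2 * lam <= `|conv k u x|].
  rewrite (_ : [set _ | _] = setT `&` ((@Num.norm _ R) \o conv k u) @^-1` `[2 * lam, +oo[%classic).
    apply: (measurableT_comp (@normr_measurable R setT)) => //.
    by apply: bddint_measurable; exact: bddint_conv.
  by rewrite setTI; apply/seteqP; split => x /=; rewrite in_itv/= andbT.
apply: (@le_trans _ _ (mu (S1 `|` S2))).
  apply: le_measure; rewrite ?inE//; first exact: measurableU.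
  move=> x /= ux; rewrite S2E; have [|h1] := ltP (lam / 2) `|conv k u1 x|; first by left.
  right => /=; have := ler_normD (conv k u1 x) (conv k u2 x).
  by rewrite -E; lra.
apply: (le_trans (measureU2 _ _ _)) => //; rewrite EFinD; apply: leeD.
  have l20 : 0 < lam / 2 by rewrite divr_gt0.
  apply: (le_trans (weak bu1 l20)); rewrite lee_fin.
  have -> : W / (lam / 2) = 2 * W / lam by field; rewrite gt_eqF.
  apply: ler_wpM2l; first by rewrite !mulr_ge0// invr_ge0 ltW.
  apply: le_Rint; first exact: bddint_norm.
    apply: (@bddint_dom _ u _ 1) => //; first exact: measurable_if_le.
    by move=> y; rewrite mul1r; case: ifP; rewrite ?normr0 ?normr_id.
  move=> y; rewrite /u1 /u2; case: ifPn => [_|h].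
    by rewrite subrr normr0; case: ifP.
  by rewrite subr0 ifT// ltW// ltNge.
apply: (le_trans (chebyshev _ _ _ _)) => //.
- by apply: bddint_measurable; exact: bddint_sqr.
- by move=> x _; exact: sqr_ge0.
- by rewrite exprn_gt0// divr_gt0.
rewrite -EFin_Rintegral; last by apply: bddint_integrable; exact: bddint_sqr.
rewrite -EFinM lee_fin.
have -> : 4 * B / lam ^+ 2 = ((lam / 2) ^+ 2)^-1 * B by field; rewrite gt_eqF.
rewrite -mulrA ler_wpM2l// ?invr_ge0 ?sqr_ge0//; apply: (le_trans (kL2 bu2)).
apply: ler_wpM2l => //; rewrite le_eqVlt; apply/orP; left; apply/eqP.
by apply: eq_Rintegral => y _; rewrite /u2; case: ifP; rewrite // expr0n.
Qed.

(** Integrate distribution_estimate at lam = expR (- s) against expR (- p s)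
    ds and exchange the integrals. The integrals in s converge because p > 1
    for the part above the height and p < 2 for the part below. *)
Lemma marcinkiewicz u : bddint u ->
  (\int[mu]_x (`|conv k u x| `^ p)%:E <=
   (2 `^ p * p * (2 * W / (p - 1) + 4 * B / (2 - p)))%:E *
     \int[mu]_x (`|u x| `^ p)%:E)%E.
Proof.
move=> bu; have p0 : 0 < p by rewrite (lt_trans ltr01).
have c2p : 0 < 2 `^ p * p by apply: mulr_gt0 => //; exact: powR_gt0.
(* the height is compared with |v| / 2 because distribution_estimate is at 2 lam *)
have layer t (t0 : 0 <= t) := powR_layer t0 p0.
move: (2 `^ p * p) c2p layer => c2 c2p layer.
have pm1 : 0 < p - 1 by rewrite subr_gt0.
have mp2 : 0 < 2 - p by rewrite subr_gt0.
set v := conv k u; have bv : bddint v by exact: bddint_conv.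
have mau : measurable_fun setT (fun y => `|u y|).
  by apply: measurableT_comp => //; exact: bddint_measurable.
have mav : measurable_fun setT (fun y => `|v y|).
  by apply: measurableT_comp => //; exact: bddint_measurable.
have mup : measurable_fun setT (fun y => (`|u y| `^ p)%:E).
  by apply/measurable_EFinP; apply: (measurableT_comp (measurable_powR p)).
have mexpN : measurable_fun setT (fun s : R => expR (- s)).
  by apply: measurableT_comp => //.
have mexp (c : R) : measurable_fun setT (fun s : R => expR (c * s)).
  by apply: measurableT_comp => //; exact: measurable_funM.
pose F0 (z : R * R) := if expR (- z.2) <= `|v z.1| / 2 then expR (- (p * z.2)) else 0.
pose F1 (z : R * R) := `|u z.1| *
  (if expR (- z.2) <= `|u z.1| then expR (- ((p - 1) * z.2)) else 0).
pose F2 (z : R * R) := u z.1 ^+ 2 *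
  (if `|u z.1| <= expR (- z.2) then expR ((2 - p) * z.2) else 0).
have F00 z : (0 <= (EFin \o F0) z)%E.
  by rewrite lee_fin /F0; case: ifP => // _; exact: expR_ge0.
have F10 z : (0 <= (EFin \o F1) z)%E.
  by rewrite lee_fin /F1 mulr_ge0//; case: ifP => // _; exact: expR_ge0.
have F20 z : (0 <= (EFin \o F2) z)%E.
  by rewrite lee_fin /F2 mulr_ge0 ?sqr_ge0//; case: ifP => // _; exact: expR_ge0.
have mE2 : measurable_fun setT (fun z : R * R => expR (- z.2)).
  exact: (measurable_snd_comp mexpN).
have mu1 : measurable_fun setT (fun z : R * R => `|u z.1|).
  exact: (measurable_fst_comp mau).
have mEp (c : R) : measurable_fun setT (fun z : R * R => expR (- (c * z.2))).
  apply: (measurable_snd_comp (f := fun s => expR (- (c * s)))).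
  by apply: measurableT_comp => //; apply: measurableT_comp => //; exact: measurable_funM.
have mF0 : measurable_fun setT (EFin \o F0).
  apply/measurable_EFinP; apply: measurable_if_le => //.
  by apply: measurable_funM => //; exact: (measurable_fst_comp mav).
have mF1 : measurable_fun setT (EFin \o F1).
  by apply/measurable_EFinP; apply: measurable_funM => //; exact: measurable_if_le.
have mF2 : measurable_fun setT (EFin \o F2).
  apply/measurable_EFinP; apply: measurable_funM.
    apply: measurable_funX; apply: measurable_fst_comp.
    exact: bddint_measurable.
  by apply: measurable_if_le => //; exact: (measurable_snd_comp (mexp _)).
have mG F : measurable_fun setT (EFin \o F) -> (forall z, 0 <= (EFin \o F) z)%E ->
    measurable_fun setT (fubini_G mu (EFin \o F : R * R -> \bar R)).
  by move=> mF Fp; apply: measurable_fun_fubini_tonelli_G.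
have mFF F : measurable_fun setT (EFin \o F) -> (forall z, 0 <= (EFin \o F) z)%E ->
    measurable_fun setT (fubini_F mu (EFin \o F : R * R -> \bar R)).
  by move=> mF Fp; apply: measurable_fun_fubini_tonelli_F.
have slice s : (\int[mu]_x (F0 (x, s))%:E <=
    (2 * W)%:E * \int[mu]_x (F1 (x, s))%:E +
    (4 * B)%:E * \int[mu]_x (F2 (x, s))%:E)%E.
  have es0 := expR_gt0 (- s).
  have b1 : bddint (fun y => if expR (- s) <= `|u y| then `|u y| else 0).
    apply: (@bddint_dom _ u _ 1) => //; first exact: measurable_if_le.
    by move=> y; rewrite mul1r; case: ifP; rewrite ?normr0 ?normr_id.
  have b2 : bddint (fun y => if `|u y| <= expR (- s) then u y ^+ 2 else 0).
    apply: (@bddint_dom _ (fun y => u y ^+ 2) _ 1); first exact: bddint_sqr.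
      by apply: measurable_if_le => //; apply: measurable_funX; exact: bddint_measurable.
    by move=> y; rewrite mul1r; case: ifP; rewrite ?normr0.
  have -> : (\int[mu]_x (F0 (x, s))%:E = (expR (- (p * s)))%:E *
      mu [set x | (2 * expR (- s) <= `|v x|)%R])%E.
    have mS : measurable [set x | 2 * expR (- s) <= `|v x|].
      rewrite (_ : [set _ | _] = setT `&` ((fun y => `|v y|)) @^-1` `[2 * expR (- s), +oo[%classic).
        exact: mav.
      by rewrite setTI; apply/seteqP; split => x /=; rewrite in_itv/= andbT.
    rewrite -integral_cst//= [RHS]integral_mkcond; apply: eq_integral => x _.
    rewrite patchE /F0/= ler_pdivlMr// mulrC.
    by case: ifPn => h; [rewrite mem_set | rewrite memNset//; exact/negP].
  have e0 : 0 < expR (- (p * s)) by exact: expR_gt0.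
  have D := distribution_estimate bu es0.
  move: D; rewrite -(@lee_pmul2l _ (expR (- (p * s)))%:E) ?lte_fin//.
  move=> /le_trans; apply.
  have -> : (\int[mu]_x (F1 (x, s))%:E =
      (expR (- ((p - 1) * s)) * \int[mu]_x (if expR (- s) <= `|u x| then `|u x| else 0))%:E)%E.
    rewrite EFinM EFin_Rintegral; last exact: bddint_integrable.
    rewrite -ge0_integralZl//=.
    - apply: eq_integral => x _; rewrite -EFinM /F1/=.
      by case: ifP => _; rewrite ?mulr0// mulrC.
    - by apply/measurable_EFinP; exact: bddint_measurable.
    - by move=> x _; rewrite lee_fin; case: ifP.
  have -> : (\int[mu]_x (F2 (x, s))%:E =
      (expR ((2 - p) * s) * \int[mu]_x (if `|u x| <= expR (- s) then u x ^+ 2 else 0))%:E)%E.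
    rewrite EFinM EFin_Rintegral; last exact: bddint_integrable.
    rewrite -ge0_integralZl//=.
    - apply: eq_integral => x _; rewrite -EFinM /F2/=.
      by case: ifP => _; rewrite ?mulr0// mulrC.
    - by apply/measurable_EFinP; exact: bddint_measurable.
    - by move=> x _; rewrite lee_fin; case: ifP => // _; exact: sqr_ge0.
  rewrite -!EFinM -EFinD lee_fin le_eqVlt; apply/orP; left; apply/eqP.
  have -> : expR (- ((p - 1) * s)) = expR (- (p * s)) / expR (- s).
    by rewrite -expRN -expRD; congr expR; ring.
  have -> : expR ((2 - p) * s) = expR (- (p * s)) / expR (- s) ^+ 2.
    by rewrite -expRM_natl -expRN -expRD; congr expR; ring.
  by field; rewrite gt_eqF.
have I0 x : (\int[mu]_s (F0 (x, s))%:E = ((`|v x| / 2) `^ p / p)%:E)%E.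
  by rewrite /F0/= integral_layer_below.
have I1 x : (\int[mu]_s (F1 (x, s))%:E = (`|u x| `^ p / (p - 1))%:E)%E.
  rewrite /F1/=; under eq_integral do rewrite EFinM.
  rewrite ge0_integralZl//.
  - rewrite integral_layer_below// -EFinM mulrA; congr (_ / _)%:E.
    by rewrite mulr_powRB1.
  - apply/measurable_EFinP; apply: measurable_if_le => //.
    by apply: measurableT_comp => //; apply: measurableT_comp => //; exact: measurable_funM.
  - by move=> s _; rewrite lee_fin; case: ifP => // _; exact: expR_ge0.
have I2 x : (\int[mu]_s (F2 (x, s))%:E = (`|u x| `^ p / (2 - p))%:E)%E.
  have [ux0|uxn0] := eqVneq (u x) 0.
    rewrite ux0 normr0 powR0 ?gt_eqF// mul0r integral0_eq// => s _.
    by rewrite /F2/= ux0 expr0n mul0r.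
  have uxp : 0 < `|u x| by rewrite normr_gt0.
  rewrite /F2/=; under eq_integral do rewrite EFinM.
  rewrite ge0_integralZl//.
  - rewrite integral_layer_above// -EFinM mulrA; congr (_ / _)%:E.
    rewrite -[u x ^+ 2]real_normK ?num_real// -powR_mulrn// -powRD.
      by congr (_ `^ _); ring.
    by apply/implyP => _; rewrite gt_eqF.
  - by apply/measurable_EFinP; apply: measurable_if_le => //; exact: mexp.
  - by move=> s _; rewrite lee_fin; case: ifP => // _; exact: expR_ge0.
  - by rewrite lee_fin sqr_ge0.
have T0 := @fubini_tonelli _ _ _ _ R mu mu _ mF0 F00.
have T1 := @fubini_tonelli _ _ _ _ R mu mu _ mF1 F10.
have T2 := @fubini_tonelli _ _ _ _ R mu mu _ mF2 F20.
have J0m : measurable_fun setT (fun x => \int[mu]_s (F0 (x, s))%:E)%E by exact: (mFF F0).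
have J00 x : (0 <= \int[mu]_s (F0 (x, s))%:E)%E.
  by apply: integral_ge0 => s _; exact: F00.
have cp0 : 0 <= c2 by exact: ltW.
have vE : (\int[mu]_x (`|v x| `^ p)%:E =
    c2%:E * \int[mu]_x \int[mu]_s (F0 (x, s))%:E)%E.
  rewrite -(integral_scale cp0 J0m J00).
  apply: eq_integral => x _; rewrite I0 -EFinM; congr EFin.
  exact: layer.
rewrite vE T0.
apply: (@le_trans _ _ (c2%:E * ((2 * W)%:E * \int[mu]_s \int[mu]_x (F1 (x, s))%:E +
    (4 * B)%:E * \int[mu]_s \int[mu]_x (F2 (x, s))%:E))%E).
  apply: lee_wpmul2l; first by rewrite lee_fin.
  have G1 : measurable_fun setT (fun s => \int[mu]_x (F1 (x, s))%:E)%E by exact: (mG F1).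
  have G2 : measurable_fun setT (fun s => \int[mu]_x (F2 (x, s))%:E)%E by exact: (mG F2).
  have G10 s : (0 <= \int[mu]_x (F1 (x, s))%:E)%E.
    by apply: integral_ge0 => x _; exact: F10.
  have G20 s : (0 <= \int[mu]_x (F2 (x, s))%:E)%E.
    by apply: integral_ge0 => x _; exact: F20.
  have G0 : measurable_fun setT (fun s => \int[mu]_x (F0 (x, s))%:E)%E by exact: (mG F0).
  have G00 s : (0 <= \int[mu]_x (F0 (x, s))%:E)%E.
    by apply: integral_ge0 => x _; exact: F00.
  have W20 : 0 <= 2 * W by rewrite mulr_ge0.
  have B40 : 0 <= 4 * B by rewrite mulr_ge0.
  exact: (integral_le_lin2 W20 B40 G0 G1 G2 G00 G10 G20 slice).
have up0 x : (0 <= (`|u x| `^ p)%:E)%E by rewrite lee_fin powR_ge0.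
have E1 : (\int[mu]_s \int[mu]_x (F1 (x, s))%:E =
    (p - 1)^-1%:E * \int[mu]_x (`|u x| `^ p)%:E)%E.
  apply: (eq_trans (esym T1)).
  have c0 : 0 <= (p - 1)^-1 by rewrite invr_ge0 ltW.
  rewrite -(integral_scale c0 mup up0).
  by apply: eq_integral => x _; rewrite -EFinM mulrC; exact: I1.
have E2 : (\int[mu]_s \int[mu]_x (F2 (x, s))%:E =
    (2 - p)^-1%:E * \int[mu]_x (`|u x| `^ p)%:E)%E.
  apply: (eq_trans (esym T2)).
  have c0 : 0 <= (2 - p)^-1 by rewrite invr_ge0 ltW.
  rewrite -(integral_scale c0 mup up0).
  by apply: eq_integral => x _; rewrite -EFinM mulrC; exact: I2.
rewrite E1 E2; clear - W0 B0 pm1 mp2.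
have Wp : 0 <= 2 * W / (p - 1) by rewrite divr_ge0 ?mulr_ge0// ltW.
have Bp : 0 <= 4 * B / (2 - p) by rewrite divr_ge0 ?mulr_ge0// ltW.
move: (integral _ _ _) => I; rewrite !muleA -!EFinM.
by rewrite -ge0_muleDl ?lee_fin// muleA -EFinD -EFinM.
Qed.

End marcinkiewicz.

(** * Calderon-Zygmund kernels on L^p *)

Section Lp_bound.
Variable R : realType.
Local Notation mu := (@lebesgue_measure R).
Implicit Types f g k u w : R -> R.

Lemma measurable_sg : measurable_fun setT (@Num.sg R).
Proof.
apply: nondecreasing_measurable => // x y xy.
have [x0|x0|x0] := ltgtP x 0; last by rewrite x0 sgr0 sgr_ge0 -x0.
  rewrite ltr0_sg//; have [y0|y0|->] := ltgtP y 0.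
  - by rewrite ltr0_sg.
  - by rewrite gtr0_sg//; lra.
  - by rewrite sgr0; lra.
by rewrite !gtr0_sg// (lt_le_trans x0).
Qed.

Lemma bddint_powR f (p : R) : 1 <= p -> bddint f ->
  bddint (fun x => `|f x| `^ p).
Proof.
move=> p1 bf; have [M M0 fM] := bddint_bounded bf.
apply: (@bddint_dom _ f _ (M `^ (p - 1))) => //.
  apply: (measurableT_comp (measurable_powR p)); apply: measurableT_comp => //.
  exact: bddint_measurable.
move=> x; rewrite ger0_norm ?powR_ge0//.
rewrite -(@mulr_powRB1 _ `|f x|)//; last exact: lt_le_trans p1.
rewrite mulrC; apply: ler_wpM2r => //; apply: ge0_ler_powR => //.
by rewrite subr_ge0.
Qed.

Lemma Rint_hoelder f g (p q : R) : bddint f -> bddint g -> 1 <= p -> 1 <= q ->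
  p^-1 + q^-1 = 1 ->
  \int[mu]_x (f x * g x) <=
  (\int[mu]_x (`|f x| `^ p)) `^ p^-1 * (\int[mu]_x (`|g x| `^ q)) `^ q^-1.
Proof.
move=> bf bg p1 q1 pq.
have p0 : 0 < p by exact: lt_le_trans p1.
have q0 : 0 < q by exact: lt_le_trans q1.
have := hoelder mu (bddint_measurable bf) (bddint_measurable bg) p0 q0 pq.
rewrite Lnorm1 unlock.
have norm_eq h r : bddint h -> 1 <= r ->
    ((\int[mu]_x `|(h x)%:E| `^ r) `^ r^-1 = ((\int[mu]_x (`|h x| `^ r)) `^ r^-1)%:E)%E.
  move=> bh r1; rewrite -poweR_EFin; congr (_ `^ _)%E.
  by rewrite EFin_Rintegral//; apply: bddint_integrable; exact: bddint_powR.
rewrite (norm_eq f p)// (norm_eq g q)// -EFinM => H.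
rewrite -lee_fin; apply: le_trans H.
have bfg := bddintMb bf bg.
apply: (@le_trans _ _ (\int[mu]_x `|f x * g x|)%:E).
  by rewrite lee_fin; apply: le_trans (le_norm_Rint bfg); exact: ler_norm.
by rewrite EFin_Rintegral//; apply: bddint_integrable; exact: bddint_norm.
Qed.

(** A is a Hormander constant, and B bounds the square of the operator norm on
    L^2. *)
Definition cz_kernel k (A B : R) := [/\ bddint k, 0 <= A, 0 <= B,
  (forall u, bddint u ->
    \int[mu]_x (conv k u x ^+ 2) <= B * \int[mu]_x (u x ^+ 2)) &
  (forall z, (\int[mu]_(x in [set x | (2 * `|z| <= `|x|)%R])
    `|k (x - z) - k x|%:E <= A%:E)%E)].

(** The constants produced by weak_type_11 and by the L^2 bound are affine in
    A and B; as 1 <= 1 + A + B, the p-th power absorbs them. It is this power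
    that becomes the p-th power of the logarithm. *)
Lemma conv_Lp_lt2 (p : R) : 1 < p -> p < 2 -> exists2 C : R, 0 <= C &
  forall k A B u, cz_kernel k A B -> bddint u ->
  \int[mu]_x (`|conv k u x| `^ p) <=
  C * (1 + A + B) `^ p * \int[mu]_x (`|u x| `^ p).
Proof.
move=> p1 p2.
have pm1 : 0 < p - 1 by rewrite subr_gt0.
have mp2 : 0 < 2 - p by rewrite subr_gt0.
exists (2 `^ p * p * (16 / (p - 1) + 4 / (2 - p))).
  apply: mulr_ge0; last by rewrite addr_ge0// divr_ge0// ltW.
  by apply: mulr_ge0; [exact: powR_ge0|rewrite ltW// (lt_trans ltr01)].
move=> k A B u [bk A0 B0 kL2 kH] bu.
pose W := 8 * B + 6 + 4 * A.
have W0 : 0 <= W by rewrite /W !addr_ge0// mulr_ge0.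
have weak f (lam : R) (bf : bddint f) (lam0 : 0 < lam) :=
  weak_type_11 bk A0 B0 kL2 kH bf lam0.
have H := marcinkiewicz bk W0 B0 p1 p2 kL2 weak bu.
have bv := bddint_conv bk bu.
rewrite -lee_fin EFinM.
have -> : ((\int[mu]_x (`|conv k u x| `^ p))%:E = \int[mu]_x (`|conv k u x| `^ p)%:E)%E.
  by apply: EFin_Rintegral; apply: bddint_integrable; apply: bddint_powR => //; exact: ltW.
have -> : ((\int[mu]_x (`|u x| `^ p))%:E = \int[mu]_x (`|u x| `^ p)%:E)%E.
  by apply: EFin_Rintegral; apply: bddint_integrable; apply: bddint_powR => //; exact: ltW.
apply: (le_trans H); apply: lee_wpmul2r.
  by apply: integral_ge0 => x _; rewrite lee_fin powR_ge0.
rewrite lee_fin -[leRHS]mulrA; apply: ler_wpM2l.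
  by apply: mulr_ge0; [exact: powR_ge0|rewrite ltW// (lt_trans ltr01)].
clear - W A0 B0 p1 p2 pm1 mp2.
have D1 : 1 <= 1 + A + B by lra.
apply: (@le_trans _ _ ((16 / (p - 1) + 4 / (2 - p)) * (1 + A + B))).
  rewrite [leRHS]mulrDl; apply: lerD.
    by rewrite [leRHS]mulrAC ler_pM2r ?invr_gt0// /W; lra.
  by rewrite [leRHS]mulrAC ler_pM2r ?invr_gt0//; lra.
apply: ler_wpM2l; first by rewrite addr_ge0// divr_ge0// ltW.
by apply: le1r_powR => //; exact: ltW.
Qed.

Lemma conv_L2 k A B u : cz_kernel k A B -> bddint u ->
  \int[mu]_x (`|conv k u x| `^ 2) <=
  (1 + A + B) `^ 2 * \int[mu]_x (`|u x| `^ 2).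
Proof.
move=> [bk A0 B0 kL2 _] bu.
have E h : \int[mu]_x (`|h x| `^ 2) = \int[mu]_x (h x ^+ 2).
  by apply: eq_Rintegral => x _; rewrite powR_mulrn// real_normK// num_real.
rewrite !E; apply: (le_trans (kL2 _ bu)); apply: ler_wpM2r.
  by apply: Rint_ge0 => x; exact: sqr_ge0.
rewrite powR_mulrn; [nra|lra].
Qed.

(** Duality bounds N, the p-th power of the norm of conv k u, by an expression
    containing N to the power 1 / q, which is divided out since 1 / q + 1 / p
    = 1. *)
Lemma conjugate_absorb (C D N U p q : R) : 0 <= C -> 0 <= D -> 0 <= N -> 0 <= U ->
  0 < p -> 0 < q -> q^-1 + p^-1 = 1 ->
  N <= (C * D `^ q * N) `^ q^-1 * U `^ p^-1 ->
  N <= C `^ (q^-1 * p) * D `^ p * U.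
Proof.
move=> C0 D0 N0 U0 p0 q0 pq Nle.
have pn0 : p != 0 by rewrite gt_eqF.
have qn0 : q != 0 by rewrite gt_eqF.
have Dq0 : 0 <= D `^ q by exact: powR_ge0.
have Cq0 : 0 <= C `^ q^-1 by exact: powR_ge0.
have Up0 : 0 <= U `^ p^-1 by exact: powR_ge0.
have CD0 : 0 <= C * D `^ q by exact: mulr_ge0.
have CqD0 : 0 <= C `^ q^-1 * D by exact: mulr_ge0.
have [->|Nn] := eqVneq N 0.
  by apply: mulr_ge0 => //; apply: mulr_ge0; exact: powR_ge0.
have Np : 0 < N by rewrite lt_neqAle eq_sym Nn.
have Nq : N = N `^ q^-1 * N `^ p^-1.
  by rewrite -powRD ?pq ?powRr1// Nn implybT.
have Nle2 : N `^ p^-1 <= C `^ q^-1 * D * U `^ p^-1.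
  rewrite -(@ler_pM2l _ (N `^ q^-1)); last exact: powR_gt0.
  rewrite -Nq; apply: (le_trans Nle).
  rewrite (powRM _ CD0 N0) (powRM _ C0 Dq0) -(powRrM D) divff// (powRr1 D0).
  by rewrite [leRHS]mulrA [N `^ q^-1 * _]mulrC.
have NE : N = (N `^ p^-1) `^ p by rewrite -powRrM mulVf// powRr1.
rewrite [leLHS]NE.
have Np0 : N `^ p^-1 \is Num.nneg by rewrite nnegrE powR_ge0.
have RHS0 : C `^ q^-1 * D * U `^ p^-1 \is Num.nneg by rewrite nnegrE mulr_ge0.
apply: (le_trans (ge0_ler_powR (ltW p0) Np0 RHS0 Nle2)).
by rewrite (powRM _ CqD0 Up0) (powRM _ Cq0 D0) -!powRrM mulVf// (powRr1 U0).
Qed.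

(** Duality. Pairing v = conv k u with w = sg v |v|^(p - 1) and moving k to w
    gives a convolution by the reflected kernel, which is conv k applied to
    the reflection of w; the conjugate exponent q is less than 2, so
    conv_Lp_lt2 applies. *)
Lemma conv_Lp_gt2 (p : R) : 2 < p -> exists2 C : R, 0 <= C &
  forall k A B u, cz_kernel k A B -> bddint u ->
  \int[mu]_x (`|conv k u x| `^ p) <=
  C * (1 + A + B) `^ p * \int[mu]_x (`|u x| `^ p).
Proof.
move=> p2; have p0 : 0 < p by lra.
have pn0 : p != 0 by rewrite gt_eqF.
have pm1 : 0 < p - 1 by lra.
pose q := p / (p - 1).
have q1 : 1 < q by rewrite /q ltr_pdivlMr//; lra.
have q2 : q < 2 by rewrite /q ltr_pdivrMr//; lra.
have q0 : 0 < q by lra.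
have qn0 : q != 0 by rewrite gt_eqF.
have pq : q^-1 + p^-1 = 1 by rewrite /q invf_div; field.
have [C C0 HC] := conv_Lp_lt2 q1 q2.
exists (C `^ (q^-1 * p)); first exact: powR_ge0.
move=> k A B u K bu; have [bk A0 B0 _ _] := K.
have D1 : 1 <= 1 + A + B by lra.
set D := 1 + A + B in D1 *; have D0 : 0 <= D by lra.
set v := conv k u; have bv : bddint v by exact: bddint_conv.
set N := \int[mu]_x (`|v x| `^ p); set U := \int[mu]_x (`|u x| `^ p).
have N0 : 0 <= N by apply: Rint_ge0 => x; exact: powR_ge0.
have U0 : 0 <= U by apply: Rint_ge0 => x; exact: powR_ge0.
pose w x := Num.sg (v x) * `|v x| `^ (p - 1).
have w_norm x : `|w x| = `|v x| `^ (p - 1).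
  rewrite /w normrM (ger0_norm (powR_ge0 _ _)) normr_sg.
  have [->|vx0] := eqVneq (v x) 0; last by rewrite mul1r.
  by rewrite mul0r normr0 powR0// gt_eqF.
have msg : measurable_fun setT (fun x : R => Num.sg (v x)).
  apply: (@measurableT_comp _ _ _ _ _ _ (@Num.sg R) _ v).
    exact: measurable_sg.
  exact: bddint_measurable.
have bw : bddint w.
  have bp : bddint (fun x => `|v x| `^ (p - 1)) by apply: bddint_powR => //; lra.
  apply: (@bddint_dom _ _ _ 1 bp).
    by apply: measurable_funM => //; exact: bddint_measurable.
  by move=> x; rewrite mul1r w_norm (ger0_norm (powR_ge0 _ _)).
have Nvw : N = \int[mu]_x (conv (fun z => k (- z)) w x * u x).
  rewrite -Rint_conv_adj//; apply: eq_Rintegral => x _; rewrite -/v.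
  by rewrite /w mulrCA mulrA -normrEsg mulr_powRB1.
have bk' := bddint_opp bk.
have Nle : N <= (C * D `^ q * N) `^ q^-1 * U `^ p^-1.
  rewrite {1}Nvw; apply: (le_trans (Rint_hoelder (bddint_conv bk' bw) bu (ltW q1) _ pq)); first by lra.
  apply: ler_wpM2r; first exact: powR_ge0.
  apply: ge0_ler_powR.
  - by rewrite invr_ge0 ltW.
  - by rewrite nnegrE; apply: Rint_ge0 => x; exact: powR_ge0.
  - rewrite nnegrE; do ?apply: mulr_ge0 => //; exact: powR_ge0.
  pose w' z := w (- z); have bw' : bddint w' by exact: bddint_opp.
  have -> : \int[mu]_x (`|conv (fun z => k (- z)) w x| `^ q) =
      \int[mu]_x (`|conv k w' x| `^ q).
    rewrite -[RHS]Rintegral_opp.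
      by apply: eq_Rintegral => x _; rewrite conv_reflect.
    apply: bddint_measurable; apply: bddint_powR; first exact: ltW.
    exact: bddint_conv.
  apply: (le_trans (HC _ _ _ _ K bw')); apply: ler_wpM2l.
    by rewrite mulr_ge0// powR_ge0.
  rewrite le_eqVlt; apply/orP; left; apply/eqP.
  rewrite -[RHS]Rintegral_opp; last first.
    by apply: bddint_measurable; apply: bddint_powR => //; lra.
  apply: eq_Rintegral => x _; rewrite /w' w_norm -powRrM.
  by congr (_ `^ _); rewrite /q mulrCA divff ?mulr1// gt_eqF.
exact: conjugate_absorb Nle.
Qed.

Lemma conv_Lp (p : R) : 1 < p -> exists2 C : R, 0 <= C &
  forall k A B u, cz_kernel k A B -> bddint u ->
  \int[mu]_x (`|conv k u x| `^ p) <=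
  C * (1 + A + B) `^ p * \int[mu]_x (`|u x| `^ p).
Proof.
move=> p1; have [p2|p2|->] := ltgtP p 2.
- exact: conv_Lp_lt2.
- exact: conv_Lp_gt2.
- by exists 1 => // k A B u; rewrite mul1r; exact: conv_L2.
Qed.

End Lp_bound.

(** * Summation over lacunary scales *)

Section telescoping.
Variable R : realType.
Implicit Types t L : R.

(** Its derivative with respect to ln t is t (L - 1) / ((1 + t) (L + t)),
    comparable to the minimum of t, 1 and L / t, and its total increase over t
    > 0 is ln L. Sums of such minima over lacunary t are thus bounded by ln L
    up to a constant. *)
Definition log_potential L t : R := ln (L * (1 + t) / (L + t)).

Lemma log_potential_ge0 L t : 1 <= L -> 0 <= t -> 0 <= log_potential L t.
Proof. by move=> L1 t0; apply: ln_ge0; rewrite ler_pdivlMr; nra. Qed.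

Lemma log_potential_le L t : 1 <= L -> 0 <= t -> log_potential L t <= ln L.
Proof.
move=> L1 t0; rewrite /log_potential ler_ln ?posrE//; last lra.
  by rewrite ler_pdivrMr; nra.
by rewrite divr_gt0//; nra.
Qed.

Lemma log_potential_nondecreasing L t u : 1 <= L -> 0 <= t -> t <= u ->
  log_potential L t <= log_potential L u.
Proof.
move=> L1 t0 tu; rewrite /log_potential ler_ln ?posrE.
- rewrite ler_pdivrMr; last by lra.
  rewrite mulrAC ler_pdivlMr; last by lra.
  have : 0 <= L * ((L - 1) * (u - t)).
    by rewrite mulr_ge0//; [lra|rewrite mulr_ge0// subr_ge0].
  lra.
- by rewrite divr_gt0//; nra.
- by rewrite divr_gt0//; nra.
Qed.

(** The increment is - ln (1 - y), where y is the quotient on the left, and ln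
    (1 - y) <= - y. *)
Lemma log_potential_double L t : 1 <= L -> 0 <= t ->
  t * (L - 1) / ((1 + 2 * t) * (L + t)) <= log_potential L (2 * t) - log_potential L t.
Proof.
move=> L1 t0; set y := t * (L - 1) / _.
have d1 : 0 < 1 + 2 * t by lra.
have d2 : 0 < L + t by lra.
have d3 : 0 < 1 + t by lra.
have d4 : 0 < L + 2 * t by lra.
have L0 : 0 < L by lra.
have yE : 1 - y = (1 + t) * (L + 2 * t) / ((1 + 2 * t) * (L + t)).
  by rewrite /y; field; rewrite !gt_eqF.
have y1 : 0 < 1 - y by rewrite yE divr_gt0// mulr_gt0.
have -> : log_potential L (2 * t) - log_potential L t = - ln (1 - y).
  rewrite -lnV ?posrE// /log_potential -ln_div ?posrE ?divr_gt0 ?mulr_gt0//.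
  by congr ln; rewrite yE; field; rewrite !gt_eqF.
have : ln (1 + - y) <= - y by apply: le_ln1Dx; lra.
by rewrite -/(1 - y) lerNr.
Qed.

(** Each scale contributes at most an increment of the potential; lacunarity
    makes the increments over distinct scales non-overlapping. *)
Lemma lacunary_sum_le L (s : nat -> R) (z : R) (N : nat) : 1 <= L -> 0 <= z ->
  (forall i, 0 < s i) -> (forall i, 2 * s i <= s i.+1) ->
  \sum_(i < N) (s i * z * (L - 1) / ((1 + 2 * (s i * z)) * (L + s i * z))) <= ln L.
Proof.
move=> L1 z0 s0 s2.
have t0 i : 0 <= s i * z by rewrite mulr_ge0// ltW.
apply: (@le_trans _ _ (log_potential L (s N * z) - log_potential L (s 0%N * z))).
  elim: N => [|N ih]; first by rewrite big_ord0 subrr.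
  rewrite big_ord_recr/=; apply: (le_trans (lerD ih (log_potential_double L1 (t0 N)))).
  have : log_potential L (2 * (s N * z)) <= log_potential L (s N.+1 * z).
    apply: log_potential_nondecreasing => //; first by rewrite mulr_ge0.
    by rewrite mulrA ler_wpM2r.
  by lra.
have := log_potential_le L1 (t0 N); have := log_potential_ge0 L1 (t0 0%N); lra.
Qed.

(** F stands for the Hormander integral of one scale. The first bound serves t
    <= 1, the second 1 <= t <= 2 (10 + b), the third larger t; adding 10 to b
    keeps L - 1 comparable to L when b is small. *)
Lemma three_regimes (F C b t : R) : 0 <= b -> 0 < t -> 0 <= C ->
  F <= C * t -> F <= C -> (2 * b <= t -> F <= C / t) ->
  F <= 10 * C * (t * (10 + b - 1) / ((1 + 2 * t) * (10 + b + t))).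
Proof.
move=> b0 t0 C0 F1 F2 F3; set L := 10 + b.
have L10 : 10 <= L by rewrite /L lerDl.
have d0 : 0 < (1 + 2 * t) * (L + t) by rewrite mulr_gt0//; lra.
have key (m : R) : 0 <= m -> m * ((1 + 2 * t) * (L + t)) <= 10 * (t * (L - 1)) ->
    F <= C * m -> F <= 10 * C * (t * (L - 1) / ((1 + 2 * t) * (L + t))).
  move=> m0 h /le_trans; apply.
  rewrite [leRHS](_ : _ = C * (10 * (t * (L - 1)) / ((1 + 2 * t) * (L + t)))).
    by apply: ler_wpM2l => //; rewrite ler_pdivlMr.
  by rewrite !mulrA [10 * C]mulrC.
have [t1|t1] := leP t 1.
  apply: (key t) => //; first exact: ltW.
  have -> : 10 * (t * (L - 1)) = t * (10 * (L - 1)) by ring.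
  by apply: ler_wpM2l; [exact: ltW|nra].
have [t2|t2] := leP t (2 * L).
  by apply: (key 1) => //; [nra|rewrite mulr1].
apply: (key t^-1) => //; first by rewrite invr_ge0 ltW.
  rewrite ler_pdivrMl//.
  by nra.
by apply: F3; rewrite /L in t2 *; lra.
Qed.

End telescoping.

(** * The Hormander condition for lacunary sums *)

Section hormander.
Variable R : realType.
Local Notation mu := (@lebesgue_measure R).

(** These are the only properties of a Schwartz function that the kernel
    estimates use: an L^1 modulus of continuity for increments that are small
    at the scale of phi, the L^1 norm for moderate ones, the tail for large
    ones. *)
Definition profile (phi : R -> R) (C : R) := [/\ bddint phi,
  \int[mu]_x `|phi x| <= C,
  forall t, \int[mu]_x `|phi (x - t) - phi x| <= C * `|t| &
  forall r, 0 < r ->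
    (\int[mu]_(x in [set x | (r <= `|x|)%R]) `|phi x|%:E <= (C / r)%:E)%E].

Definition dilate (phi : R -> R) (s b : R) : R -> R := fun x => s * phi (s * x - b).

Lemma bddint_dilate phi s b : 0 < s -> bddint phi -> bddint (dilate phi s b).
Proof. by move=> s0 bp; apply: bddintZ; exact: (bddint_affine (- b)). Qed.

Lemma Rint_norm_dilate phi s b : 0 < s -> bddint phi ->
  \int[mu]_x `|dilate phi s b x| = \int[mu]_x `|phi x|.
Proof.
move=> s0 bp; have bn := bddint_norm bp.
transitivity (\int[mu]_x (s * `|phi (s * x - b)|)).
  by apply: eq_Rintegral => x _; rewrite /dilate normrM gtr0_norm.
rewrite RintZ; last exact: (bddint_affine (- b) s0 bn).
rewrite (Rintegral_affine (- b) s0 (bddint_integrable bn)).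
by rewrite mulrA divff ?mul1r// gt_eqF.
Qed.

(** Rescaling reduces to s = 1 with the increment t = s |z|. The modulus of
    continuity bounds the integral by C t and the L^1 norm by 2 C. When t >= 2
    |b| the shift by b is too small to bring the region of integration near
    the origin, and the tail bound gives 4 C / t. *)
Lemma hormander_dilate phi C s b z : profile phi C -> 0 < s -> z != 0 ->
  (\int[mu]_(x in [set x | (2 * `|z| <= `|x|)%R])
    `|dilate phi s b (x - z) - dilate phi s b x|%:E <=
   (40 * C * (s * `|z| * (10 + `|b| - 1) /
      ((1 + 2 * (s * `|z|)) * (10 + `|b| + s * `|z|))))%:E)%E.
Proof.
move=> [bp pC pL pT] s0 z0.
have C0 : 0 <= C by apply: le_trans pC; exact: Rint_ge0.
set t := s * `|z|; have t0 : 0 < t by rewrite mulr_gt0// normr_gt0.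
have mp := bddint_measurable bp.
pose D := [set w : R | 2 * t <= `|w + b|].
have mD : measurable D.
  rewrite (_ : D = setT `&` (fun w => w + b) @^-1` [set x : R | 2 * t <= `|x|]).
    have ma : measurable_fun setT (fun w : R => w + b) by exact: measurable_funD.
    by apply: ma => //; exact: measurable_norm_ge.
  by rewrite setTI.
pose h (w : R) : R := `|phi (w - s * z) - phi w|.
have bh : bddint h.
  by apply: bddint_norm; apply: bddintB => //; exact: bddint_shift.
have mh : measurable_fun setT (fun w => (h w)%:E).
  by apply/measurable_EFinP; exact: bddint_measurable.
pose g := (fun w => (h w)%:E) \_ D.
have mg : measurable_fun setT g.
  by apply/(measurable_restrictT _ mD); exact: measurable_funTS.
have g0 w : (0 <= g w)%E by rewrite /g patchE; case: ifP => // _; rewrite lee_fin normr_ge0.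
have -> : (\int[mu]_(x in [set x | (2 * `|z| <= `|x|)%R])
    `|dilate phi s b (x - z) - dilate phi s b x|%:E = \int[mu]_(w in D) (h w)%:E)%E.
  rewrite [RHS]integral_mkcond (ge0_integral_affine (- b) s0 mg g0).
  have mga : measurable_fun setT (fun x : R => g (s * x - b)%R).
    by apply: (measurableT_comp mg); exact: measurable_affine.
  rewrite -(integral_scale (ltW s0) mga (fun x => g0 _)) integral_mkcond.
  apply: eq_integral => x _; rewrite /g !patchE.
  have -> : (x \in [set x | (2 * `|z| <= `|x|)%R]) = (s * x - b \in D).
    have E : (2 * `|z| <= `|x|) = (2 * t <= `|s * x - b + b|).
      by rewrite subrK normrM (gtr0_norm s0) /t mulrCA ler_pM2l.
    by apply/idP/idP => /set_mem H; apply/mem_set; move: H; rewrite /D/= E.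
  case: ifP => _; last by rewrite mule0.
  rewrite -EFinM /h /dilate -mulrBr normrM (gtr0_norm s0).
  by congr (s * `|phi _ - _|)%:E; ring.
set F := (\int[mu]_(w in D) (h w)%:E)%E.
have Fle : (F <= (\int[mu]_w h w)%:E)%E.
  rewrite EFin_Rintegral; last exact: bddint_integrable.
  by apply: ge0_subset_integral => //; move=> w _; rewrite lee_fin normr_ge0.
have Ffin : F \is a fin_num.
  rewrite ge0_fin_numE; first exact: le_lt_trans Fle (ltry _).
  by apply: integral_ge0 => w _; rewrite lee_fin normr_ge0.
rewrite -(fineK Ffin) lee_fin.
have FleR : fine F <= \int[mu]_w h w by rewrite -lee_fin fineK.
have -> : 40 * C = 10 * (4 * C) by ring.
have C4 : 0 <= 4 * C by rewrite mulr_ge0.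
apply: three_regimes => //.
- apply: (le_trans FleR); apply: (le_trans (pL _)).
  rewrite normrM (gtr0_norm s0) -/t; apply: ler_wpM2r; first exact: ltW.
  by lra.
- apply: (le_trans FleR).
  apply: (@le_trans _ _ (\int[mu]_w (`|phi (w - s * z)| + `|phi w|))).
    apply: le_Rint => //.
      by apply: bddintD; apply: bddint_norm => //; exact: bddint_shift.
    by move=> w; exact: ler_normB.
  rewrite RintD; [|by apply: bddint_norm; exact: bddint_shift|exact: bddint_norm].
  rewrite (@Rintegral_shift _ _ (fun w => `|phi w|)); last exact: bddint_measurable (bddint_norm bp).
  by lra.
- move=> bt; rewrite -lee_fin fineK//.
  pose D' := [set x : R | t / 2 <= `|x|].
  have mD' : measurable D' by exact: measurable_norm_ge.
  pose e (w : R) : \bar R := ((fun x => `|phi x|%:E) \_ D') w.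
  have me : measurable_fun setT e.
    apply/(measurable_restrictT _ mD'); apply: measurable_funTS.
    by apply/measurable_EFinP; exact: measurableT_comp.
  have e0 w : (0 <= e w)%E by rewrite /e patchE; case: ifP.
  have mes : measurable_fun setT (fun w : R => e (w - s * z)%R).
    by apply: (measurableT_comp me); exact: measurable_funB.
  have eE : (\int[mu]_w e w <= (C / (t / 2))%:E)%E.
    by rewrite /e -integral_mkcond; apply: pT; rewrite divr_gt0.
  apply: (@le_trans _ _ (\int[mu]_w (e (w - s * z)%R + e w))%E).
    rewrite /F integral_mkcond; apply: ge0_le_integral => //.
    + exact: emeasurable_funD.
    + move=> w _; rewrite patchE; case: ifPn => [/set_mem Dw|_]; last exact: adde_ge0.
      have zt : `|s * z| = t by rewrite normrM (gtr0_norm s0).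
      have wb : 2 * t <= `|w| + `|b| by apply: le_trans (ler_normD _ _).
      have w2 : t / 2 <= `|w| by lra.
      have wz : t / 2 <= `|w - s * z|.
        by have := lerB_dist w (s * z); rewrite zt; lra.
      rewrite /e !patchE !mem_set//= -EFinD lee_fin /h.
      exact: ler_normB.
  rewrite ge0_integralD// (ge0_integral_shift (- (s * z)) me e0).
  apply: (le_trans (leeD eE eE)); rewrite -EFinD lee_fin le_eqVlt.
  by apply/orP; left; apply/eqP; field; rewrite gt_eqF.
Qed.

Section lacunary_family.
Variables (phi : R -> R) (C b : R) (s : nat -> R) (N : nat).
Hypotheses (phiC : profile phi C) (s_gt0 : forall i, 0 < s i)
  (s_lac : forall i, 2 * s i <= s i.+1).
Hypothesis orth : forall i j, (i + 2 < j)%N || (j + 2 < i)%N ->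
  forall t, conv (fun z => dilate phi (s i) b (- z)) (dilate phi (s j) b) t = 0.

(** The Hormander integrals of the scales add up to O(ln (10 + |b|)) by
    lacunary_sum_le, and the L^2 bound is almost orthogonality. Neither
    depends on N or on the signs, as Khintchine's inequality requires. *)
Lemma cz_kernel_lacunary (eps : nat -> R) : (forall i, `|eps i| <= 1) ->
  cz_kernel (fun x => \sum_(i < N) eps i * dilate phi (s i) b x)
    (40 * C * ln (10 + `|b|)) (9 * C ^+ 2).
Proof.
move=> e1; have [bp pC pL pT] := phiC.
have C0 : 0 <= C by apply: le_trans pC; exact: Rint_ge0.
have bd i : bddint (dilate phi (s i) b) := bddint_dilate b (s_gt0 i) bp.
have b0 : 0 <= `|b| by [].
have L1 : 1 <= 10 + `|b| by lra.
split.
- by apply: bddint_sum => i _; exact: bddintZ.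
- by rewrite !mulr_ge0// ln_ge0.
- by rewrite mulr_ge0// sqr_ge0.
- move=> u bu.
  have psiC i : \int[mu]_x `|dilate phi (s i) b x| <= C.
    by rewrite (Rint_norm_dilate b (s_gt0 i) bp).
  exact: (L2_signed_sum N bd psiC orth e1 bu).
move=> z; have [->|z0] := eqVneq z 0.
  rewrite integral0_eq; first by rewrite lee_fin !mulr_ge0// ln_ge0.
  by move=> x _; rewrite subr0 subrr normr0.
set D := [set x | _].
have mD : measurable D by exact: measurable_norm_ge.
have md i : measurable_fun D (fun x => `|dilate phi (s i) b (x - z) - dilate phi (s i) b x|%:E).
  apply: measurable_funTS; apply/measurable_EFinP; apply: measurableT_comp => //.
  apply: measurable_funB; last exact: bddint_measurable.
  exact: (bddint_measurable (bddint_shift (- z) (bd i))).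
apply: (@le_trans _ _ (\int[mu]_(x in D)
    (\sum_(i < N) `|(dilate phi (s i) b (x - z) - dilate phi (s i) b x)%R|%:E)%E)%E).
  apply: ge0_le_integral => //.
  - apply: measurable_funTS; apply/measurable_EFinP; apply: measurableT_comp => //.
    have bK : bddint (fun x => \sum_(i < N) eps i * dilate phi (s i) b x).
      by apply: bddint_sum => i _; exact: bddintZ.
    apply: measurable_funB; last exact: bddint_measurable.
    exact: (bddint_measurable (bddint_shift (- z) bK)).
  - exact: (@emeasurable_sum _ _ R D 'I_N (index_enum _)
      (fun i x => `|dilate phi (s i) b (x - z) - dilate phi (s i) b x|%:E) (fun i => md i)).
  - move=> x _; rewrite sumEFin lee_fin -sumrB.
    apply: (le_trans (ler_norm_sum _ _ _)); apply: ler_sum => i _.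
    by rewrite -mulrBr normrM ler_piMl.
rewrite ge0_integral_sum//; last by move=> i; exact: md.
apply: (@le_trans _ _ (\sum_(i < N) (40 * C * (s i * `|z| * (10 + `|b| - 1) /
      ((1 + 2 * (s i * `|z|)) * (10 + `|b| + s i * `|z|))))%:E)%E).
  by apply: lee_sum => i _; exact: hormander_dilate.
rewrite sumEFin lee_fin -mulr_sumr; apply: ler_wpM2l; first exact: mulr_ge0.
exact: lacunary_sum_le.
Qed.

End lacunary_family.
End hormander.

(** * Khintchine's inequality *)

Section rademacher.
Variable R : realType.
Local Notation mu := (@lebesgue_measure R).
Implicit Types (e a : nat -> R) (F G : (nat -> R) -> R).

Definition set_sign e (n : nat) (c : R) : nat -> R :=
  fun i => if i == n then c else e i.

(** The expectation over n independent random signs, written by recursion so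
    that moments are computed by induction. *)
Fixpoint rademacher (n : nat) F : R :=
  if n is m.+1 then
    (rademacher m (fun e => F (set_sign e m 1)) +
     rademacher m (fun e => F (set_sign e m (-1)))) / 2
  else F (fun=> 0).

(** Bounded by 1 rather than equal to 1 in modulus: the recursion starts from
    the zero sequence. *)
Definition signs e := forall i, `|e i| <= 1.

Lemma signs_set e n (c : R) : signs e -> `|c| <= 1 -> signs (set_sign e n c).
Proof. by move=> es c1 i; rewrite /set_sign; case: ifP. Qed.

Lemma signs_pos e n : signs e -> signs (set_sign e n 1).
Proof. by move=> es; apply: signs_set => //; rewrite normr1. Qed.

Lemma signs_neg e n : signs e -> signs (set_sign e n (-1)).
Proof. by move=> es; apply: signs_set => //; rewrite normrN1. Qed.

Lemma le_rademacher n F G : (forall e, signs e -> F e <= G e) ->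
  rademacher n F <= rademacher n G.
Proof.
elim: n F G => [|n ih] F G FG /=; first by apply: FG => i; rewrite normr0.
rewrite ler_pM2r; last by rewrite invr_gt0.
by apply: lerD; apply: ih => e es; apply: FG; [exact: signs_pos|exact: signs_neg].
Qed.

Lemma eq_rademacher n F G : (forall e, signs e -> F e = G e) ->
  rademacher n F = rademacher n G.
Proof.
by move=> FG; apply/eqP; rewrite eq_le; apply/andP; split;
  apply: le_rademacher => e es; rewrite FG.
Qed.

Lemma rademacherD n F G :
  rademacher n (fun e => F e + G e) = rademacher n F + rademacher n G.
Proof. by elim: n F G => //= n ih F G; rewrite !ih; field. Qed.

Lemma rademacherZ n (c : R) F : rademacher n (fun e => c * F e) = c * rademacher n F.
Proof. by elim: n F => //= n ih F; rewrite !ih; field. Qed.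

Lemma rademacher_cst n (c : R) : rademacher n (fun=> c) = c.
Proof. by elim: n => //= n ->; field. Qed.

Lemma bddint_rademacher n (f : (nat -> R) -> R -> R) :
  (forall e, signs e -> bddint (f e)) ->
  bddint (fun x => rademacher n (f ^~ x)) /\
  \int[mu]_x rademacher n (f ^~ x) = rademacher n (fun e => \int[mu]_x f e x).
Proof.
elim: n f => [|n ih] f bf /=.
  by split => //; apply: bf => i; rewrite normr0.
have [b1 E1] := ih (fun e => f (set_sign e n 1)) (fun e es => bf _ (signs_pos n es)).
have [b2 E2] := ih (fun e => f (set_sign e n (-1))) (fun e es => bf _ (signs_neg n es)).
rewrite -E1 -E2; split.
  have := bddintZ 2^-1 (bddintD b1 b2); congr bddint.
  by apply/funext => x; rewrite mulrC.
rewrite -RintD// mulrC -RintZ; last exact: bddintD.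
by apply: eq_Rintegral => x _; rewrite mulrC.
Qed.

Lemma sum_set_sign e a n (c : R) :
  \sum_(i < n.+1) set_sign e n c i * a i = \sum_(i < n) e i * a i + c * a n.
Proof.
rewrite big_ord_recr/= /set_sign eqxx; congr (_ + _).
by apply: eq_bigr => i _; rewrite ltn_eqF.
Qed.

Lemma rademacher_moment2 a n :
  rademacher n (fun e => (\sum_(i < n) e i * a i) ^+ 2) = \sum_(i < n) a i ^+ 2.
Proof.
elim: n => [|n ih] /=; first by rewrite !big_ord0 expr0n.
rewrite big_ord_recr/= -ih -rademacherD.
rewrite (@eq_rademacher _ _ (fun e => 2 * ((\sum_(i < n) e i * a i) ^+ 2 + a n ^+ 2))).
  by rewrite rademacherZ rademacherD rademacher_cst; field.
by move=> e _; rewrite !sum_set_sign; ring.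
Qed.

Lemma rademacher_moment4 a n :
  rademacher n (fun e => (\sum_(i < n) e i * a i) ^+ 4) <=
  3 * (\sum_(i < n) a i ^+ 2) ^+ 2.
Proof.
elim: n => [|n ih] /=; first by rewrite !big_ord0 !expr0n mulr0.
rewrite big_ord_recr/= -rademacherD.
rewrite (@eq_rademacher _ _ (fun e => 2 * ((\sum_(i < n) e i * a i) ^+ 4 +
  (6 * a n ^+ 2 * (\sum_(i < n) e i * a i) ^+ 2 + a n ^+ 4)))); last first.
  by move=> e _; rewrite !sum_set_sign; ring.
rewrite rademacherZ rademacherD rademacherD rademacherZ rademacher_cst.
rewrite rademacher_moment2; move: ih.
set E4 := rademacher _ _; set S := \sum_(i < n) _; set c := a n => ih.
have : 0 <= c ^+ 4 by rewrite exprn_even_ge0.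
nra.
Qed.

(** The constant suffices for |y| <= 1 / 2, the fourth power for y ^ 2 >= 6,
    and the p-th power in between. The coefficients 1 / 4 and 1 / 6 are chosen
    so that, when y has second moment 1 and fourth moment at most 3, the first
    two terms average to at most 3 / 4. *)
Lemma khintchine_pointwise (y p : R) : 0 < p ->
  y ^+ 2 <= 1 / 4 + (y ^+ 4 / 6 + 6 * (2 * `|y|) `^ p).
Proof.
move=> p0.
have P0 : 0 <= (2 * `|y|) `^ p by exact: powR_ge0.
have y40 : 0 <= y ^+ 4 by rewrite exprn_even_ge0.
have ye : y ^+ 4 = (y ^+ 2) ^+ 2 by ring.
have y2 : y ^+ 2 = `|y| ^+ 2 by rewrite real_normK// num_real.
have [h|h] := leP `|y| 2^-1.
  have : `|y| ^+ 2 <= 1 / 4 by have := normr_ge0 y; nra.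
  by rewrite -y2; lra.
(* y ^ 2 >= 6 gives y ^ 4 / 6 >= y ^ 2 *)
have [h6|h6] := leP 6 (y ^+ 2).
  by rewrite ye; nra.
have P1 : 1 <= (2 * `|y|) `^ p.
  have h1 : 1 <= 2 * `|y| by lra.
  by rewrite -[leLHS](powRr0 (2 * `|y|)); apply: ler_powR => //; exact: ltW.
lra.
Qed.

(** After normalising the coefficients in l^2, average khintchine_pointwise
    over the signs: the p-th moment must account for the missing 1 / 4. *)
Lemma khintchine a n (p : R) : 0 < p ->
  (\sum_(i < n) a i ^+ 2) `^ (p / 2) <=
  24 * 2 `^ p * rademacher n (fun e => `|\sum_(i < n) e i * a i| `^ p).
Proof.
move=> p0; set S := \sum_(i < n) a i ^+ 2.
have p20 : p / 2 != 0 by rewrite gt_eqF// divr_gt0.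
have S0 : 0 <= S by apply: sumr_ge0 => i _; exact: sqr_ge0.
have t2p0 : 0 <= 2 `^ p by exact: powR_ge0.
have av0 b : 0 <= rademacher n (fun e => `|\sum_(i < n) e i * b i| `^ p).
  rewrite -[leLHS](rademacher_cst n); apply: le_rademacher => e _.
  exact: powR_ge0.
have [Sz|Sn] := eqVneq S 0.
  rewrite Sz powR0//; apply: mulr_ge0 => //; exact: mulr_ge0.
have Sp : 0 < S by rewrite lt_neqAle eq_sym Sn.
pose sg := Num.sqrt S; have sg0 : 0 < sg by rewrite sqrtr_gt0.
pose b i := a i / sg.
have bE e : \sum_(i < n) e i * b i = (\sum_(i < n) e i * a i) / sg.
  by rewrite mulr_suml; apply: eq_bigr => i _; rewrite mulrA.
have b1 : \sum_(i < n) b i ^+ 2 = 1.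
  rewrite (eq_bigr (fun i : 'I_n => a i ^+ 2 * S^-1)); last first.
    by move=> i _; rewrite /b expr_div_n sqr_sqrtr.
  by rewrite -mulr_suml divff.
set E := rademacher n _.
have EE : rademacher n (fun e => `|\sum_(i < n) e i * b i| `^ p) = E / sg `^ p.
  rewrite mulrC -rademacherZ; apply: eq_rademacher => e _.
  rewrite bE normrM normfV (gtr0_norm sg0) powRM//; last by rewrite invr_ge0 ltW.
  rewrite mulrC; congr (_ * _).
  rewrite -powRN -mulN1r powRrM powR_inv1//; exact: ltW.
have sgp : sg `^ p = S `^ (p / 2).
  by rewrite /sg -powR12_sqrt// -powRrM mulrC.
have H : 1 <= 1 / 4 + (3 / 6 + 6 * (2 `^ p * (E / sg `^ p))).
  rewrite -{1}b1 -rademacher_moment2.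
  apply: (@le_trans _ _ (rademacher n (fun e => 1 / 4 +
     (6^-1 * (\sum_(i < n) e i * b i) ^+ 4 +
      6 * 2 `^ p * `|\sum_(i < n) e i * b i| `^ p)))).
    apply: le_rademacher => e _; apply: (le_trans (khintchine_pointwise _ p0)).
    rewrite lerD2l; apply: lerD; first by rewrite [leLHS]mulrC lexx.
    by rewrite powRM// mulrA lexx.
  rewrite !rademacherD rademacher_cst !rademacherZ EE.
  have := rademacher_moment4 b n; rewrite b1 expr1n mulr1 => m4.
  rewrite lerD2l; apply: lerD; last by rewrite [leRHS]mulrA lexx.
  by rewrite mulrC ler_pM2r ?invr_gt0.
have sgp0 : 0 < sg `^ p by exact: powR_gt0.
rewrite -sgp -(@ler_pM2r _ (sg `^ p)^-1) ?invr_gt0// divff ?gt_eqF//.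
move: H; move: (2 `^ p) => t H; rewrite -!mulrA.
by move: (t * _) H => w; lra.
Qed.

End rademacher.

(** * The square function of a bounded integrable function *)

Section limits.
Variable R : realType.

(** Additive constants are absorbed into the logarithm. *)
Lemma ln10_ge1 (b : R) : 0 <= b -> 1 <= ln (10 + b).
Proof.
move=> b0; have h2 : 2^-1 <= ln (2 : R).
  have : ln (1 + (- 2^-1) : R) <= - 2^-1 by apply: le_ln1Dx; lra.
  have -> : 1 + - 2^-1 = 2^-1 :> R by lra.
  by rewrite lnV ?posrE//; lra.
apply: (@le_trans _ _ (ln (2 * 2))).
  by rewrite lnM ?posrE//; lra.
by rewrite ler_ln ?posrE//; lra.
Qed.

Lemma cvg_powR (S_ : nat -> R) (S q : R) : 0 < q -> (forall n, 0 <= S_ n) ->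
  S_ @ \oo --> S -> (fun n => S_ n `^ q) @ \oo --> S `^ q.
Proof.
move=> q0 S0 cS; have Sge0 : 0 <= S.
  apply: (cvgr_to_ge cS); exact: nearW.
have [Sz|Sn] := eqVneq S 0.
  rewrite Sz powR0 ?gt_eqF// in cS *.
  apply/cvgrPdist_lt => e e0.
  have e1 : 0 < e `^ q^-1 by exact: powR_gt0.
  move/cvgrPdist_lt : cS => /(_ _ e1); apply: filterS => n.
  rewrite !sub0r !normrN (ger0_norm (S0 n)) (ger0_norm (powR_ge0 _ _)) => h.
  have -> : e = (e `^ q^-1) `^ q by rewrite -powRrM mulVf ?gt_eqF// powRr1// ltW.
  by apply: gt0_ltr_powR => //; rewrite nnegrE ?powR_ge0.
have Sp : 0 < S by rewrite lt_neqAle eq_sym Sn.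
have Sin : S \in `]0, +oo[ by rewrite in_itv/= Sp.
have dS : derivable (fun x : R => x `^ q) S 1 by exact: derivable_powR Sin.
have cpow : {for S, continuous (fun x : R => x `^ q)}.
  by apply: differentiable_continuous; apply/derivable1_diffP.
exact: (@continuous_cvg _ _ _ _ _ S_ (fun x : R => x `^ q) S cpow cS).
Qed.

Lemma limn_einf_le (u : nat -> \bar R) (c : \bar R) : (forall n, u n <= c)%E ->
  (limn_einf u <= c)%E.
Proof.
move=> uc; rewrite limn_einf_lim; apply: lime_le; first exact: is_cvg_einfs.
by apply: nearW => n; apply: le_trans (uc n); apply: ereal_inf_lbound; exists n => /=.
Qed.

End limits.

Section square_function.
Variable R : realType.
Local Notation mu := (@lebesgue_measure R).

Definition orthogonal_scales (phi : R -> R) (s : nat -> R) (b : R) :=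
  forall i j, (i + 2 < j)%N || (j + 2 < i)%N ->
  forall t, conv (fun z => dilate phi (s i) b (- z)) (dilate phi (s j) b) t = 0.

Lemma measurable_square_sum (v : nat -> R -> R) (N : nat) (p : R) :
  (forall i, measurable_fun setT (v i)) ->
  measurable_fun setT (fun x => (\sum_(i < N) v i x ^+ 2) `^ p).
Proof.
move=> mv; apply: (measurableT_comp (measurable_powR p)).
by apply: measurable_sum => i; exact: measurable_funX.
Qed.

(** By Khintchine's inequality the p-th power of the square function is
    dominated by the average over signs of the p-th powers of signed sums.
    Each signed sum is a convolution by a Calderon-Zygmund kernel with
    constants O(ln (10 + |b|)), by cz_kernel_lacunary, and conv_Lp bounds it
    on L^p. *)
Lemma square_function_bddint (phi : R -> R) (C p : R) : 1 < p -> profile phi C ->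
  exists2 K : R, 0 <= K & forall (b : R) (s : nat -> R) (N : nat) (u : R -> R),
  (forall i, 0 < s i) -> (forall i, 2 * s i <= s i.+1) ->
  orthogonal_scales phi s b -> bddint u ->
  (\int[mu]_x ((\sum_(i < N) conv (dilate phi (s i) b) u x ^+ 2) `^ (p / 2))%:E <=
   (K * ln (10 + `|b|) `^ p)%:E * \int[mu]_x (`|u x| `^ p)%:E)%E.
Proof.
move=> p1 phiC; have p0 : 0 < p by exact: lt_trans p1.
have [Cp Cp0 HCp] := conv_Lp p1.
have [bp pC _ _] := phiC.
have C0 : 0 <= C by apply: le_trans pC; exact: Rint_ge0.
(* 1 + A + B <= c ln (10 + |b|) for the constants A, B of cz_kernel_lacunary *)
set c := 1 + 40 * C + 9 * C ^+ 2.
have c0 : 0 <= c by rewrite /c; have := sqr_ge0 C; lra.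
have t2p0 : 0 <= 2 `^ p :> R by exact: powR_ge0.
have K0 : 0 <= 24 * 2 `^ p * (Cp * c `^ p).
  by apply: mulr_ge0; apply: mulr_ge0 => //; exact: powR_ge0.
exists (24 * 2 `^ p * (Cp * c `^ p)); first exact: K0.
move=> b s N u s0 s2 orth bu.
have bpsi i : bddint (dilate phi (s i) b) := bddint_dilate b (s0 i) bp.
pose v i := conv (dilate phi (s i) b) u.
have bv i : bddint (v i) by exact: bddint_conv.
pose L := ln (10 + `|b|); have L1 : 1 <= L by exact: ln10_ge1.
have L0 : 0 <= L by lra.
pose Ke (e : nat -> R) x := \sum_(i < N) e i * dilate phi (s i) b x.
have KeE (e : nat -> R) x : \sum_(i < N) e i * v i x = conv (Ke e) u x.
  rewrite /Ke conv_suml//; last by move=> i _; exact: bddintZ.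
  by apply: eq_bigr => i _; rewrite convZl.
pose f (e : nat -> R) x := `|\sum_(i < N) e i * v i x| `^ p.
have bf e : signs e -> bddint (f e).
  move=> es; apply: (bddint_powR (ltW p1) (f := fun x => \sum_(i < N) e i * v i x)).
  by apply: bddint_sum => i _; exact: bddintZ.
have [bavg Eavg] := bddint_rademacher N bf.
have Iup : mu.-integrable setT (EFin \o (fun x => `|u x| `^ p)).
  by apply: bddint_integrable; apply: bddint_powR => //; exact: ltW.
have fle e : signs e -> \int[mu]_x f e x <= Cp * (c * L) `^ p * \int[mu]_x (`|u x| `^ p).
  move=> es; rewrite /f; under eq_Rintegral do rewrite KeE.
  have K := cz_kernel_lacunary N phiC s0 s2 orth es.
  apply: (le_trans (HCp _ _ _ _ K bu)).
  apply: ler_wpM2r; first by apply: Rint_ge0 => x; exact: powR_ge0.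
  apply: ler_wpM2l => //.
  have CL : 0 <= C * L by exact: mulr_ge0.
  have C2 : 0 <= C ^+ 2 by exact: sqr_ge0.
  apply: ge0_ler_powR; first exact: ltW.
  - by rewrite nnegrE -/L; lra.
  - by rewrite nnegrE mulr_ge0.
  - have : 0 <= C ^+ 2 * (L - 1) by rewrite mulr_ge0// subr_ge0.
    by rewrite -/L /c; lra.
have tK0 : 0 <= 24 * 2 `^ p :> R by exact: mulr_ge0.
apply: (@le_trans _ _ (\int[mu]_x (24 * 2 `^ p * rademacher N (f ^~ x)))%:E).
  rewrite EFin_Rintegral; last by apply: bddint_integrable; exact: bddintZ.
  apply: ge0_le_integral => //.
  - by move=> x _; rewrite lee_fin powR_ge0.
  - apply/measurable_EFinP.
    exact: (measurable_square_sum N (p / 2) (fun i => bddint_measurable (bv i))).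
  - by apply/measurable_EFinP; exact: (bddint_measurable (bddintZ _ bavg)).
  - by move=> x _; rewrite lee_fin; exact: (khintchine (v ^~ x) N p0).
rewrite RintZ// Eavg -(EFin_Rintegral Iup) -EFinM lee_fin.
move: tK0; move: (24 * 2 `^ p) => t tK0.
set I := \int[mu]_x (`|u x| `^ p).
have -> : t * (Cp * c `^ p) * ln (10 + `|b|) `^ p * I =
    t * (Cp * (c `^ p * ln (10 + `|b|) `^ p) * I) by rewrite !mulrA.
apply: ler_wpM2l => //; rewrite -(powRM p c0 L0).
rewrite -[leRHS](rademacher_cst N); apply: le_rademacher => e es.
exact: fle.
Qed.

End square_function.

(** * The square function on L^p *)

Section truncation.
Variable R : realType.
Local Notation mu := (@lebesgue_measure R).
Implicit Types (u k : R -> R) (n : nat).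

Definition truncate u n (y : R) : R :=
  if `|u y| <= n%:R then (if `|y| <= n%:R then u y else 0) else 0.

Lemma truncate_le u n y : `|truncate u n y| <= `|u y|.
Proof. by rewrite /truncate; case: ifP; [case: ifP|]; rewrite ?normr0. Qed.

Lemma measurable_truncate u n : measurable_fun setT u ->
  measurable_fun setT (truncate u n).
Proof.
move=> mu'; apply: measurable_if_le => //; first exact: measurableT_comp.
exact: measurable_if_le.
Qed.

Lemma bddint_truncate u n : measurable_fun setT u -> bddint (truncate u n).
Proof.
move=> mu'; have mt := measurable_truncate n mu'.
have bI : bddint (\1_(`[- n%:R, n%:R]%classic) : R -> R).
  split; first exact: measurable_indic.
  - by exists 1 => x; rewrite indicE; case: (_ \in _); rewrite ?normr1 ?normr0.
  - exact: integrable_indic_itv.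
apply: (bddint_dom (c := n%:R) bI mt) => y.
rewrite /truncate indicE; case: ifPn => [un|_]; last by rewrite normr0 mulr_ge0.
case: ifPn => [yn|_]; last by rewrite normr0 mulr_ge0.
rewrite mem_set ?normr1 ?mulr1//=.
by rewrite in_itv/= -ler_norml.
Qed.

Lemma truncate_cvg u y : truncate u n y @[n --> \oo] --> u y.
Proof.
apply: cvg_near_cst; near=> n.
rewrite /truncate ifT; first rewrite ifT//.
- by near: n; exact: nbhs_infty_ger.
- by near: n; exact: nbhs_infty_ger.
Unshelve. all: by end_near. Qed.

Lemma cvg_sum_ord (f : nat -> nat -> R) (l : nat -> R) (N : nat) :
  (forall i, f i n @[n --> \oo] --> l i) ->
  \sum_(i < N) f i n @[n --> \oo] --> \sum_(i < N) l i.
Proof.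
move=> fl; elim: N => [|N ih].
  rewrite big_ord0; under eq_fun do rewrite big_ord0.
  exact: cvg_cst.
rewrite big_ord_recr/=; under eq_fun do rewrite big_ord_recr/=.
exact: cvgD.
Qed.

Section Lp.
Variable p : R.
Hypothesis p1 : 1 <= p.

Lemma le_1_powR (t : R) : 0 <= t -> t <= 1 + t `^ p.
Proof.
move=> t0; have P := powR_ge0 t p; have [t1|t1] := leP t 1; first by lra.
by have := le1r_powR (ltW t1) p1; lra.
Qed.

(** Since t <= 1 + t^p, the product of a bounded integrable k with an L^p
    function u is dominated by |k| + M |u|^p. *)
Lemma integrable_conv_Lp_dom k u x (M : R) : bddint k ->
  measurable_fun setT u -> (forall z, `|k z| <= M) ->
  (\int[mu]_y (`|u y| `^ p)%:E < +oo)%E ->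
  mu.-integrable setT (EFin \o (fun y : R => `|k (x - y)| + M * `|u y| `^ p)).
Proof.
move=> bk mu' kM uoo.
have mup : measurable_fun setT (fun y => `|u y| `^ p).
  by apply: (measurableT_comp (measurable_powR p)); exact: measurableT_comp.
have Iu : mu.-integrable setT (EFin \o (fun y => `|u y| `^ p)).
  apply/integrableP; split; first exact/measurable_EFinP.
  apply: le_lt_trans uoo; apply: ge0_le_integral => //.
  - by apply/measurable_EFinP; exact: measurableT_comp.
  - exact/measurable_EFinP.
  - by move=> y _ /=; rewrite lee_fin ger0_norm// powR_ge0.
have Ik := bddint_integrable (bddint_norm (bddint_reflect x bk)).
exact: (integrableD _ Ik (integrableZl _ M Iu)).
Qed.

Lemma conv_integrand_dom k u x (M : R) y (w : R) : (forall z, `|k z| <= M) ->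
  `|w| <= `|u y| -> `|k (x - y) * w| <= `|k (x - y)| + M * `|u y| `^ p.
Proof.
move=> kM wu; rewrite normrM.
apply: (@le_trans _ _ (`|k (x - y)| * (1 + `|u y| `^ p))).
  by apply: ler_wpM2l => //; apply: (le_trans wu); exact: le_1_powR.
by rewrite mulrDr mulr1 lerD2l ler_wpM2r// powR_ge0.
Qed.

Lemma measurable_conv_slice k u x : bddint k -> measurable_fun setT u ->
  measurable_fun setT (fun y : R => k (x - y) * u y).
Proof.
move=> bk mu'; apply: measurable_funM => //.
by have /bddint_measurable := bddint_reflect x bk.
Qed.

Lemma integrable_conv_Lp k u x : bddint k -> measurable_fun setT u ->
  (\int[mu]_y (`|u y| `^ p)%:E < +oo)%E ->
  mu.-integrable setT (EFin \o (fun y : R => k (x - y) * u y)).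
Proof.
move=> bk mu' uoo; have [M M0 kM] := bddint_bounded bk.
apply: le_integrable (integrable_conv_Lp_dom x bk mu' kM uoo) => //.
  by apply/measurable_EFinP; exact: measurable_conv_slice.
move=> y _; rewrite lee_fin (ger0_norm (x := _ + _)).
  exact: conv_integrand_dom.
by rewrite addr_ge0// mulr_ge0// powR_ge0.
Qed.

Lemma conv_truncate_cvg k u x : bddint k -> measurable_fun setT u ->
  (\int[mu]_y (`|u y| `^ p)%:E < +oo)%E ->
  conv k (truncate u n) x @[n --> \oo] --> conv k u x.
Proof.
move=> bk mu' uoo; have [M M0 kM] := bddint_bounded bk.
have mf n : measurable_fun setT (fun y : R => (k (x - y) * truncate u n y)%:E).
  apply/measurable_EFinP; apply: measurable_conv_slice => //.
  exact: measurable_truncate.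
have mf' : measurable_fun setT (fun y : R => (k (x - y) * u y)%:E).
  by apply/measurable_EFinP; exact: measurable_conv_slice.
have Ig := integrable_conv_Lp_dom x bk mu' kM uoo.
have cf : {ae mu, forall y, setT y ->
    (k (x - y) * truncate u n y)%:E @[n --> \oo] --> (k (x - y) * u y)%:E}.
  apply: aeW => y _; apply: cvg_EFin; first exact: nearW.
  by apply: cvgMr; exact: truncate_cvg.
have df : {ae mu, forall y n, setT y -> (`|(k (x - y) * truncate u n y)%:E| <=
    (EFin \o (fun y : R => (`|k (x - y)| + M * `|u y| `^ p)%R)) y)%E}.
  apply: aeW => y n _; rewrite lee_fin.
  by apply: conv_integrand_dom => //; exact: truncate_le.
have [_ _ H] := @dominated_convergence _ _ R mu setT measurableT _ _ _ mf mf' cf Ig df.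
apply: fine_cvg; rewrite EFin_Rintegral//.
exact: integrable_conv_Lp.
Qed.

End Lp.

(** Convolutions of the truncations converge pointwise, and Fatou's lemma
    passes to the limit in square_function_bddint. *)
Lemma square_function_Lp (phi : R -> R) (C p : R) : 1 < p -> profile phi C ->
  exists2 K : R, 0 <= K & forall (b : R) (s : nat -> R) (N : nat) (u : R -> R),
  (forall i, 0 < s i) -> (forall i, 2 * s i <= s i.+1) ->
  orthogonal_scales phi s b -> measurable_fun setT u ->
  (\int[mu]_y (`|u y| `^ p)%:E < +oo)%E ->
  (\int[mu]_x ((\sum_(i < N) conv (dilate phi (s i) b) u x ^+ 2) `^ (p / 2))%:E <=
   (K * ln (10 + `|b|) `^ p)%:E * \int[mu]_x (`|u x| `^ p)%:E)%E.
Proof.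
move=> p1 phiC; have [K K0 HK] := square_function_bddint p1 phiC.
exists K => // b s N u s0 s2 orth mu' uoo; have [bp _ _ _] := phiC.
have p20 : 0 < p / 2 by rewrite divr_gt0// (lt_trans _ p1).
have p0 : 0 <= p by rewrite ltW// (lt_trans _ p1).
have bpsi i : bddint (dilate phi (s i) b) := bddint_dilate b (s0 i) bp.
pose S n x := \sum_(i < N) conv (dilate phi (s i) b) (truncate u n) x ^+ 2.
pose S' x := \sum_(i < N) conv (dilate phi (s i) b) u x ^+ 2.
have S0 n x : 0 <= S n x by apply: sumr_ge0 => i _; exact: sqr_ge0.
have cS x : S n x @[n --> \oo] --> S' x.
  apply: (cvg_sum_ord (f := fun i n => conv (dilate phi (s i) b) (truncate u n) x ^+ 2)
    (l := fun i => conv (dilate phi (s i) b) u x ^+ 2)) => i.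
  have ci := conv_truncate_cvg (x := x) (ltW p1) (bpsi i) mu' uoo.
  exact: (cvgM ci ci).
have mS n : measurable_fun setT (fun x => (S n x `^ (p / 2))%:E).
  apply/measurable_EFinP.
  pose v i := conv (dilate phi (s i) b) (truncate u n).
  have mv i : measurable_fun setT (v i).
    exact: (bddint_measurable (bddint_conv (bpsi i) (bddint_truncate n mu'))).
  exact: (measurable_square_sum N (p / 2) mv).
have cSp x : (S n x `^ (p / 2))%:E @[n --> \oo] --> (S' x `^ (p / 2))%:E.
  by apply: cvg_EFin; [exact: nearW|exact: cvg_powR].
have mup : measurable_fun setT (fun y => (`|u y| `^ p)%:E).
  apply/measurable_EFinP; apply: (measurableT_comp (measurable_powR p)).
  exact: measurableT_comp.
have bound n : (\int[mu]_x (S n x `^ (p / 2))%:E <=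
    (K * ln (10 + `|b|) `^ p)%:E * \int[mu]_x (`|u x| `^ p)%:E)%E.
  apply: (le_trans (HK b s N _ s0 s2 orth (bddint_truncate n mu'))).
  apply: lee_wpmul2l.
    by rewrite lee_fin; apply: mulr_ge0 => //; exact: powR_ge0.
  apply: ge0_le_integral => //.
  - apply/measurable_EFinP; apply: (measurableT_comp (measurable_powR p)).
    by apply: measurableT_comp => //; exact: measurable_truncate.
  - move=> x _; rewrite lee_fin; apply: ge0_ler_powR => //; rewrite ?nnegrE//.
    exact: truncate_le.
have F := fatou mu measurableT mS (fun n x _ => _).
apply: (le_trans _ (limn_einf_le bound)).
apply: le_trans (F _); last by move=> n x; rewrite lee_fin powR_ge0.
rewrite le_eqVlt; apply/orP; left; apply/eqP.
apply: eq_integral => x _; rewrite is_cvg_limn_einfE; last by apply/cvg_ex; eexists; exact: cSp.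
by apply/esym/cvg_lim => //; exact: cSp.
Qed.

End truncation.

(** * Injectivity of the Fourier transform *)

Section fourier_injectivity.
Variable R : realType.
Local Notation mu := (@lebesgue_measure R).
Implicit Types (h k l : R -> R).

Lemma oneDsqr_gt0 (x : R) : 0 < oneDsqr x.
Proof. by []. Qed.

Lemma bddint_oneDsqrV : bddint (fun x : R => (oneDsqr x)^-1).
Proof.
have c : continuous (fun x : R => (oneDsqr x)^-1) by exact: continuous_oneDsqrV.
have m : measurable_fun setT (fun x : R => (oneDsqr x)^-1).
  exact: continuous_measurable_fun.
have p0 (x : R) : 0 <= (oneDsqr x)^-1 by rewrite invr_ge0 ltW// oneDsqr_gt0.
split => //.
  by exists 1 => x; rewrite ger0_norm//; exact: oneDsqrV_le1.
apply/integrableP; split; first exact/measurable_EFinP.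
under eq_integral do rewrite /= ger0_norm//.
rewrite ge0_symfun_integralT//; last by move=> x; rewrite /= /oneDsqr sqrrN.
by rewrite -set_itvcy integral0y_oneDsqr -EFinM ltry.
Qed.

Lemma Rint_oneDsqrV_gt0 : 0 < \int[mu]_x (oneDsqr x)^-1.
Proof.
have [m [M bM] I] := bddint_oneDsqrV.
have p0 (x : R) : 0 <= (oneDsqr x)^-1 by rewrite invr_ge0 ltW// oneDsqr_gt0.
rewrite -lte_fin EFin_Rintegral// ge0_symfun_integralT//.
- by rewrite -set_itvcy integral0y_oneDsqr -EFinM lte_fin mulr_gt0// divr_gt0// pi_gt0.
- exact: continuous_oneDsqrV.
- by move=> x; rewrite /= /oneDsqr sqrrN.
Qed.

(** The Laplace transform of the cosine; the summand 1 makes the integrand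
    nonnegative, so that the improper form of the fundamental theorem of
    calculus applies. *)
Lemma laplace_one_add_cos (v : R) :
  (\int[mu]_(z in `[0%R, +oo[) (expR (- z) * (1 + cos (z * v)))%:E =
   (1 + (oneDsqr v)^-1)%:E)%E.
Proof.
have v0 : oneDsqr v != 0 by rewrite gt_eqF// oneDsqr_gt0.
pose F (z : R) : R := - expR (- z) +
  expR (- z) * (v * sin (z * v) - cos (z * v)) / oneDsqr v.
pose f (z : R) : R := expR (- z) * (1 + cos (z * v)).
have dF (z : R) : is_derive z 1 F (f z).
  rewrite /F; apply: is_derive_eq.
  by rewrite /f /GRing.scale/=; move: v0; rewrite /oneDsqr => v0; field.
have cF : continuous F.
  move=> z; apply: differentiable_continuous; apply/derivable1_diffP.
  exact: (@ex_derive _ _ _ _ _ _ _ (dF z)).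
have cf : continuous f.
  move=> z; apply: differentiable_continuous; apply/derivable1_diffP.
  by rewrite /f; apply: ex_derive.
have F0 : F 0 = - (1 + (oneDsqr v)^-1).
  by rewrite /F oppr0 expR0 mul0r sin0 cos0 mulr0 sub0r mul1r; field.
rewrite (@ge0_continuous_FTC2y _ f F 0 0).
- by rewrite F0 sub0e EFinN oppeK.
- by move=> z _; rewrite /f mulr_ge0 ?expR_ge0//; have := cos_geN1 (z * v); lra.
- exact: continuous_subspaceT.
- pose c := 1 + (`|v| + 1) / oneDsqr v.
  have cE : (fun z => c * expR (- z)) @ +oo --> 0.
    by rewrite -[X in _ --> X](mulr0 c); apply: cvgMr; exact: cvgr_expR.
  apply/norm_cvg0P.
  apply: (squeeze_cvgr (f := fun=> 0) (h := fun z => c * expR (- z)) _ _ cE).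
    apply: nearW => z; rewrite normr_ge0/= /F.
    rewrite -mulrA -mulN1r mulrC -mulrDr normrM (ger0_norm (expR_ge0 _)) mulrC.
    rewrite ler_wpM2r ?expR_ge0// (le_trans (ler_normD _ _))// normrN1 lerD2l.
    rewrite normrM (ger0_norm (x := _^-1)) ?invr_ge0 ?(ltW (oneDsqr_gt0 _))//.
    rewrite ler_wpM2r ?invr_ge0 ?(ltW (oneDsqr_gt0 _))//.
    rewrite (le_trans (ler_normB _ _))// lerD ?normrM//.
      by rewrite ler_piMr// ler_norml sin_geN1 sin_le1.
    by rewrite ler_norml cos_geN1 cos_le1.
  exact: cvg_cst.
- by move=> z _; exact: (@ex_derive _ _ _ _ _ _ _ (dF z)).
- by apply: cvg_at_right_filter; exact: cF.
- by move=> z _; rewrite derive1E; exact: (@derive_val _ _ _ _ _ _ _ (dF z)).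
Qed.

Definition half_exp (z : R) : R := if 0 <= z then expR (- z) else 0.

Lemma half_exp_ge0 z : 0 <= half_exp z.
Proof. by rewrite /half_exp; case: ifP => // _; exact: expR_ge0. Qed.

Lemma bddint_half_exp : bddint half_exp.
Proof.
have m : measurable_fun setT half_exp.
  by apply: measurable_if_le => //; exact: measurableT_comp.
split => //.
  exists 1 => z; rewrite (ger0_norm (half_exp_ge0 _)) /half_exp.
  by case: ifP => // z0; rewrite -expR0 ler_expR oppr_le0.
apply/integrableP; split; first exact/measurable_EFinP.
under eq_integral do rewrite /= (ger0_norm (half_exp_ge0 _)).
apply: le_lt_trans (ltry (expR (- (1 * 0)) / 1)).
rewrite -(integral_exp_tail 0 ltr01) le_eqVlt; apply/orP; left; apply/eqP.
by apply: eq_integral => z _; rewrite mul1r.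
Qed.

Lemma Rint_half_exp_cos (v : R) :
  \int[mu]_z (half_exp z * (1 + cos (z * v))) = 1 + (oneDsqr v)^-1.
Proof.
rewrite /Rintegral -[RHS]/(fine (1 + (oneDsqr v)^-1)%:E) -laplace_one_add_cos.
congr fine; rewrite [RHS]integral_mkcond; apply: eq_integral => z _.
rewrite patchE /half_exp; case: ifPn => z0.
  by rewrite mem_set//= in_itv/= z0.
by rewrite mul0r memNset//= in_itv/= andbT; exact/negP.
Qed.

(** The frequency is in radians: it is 2 pi times the argument of the
    transform fourier. *)
Definition fourier_vanishes h (xi : R) :=
  \int[mu]_x (h x * cos (xi * x)) = 0 /\ \int[mu]_x (h x * sin (xi * x)) = 0.

Lemma measurable_cos_affine (xi b : R) : measurable_fun setT (fun x : R => cos (xi * x + b)).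
Proof.
apply: (measurableT_comp (f := @cos R)); last exact: measurable_affine.
by apply: continuous_measurable_fun; exact: continuous_cos.
Qed.

Lemma measurable_sin_affine (xi b : R) : measurable_fun setT (fun x : R => sin (xi * x + b)).
Proof.
apply: (measurableT_comp (f := @sin R)); last exact: measurable_affine.
by apply: continuous_measurable_fun; exact: continuous_sin.
Qed.

Lemma norm_cos_le1 (x : R) : `|cos x| <= 1.
Proof. by rewrite ler_norml cos_geN1 cos_le1. Qed.

Lemma norm_sin_le1 (x : R) : `|sin x| <= 1.
Proof. by rewrite ler_norml sin_geN1 sin_le1. Qed.

Lemma bddint_cos h xi b : bddint h -> bddint (fun x => h x * cos (xi * x + b)).
Proof.
move=> bh; apply: bddintM => //; first exact: measurable_cos_affine.
by exists 1 => x; exact: norm_cos_le1.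
Qed.

Lemma bddint_sin h xi b : bddint h -> bddint (fun x => h x * sin (xi * x + b)).
Proof.
move=> bh; apply: bddintM => //; first exact: measurable_sin_affine.
by exists 1 => x; exact: norm_sin_le1.
Qed.

Lemma bddint_cos0 h xi : bddint h -> bddint (fun x => h x * cos (xi * x)).
Proof.
by move=> /(bddint_cos xi 0); congr bddint; apply/funext => x; rewrite addr0.
Qed.

Lemma bddint_sin0 h xi : bddint h -> bddint (fun x => h x * sin (xi * x)).
Proof.
by move=> /(bddint_sin xi 0); congr bddint; apply/funext => x; rewrite addr0.
Qed.

Lemma Rint_cos_shift h xi b : bddint h ->
  \int[mu]_x (h x * cos (xi * x + b)) =
  cos b * \int[mu]_x (h x * cos (xi * x)) - sin b * \int[mu]_x (h x * sin (xi * x)).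
Proof.
move=> bh; have bc := bddint_cos0 xi bh; have bs := bddint_sin0 xi bh.
rewrite -!RintZ// -RintB; [|exact: bddintZ..].
by apply: eq_Rintegral => x _; rewrite cosD; ring.
Qed.

(** The kernel is an average of 1 + cos (z (t (x - y))) over z with weight
    expR (- z), up to the constant 1; by Fubini's theorem its integral against
    h is an average of transforms of h. *)
Lemma Rint_cauchy_kernel h (t y : R) : bddint h ->
  (forall xi, fourier_vanishes h xi) ->
  \int[mu]_x (h x * (oneDsqr (t * (x - y)))^-1) = 0.
Proof.
move=> bh hv.
have h0 : \int[mu]_x h x = 0.
  have [<- _] := hv 0; apply: eq_Rintegral => x _.
  by rewrite mul0r cos0 mulr1.
pose G (w : R * R) := h w.1 * (half_exp w.2 * (1 + cos (w.2 * (t * (w.1 - y))))).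
have bE := bddint_half_exp.
have c2 (a : R) : `|1 + cos a| <= 2.
  by rewrite (le_trans (ler_normD _ _))// normr1; have := norm_cos_le1 a; lra.
have maff : measurable_fun setT (fun w : R * R => w.2 * (t * (w.1 - y))).
  apply: measurable_funM; first exact: measurable_snd.
  apply: measurable_funM => //; apply: measurable_funB => //.
have mG : measurable_fun setT G.
  apply: measurable_funM; first by apply: measurable_fst_comp; exact: bddint_measurable.
  apply: measurable_funM; first by apply: measurable_snd_comp; exact: bddint_measurable.
  apply: measurable_funD => //; apply: (measurableT_comp (f := @cos R)) => //.
  by apply: continuous_measurable_fun; exact: continuous_cos.
have IG : (mu \x mu)%E.-integrable setT (EFin \o G).
  apply: (@integrable_prod_dom _ G h half_exp 2) => //; try exact: bddint_integrable.
  move=> x z; rewrite /G/= !normrM mulrA mulrC.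
  by apply: ler_wpM2r; [exact: mulr_ge0|exact: c2].
have b1 x : bddint (fun z => half_exp z * (1 + cos (z * (t * (x - y))))).
  have := bddintD bE (bddint_cos0 (t * (x - y)) bE); congr bddint.
  by apply/funext => z; rewrite [z * _]mulrC; ring.
have b2 z : bddint (fun x => h x * (1 + cos (z * (t * (x - y))))).
  have := bddintD bh (bddint_cos (z * t) (- (z * t * y)) bh); congr bddint.
  apply/funext => x; rewrite [X in cos X](_ : _ = z * (t * (x - y))); last by ring.
  by move: (cos _) => v; ring.
have E := Rfubini IG (fun x => bddint_integrable (bddintZ (h x) (b1 x))).
have {}E : \int[mu]_x \int[mu]_z G (x, z) = \int[mu]_z \int[mu]_x G (x, z).
  apply: E => z; apply: bddint_integrable.
  have := bddintZ (half_exp z) (b2 z); congr bddint.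
  by apply/funext => x; rewrite /G/=; ring.
have b3 : bddint (fun x => h x * (oneDsqr (t * (x - y)))^-1).
  clear - bh; apply: bddintM; first exact: bh.
    apply: (measurableT_comp (f := fun v : R => (oneDsqr v)^-1)).
      exact: bddint_measurable bddint_oneDsqrV.
    by apply: measurable_funM => //; exact: measurable_funB.
  have [_ [M bM] _] := bddint_oneDsqrV.
  by exists M => x; exact: bM.
have L : \int[mu]_x \int[mu]_z G (x, z) =
    \int[mu]_x (h x + h x * (oneDsqr (t * (x - y)))^-1).
  apply: eq_Rintegral => x _; rewrite /G/= RintZ; last exact: b1.
  by rewrite Rint_half_exp_cos mulrDr mulr1.
have RH : \int[mu]_z \int[mu]_x G (x, z) = 0.
  rewrite (@eq_Rintegral _ _ _ mu setT (fun=> 0)).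
    by rewrite /Rintegral integral0.
  move=> z _; rewrite (@eq_Rintegral _ _ _ mu setT
    (fun x => half_exp z * (h x + h x * cos (z * t * x + - (z * t * y))))).
    rewrite RintZ; last by apply: bddintD; [exact: bh|exact: bddint_cos].
    rewrite RintD; [|exact: bh|exact: bddint_cos].
    rewrite h0 Rint_cos_shift; last exact: bh.
    have [-> ->] := hv (z * t).
    by rewrite !mulr0 subr0 addr0 mulr0.
  move=> x _; rewrite /G/= -[h x + _](_ : h x * (1 + cos (z * t * x + - (z * t * y))) = _).
    by rewrite mulrCA; congr (_ * (_ * (_ + cos _))); ring.
  by rewrite mulrDr mulr1.
by move: E; rewrite L RH RintD// h0 add0r.
Qed.

(** The kernels of Rint_cauchy_kernel, with t = n + 1, concentrate at y.
    Rescaled, their vanishing integrals against h tend to h y times the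
    integral of (oneDsqr x)^-1, by dominated convergence. *)
Lemma fourier_injective h : bddint h -> continuous h ->
  (forall xi, fourier_vanishes h xi) -> forall y, h y = 0.
Proof.
move=> bh ch hv y.
have bQ := bddint_oneDsqrV; have [mQ _ IQ] := bQ.
have Q0 (x : R) : 0 <= (oneDsqr x)^-1 by rewrite invr_ge0 ltW// oneDsqr_gt0.
have [M M0 hM] := bddint_bounded bh.
(* substitution w = (n + 1) (x - y) in the integral of Rint_cauchy_kernel *)
pose f (n : nat) (w : R) := h (w / n.+1%:R + y) * (oneDsqr w)^-1.
have bhn n : bddint (fun w => h (w / n.+1%:R + y)).
  have := bddint_affine (s := n.+1%:R^-1) y _ bh; rewrite invr_gt0 ltr0n => /(_ isT).
  by congr bddint; apply/funext => w; rewrite mulrC.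
have bf n : bddint (f n) by exact: bddintMb.
have If n : \int[mu]_w f n w = 0.
  have n0 : 0 < n.+1%:R :> R by rewrite ltr0n.
  have := Rintegral_affine (- (n.+1%:R * y)) n0 (bddint_integrable (bf n)).
  rewrite (@eq_Rintegral _ _ _ mu setT
    (fun x => h x * (oneDsqr (n.+1%:R * (x - y)))^-1)).
    rewrite Rint_cauchy_kernel// => /esym/eqP.
    by rewrite mulf_eq0 invr_eq0 gt_eqF//= => /eqP.
  move=> x _; rewrite /f.
  have -> : n.+1%:R * x - n.+1%:R * y = n.+1%:R * (x - y) by rewrite mulrBr.
  by rewrite mulrAC divff ?gt_eqF// mul1r subrK.
have mf n : measurable_fun setT (EFin \o f n).
  by apply/measurable_EFinP; exact: bddint_measurable.
have mg : measurable_fun setT (fun w => (h y * (oneDsqr w)^-1)%:E).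
  by apply/measurable_EFinP; exact: measurable_funM.
have cfg : {ae mu, forall w, setT w -> (EFin \o f n) w @[n --> \oo] -->
    (h y * (oneDsqr w)^-1)%:E}.
  apply: aeW => w _; apply: cvg_EFin; first exact: nearW.
  apply: cvgMl; apply: (cvg_comp (fun n => w / n.+1%:R + y) h); last exact: ch.
  suff H : w / n.+1%:R + y @[n --> \oo] --> w * 0 + y.
    by move: H; rewrite mulr0 add0r.
  by apply: cvgD; [apply: cvgMr; exact: cvg_harmonic|exact: cvg_cst].
have Ig : mu.-integrable setT (EFin \o (fun w => M * (oneDsqr w)^-1)).
  by apply: bddint_integrable; exact: bddintZ.
have dfg : {ae mu, forall w n, setT w -> (`|(EFin \o f n) w| <=
    (EFin \o (fun w => (M * (oneDsqr w)^-1)%R)) w)%E}.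
  apply: aeW => w n _; rewrite lee_fin /f normrM (ger0_norm (Q0 _)).
  exact: ler_wpM2r.
have [_ _ H] := @dominated_convergence _ _ R mu setT measurableT _ _ _ mf mg cfg Ig dfg.
have E : (\int[mu]_w (h y * (oneDsqr w)^-1)%:E = 0)%E.
  apply: (cvg_unique _ H); first exact: ereal_hausdorff.
  apply: cvg_near_cst; apply: nearW => n.
  by have := EFin_Rintegral (bddint_integrable (bf n)); rewrite If => /esym.
have : h y * \int[mu]_w (oneDsqr w)^-1 = 0.
  by rewrite -RintZ// /Rintegral E.
move/eqP; rewrite mulf_eq0 => /orP[/eqP//|].
by rewrite gt_eqF// Rint_oneDsqrV_gt0.
Qed.

End fourier_injectivity.

(** * Orthogonality of distant scales *)

Section orthogonality.
Context {R : realType}.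
Local Notation mu := (@lebesgue_measure R).
Implicit Types (h k l phi : R -> R).

(** All phases at once: this form is stable under translation. *)
Lemma fourier_vanishesP h xi : bddint h ->
  fourier_vanishes h xi <-> forall b, \int[mu]_x (h x * cos (xi * x + b)) = 0.
Proof.
move=> bh; split=> [[c0 s0] b|H].
  by rewrite Rint_cos_shift// c0 s0 !mulr0 subr0.
split.
  by rewrite -[RHS](H 0); apply: eq_Rintegral => x _; rewrite addr0.
(* the sine is the cosine with phase - pi / 2 *)
by rewrite -[RHS](H (- (pi / 2))); apply: eq_Rintegral => x _; rewrite cosBpihalf.
Qed.

(** The transform of a convolution is the product of the transforms; only the
    vanishing is tracked, through the phase-shifted integrals. *)
Lemma fourier_vanishes_conv k l xi : bddint k -> bddint l ->
  fourier_vanishes k xi \/ fourier_vanishes l xi -> fourier_vanishes (conv k l) xi.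
Proof.
move=> bk bl kl; apply/(fourier_vanishesP _ (bddint_conv bk bl)) => b.
have c1 (x : R) : `|cos (xi * x + b)| <= 1 by exact: norm_cos_le1.
rewrite (Rint_weight_conv bk bl (measurable_cos_affine xi b)); last by exists 1.
have E y : \int[mu]_x (k (x - y) * cos (xi * x + b)) =
    \int[mu]_x (k x * cos (xi * x + (xi * y + b))).
  rewrite -(Rintegral_shift (- y)
    (bddint_measurable (bddint_cos xi (xi * y + b) bk))).
  apply: eq_Rintegral => x _; congr (_ * cos _); ring.
case: kl => [/(fourier_vanishesP _ bk) k0|/(fourier_vanishesP _ bl) l0].
  rewrite (@eq_Rintegral _ _ _ mu setT (fun=> 0)).
    by rewrite /Rintegral integral0.
  by move=> y _; rewrite E k0 mul0r.
set A := \int[mu]_x (k x * cos (xi * x)); set B := \int[mu]_x (k x * sin (xi * x)).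
rewrite (@eq_Rintegral _ _ _ mu setT (fun y => A * (l y * cos (xi * y + b)) +
    B * (l y * cos (xi * y + (b + pi / 2))))).
  have b1 (t : R) := bddint_cos xi t bl.
  rewrite RintD; [|exact: bddintZ|exact: bddintZ].
  by rewrite !RintZ; [rewrite !l0 !mulr0 addr0|exact: b1|exact: b1].
move=> y _; rewrite E Rint_cos_shift// -/A -/B addrA cosDpihalf; ring.
Qed.

Lemma lipschitz_continuous k (M : R) :
  (forall x y, `|k x - k y| <= M * `|x - y|) -> continuous k.
Proof.
move=> kM x.
have M0 : 0 <= M by have := le_trans (normr_ge0 _) (kM 1 0); rewrite subr0 normr1 mulr1.
have M1 : 0 < M + 1 by lra.
apply/cvgrPdist_lt => e e0; have ed : 0 < e / (M + 1) by exact: divr_gt0.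
near=> y; apply: (le_lt_trans (kM x y)).
apply: (@le_lt_trans _ _ ((M + 1) * `|x - y|)).
  by rewrite ler_wpM2r//; lra.
rewrite mulrC -ltr_pdivlMr; last by rewrite ltr_wpDl.
near: y; exact: cvgr_dist_lt ed.
Unshelve. all: by end_near. Qed.

Lemma conv_lipschitz k l (M : R) : bddint k -> bddint l ->
  (forall x y, `|k x - k y| <= M * `|x - y|) ->
  forall x y, `|conv k l x - conv k l y| <= (M * \int[mu]_z `|l z|) * `|x - y|.
Proof.
move=> bk bl kM x y.
have b1 z := bddint_conv_integrand z bk bl.
have bn := bddint_norm bl.
rewrite /conv -RintB//; apply: (le_trans (le_norm_Rint (bddintB (b1 x) (b1 y)))).
rewrite mulrAC -RintZ//; apply: le_Rint.
- by apply: bddint_norm; exact: bddintB.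
- exact: bddintZ.
- move=> z; rewrite -mulrBl normrM; apply: ler_wpM2r => //.
  by apply: (le_trans (kM _ _)); rewrite opprB addrA subrK.
Qed.

(** Disjoint frequency supports make the transform of conv k l vanish
    identically; the Lipschitz bound makes conv k l continuous, so that it is
    0 everywhere and not only almost everywhere. *)
Lemma conv_eq0 k l (M : R) : bddint k -> bddint l ->
  (forall x y, `|k x - k y| <= M * `|x - y|) ->
  (forall xi, fourier_vanishes k xi \/ fourier_vanishes l xi) ->
  forall t, conv k l t = 0.
Proof.
move=> bk bl kM kl; apply: fourier_injective; first exact: bddint_conv.
  exact: lipschitz_continuous (conv_lipschitz bk bl kM).
by move=> xi; exact: fourier_vanishes_conv.
Qed.

Lemma fourier_vanishes_dilate phi s b xi : 0 < s -> bddint phi ->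
  fourier_vanishes phi (xi / s) -> fourier_vanishes (dilate phi s b) xi.
Proof.
move=> s0 bp /(fourier_vanishesP _ bp) H.
apply/fourier_vanishesP; first exact: bddint_dilate.
move=> t; pose g (v : R) := s * (phi v * cos (xi / s * v + (xi / s * b + t))).
have bg : bddint g by apply: bddintZ; exact: bddint_cos.
have := Rintegral_affine (- b) s0 (bddint_integrable bg).
have -> : \int[mu]_x g x = 0 by rewrite RintZ ?H ?mulr0//; exact: bddint_cos.
rewrite mulr0 => <-; apply: eq_Rintegral => x _.
rewrite /g/dilate mulrA; congr (_ * cos _); field; exact: lt0r_neq0.
Qed.

Lemma fourier_vanishes_opp phi xi : bddint phi ->
  fourier_vanishes phi xi -> fourier_vanishes (fun x => phi (- x)) xi.
Proof.
move=> bp [c0 s0].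
have E1 := Rintegral_opp (bddint_measurable (bddint_cos0 xi bp)).
have E2 := Rintegral_opp (bddint_measurable (bddint_sin0 xi bp)).
split.
  by rewrite -c0 -E1; apply: eq_Rintegral => x _; rewrite mulrN cosN.
rewrite -[RHS]oppr0 -s0 -E2 -mulN1r -RintZ; last first.
  exact: (bddint_opp (bddint_sin0 xi bp)).
by apply: eq_Rintegral => x _; rewrite mulrN sinN; ring.
Qed.

(** The scale s i lives at frequencies between r s i and 4 r s i. Three
    doublings give s j >= 8 s i, so the annuli of indices more than 2 apart
    are disjoint. *)
Lemma orthogonal_scales_of_annulus phi (M r : R) (s : nat -> R) b :
  bddint phi -> (forall x y, `|phi x - phi y| <= M * `|x - y|) -> 0 < r ->
  (forall xi, `|xi| < r \/ 4 * r < `|xi| -> fourier_vanishes phi xi) ->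
  (forall i, 0 < s i) -> (forall i, 2 * s i <= s i.+1) ->
  orthogonal_scales phi s b.
Proof.
move=> bp pM r0 pv s0 s2 i j ij.
have M0 : 0 <= M by have := le_trans (normr_ge0 _) (pM 1 0); rewrite subr0 normr1 mulr1.
have far (a c : nat) : (a + 2 < c)%N -> 8 * s a <= s c.
  move=> ac; have -> : c = (a + 3 + (c - (a + 3)))%N by rewrite subnKC// addnS.
  elim: (c - _)%N => [|n IH].
    rewrite addn0 addn3; have := s2 a; have := s2 a.+1; have := s2 a.+2; lra.
  rewrite addnS; have := s2 (a + 3 + n)%N; have := s0 a; lra.
apply: (@conv_eq0 _ _ (s i * M * s i)).
- exact: bddint_opp (bddint_dilate _ (s0 i) bp).
- exact: bddint_dilate.
- move=> x y; rewrite /dilate -mulrBr normrM gtr0_norm// -!mulrA.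
  apply: ler_wpM2l; first exact: ltW.
  apply: (le_trans (pM _ _)); apply: ler_wpM2l => //.
  rewrite (_ : _ - _ = s i * (y - x)); last by ring.
  by rewrite normrM gtr0_norm// distrC.
move=> xi.
have va a : `|xi| < r * s a \/ 4 * r * s a < `|xi| ->
    fourier_vanishes (dilate phi (s a) b) xi.
  move=> H; apply: fourier_vanishes_dilate => //; apply: pv.
  rewrite normrM normfV (gtr0_norm (s0 a)).
  by rewrite ltr_pdivrMr// ltr_pdivlMr.
have [H|H] := pselect (`|xi| < r * s i \/ 4 * r * s i < `|xi|).
  left; apply: fourier_vanishes_opp; first exact: bddint_dilate.
  exact: va.
right; apply: va.
have {H} [H1 H2] : r * s i <= `|xi| /\ `|xi| <= 4 * r * s i.
  by split; rewrite leNgt; apply/negP => ?; apply: H; [left|right].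
case/orP: ij => /far ij; have := s0 i; have := s0 j => sj si; [left|right].
  by apply: (le_lt_trans H2); nra.
by apply: (lt_le_trans _ H1); nra.
Qed.

End orthogonality.

(** * Decay of Schwartz functions *)

Section schwartz_profiles.
Context {R : realType}.
Local Notation mu := (@lebesgue_measure R).
Implicit Types (u : R -> R).

Lemma mean_value u : (forall x, derivable u x 1) -> forall a b,
  exists2 c, `|c - a| <= `|b - a| & u b - u a = (u^`())%classic c * (b - a).
Proof.
move=> du a b.
have cu : continuous u by move=> x; apply/differentiable_continuous/derivable1_diffP.
have id x y (z : R) : z \in `]x, y[%R -> is_derive z 1 u ((u^`())%classic z).
  by move=> _; rewrite derive1E; exact/derivableP.
have [ab|ba] := leP a b.
  have [c cab E] := MVT_segment ab (id a b) (continuous_subspaceT cu).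
  exists c => //; move: cab; rewrite in_itv/= => /andP[ac cb].
  by rewrite !ger0_norm; lra.
have [c cab E] := MVT_segment (ltW ba) (id b a) (continuous_subspaceT cu).
exists c; last by rewrite -opprB E -mulrN opprB.
move: cab; rewrite in_itv/= => /andP[ac cb].
by rewrite !ler0_norm; lra.
Qed.

(** Decay at a point controls decay at unit distance from it. *)
Lemma oneDsqrV_near (x c : R) : `|c - x| <= 1 ->
  (oneDsqr c)^-1 <= 3 * (oneDsqr x)^-1.
Proof.
rewrite ler_norml => /andP[c1 c2].
have x0 := oneDsqr_gt0 x; have c0 := oneDsqr_gt0 c.
rewrite -[X in X <= _]mul1r ler_pdivrMr// mulrAC ler_pdivlMr// mul1r /oneDsqr.
have := sqr_ge0 (2 * c - x).
(* 3 (1 + c^2) - (1 + x^2) >= 0 follows from (2 c - x)^2 >= 0 and |c - x| <= 1 *)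
rewrite (_ : x = c - (c - x)); last by ring.
have : (c - x) ^+ 2 <= 1 by rewrite expr2; nra.
move: (c - x) => t t1; rewrite !expr2 in t1 *; nra.
Qed.

(** For |t| <= 1 the modulus of continuity comes from the mean value theorem
    and the decay of the derivative, which oneDsqrV_near transfers from the
    intermediate point to x. For |t| > 1 twice the L^1 norm is enough. The
    tail bound uses 1 <= |x| / r. *)
Lemma profile_of_decay u (A : R) : 0 <= A -> (forall x, derivable u x 1) ->
  (forall x, `|u x| <= A * (oneDsqr x)^-1) ->
  (forall x, `|(u^`())%classic x| <= A * (oneDsqr x)^-1) ->
  (forall x, `|x| * `|u x| <= A * (oneDsqr x)^-1) ->
  exists2 C, profile u C & forall x y, `|u x - u y| <= A * `|x - y|.
Proof.
move=> A0 du u0 u1 xu.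
have Q1 (x : R) : 0 <= (oneDsqr x)^-1 <= 1.
  by rewrite oneDsqrV_le1 invr_ge0 ltW// oneDsqr_gt0.
have lip x y : `|u x - u y| <= A * `|x - y|.
  have [c _ ->] := mean_value du y x; rewrite normrM ler_wpM2r//.
  have /andP[q0 q1] := Q1 c.
  by rewrite (le_trans (u1 c))// -[leRHS]mulr1 ler_wpM2l.
have bQ := @bddint_oneDsqrV R; have Q0 := @Rint_oneDsqrV_gt0 R.
have bAQ := bddintZ A bQ.
have mu' : measurable_fun setT u.
  by apply: continuous_measurable_fun; exact: lipschitz_continuous lip.
have bu : bddint u.
  apply: (bddint_dom (c := 1) bAQ) => // x; rewrite mul1r (ger0_norm (x := _ * _))//.
  by have /andP[q0 _] := Q1 x; exact: mulr_ge0.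
have bn := bddint_norm bu.
set I := \int[mu]_x (oneDsqr x)^-1 in Q0.
have L1 : \int[mu]_x `|u x| <= A * I by rewrite -RintZ//; exact: le_Rint.
have AI : 0 <= A * I by rewrite mulr_ge0// ltW.
exists (3 * (A * I)) => //; split.
- exact: bu.
- by apply: (le_trans L1); lra.
- move=> t; have bs : bddint (fun x => u (x - t)) by exact: bddint_shift.
  have bd := bddint_norm (bddintB bs bu).
  have [t1|t1] := leP `|t| 1.
    rewrite mulrC !mulrA -RintZ//; apply: le_Rint => //; first exact: bddintZ.
    move=> x; have [c cx ->] := mean_value du x (x - t).
    rewrite (_ : x - t - x = - t) in cx *; last by ring.
    rewrite normrN in cx; rewrite normrM normrN.
    rewrite [leRHS](_ : _ = A * (3 * (oneDsqr x)^-1) * `|t|); last by ring.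
    apply: ler_wpM2r => //; apply: (le_trans (u1 c)); apply: ler_wpM2l => //.
    exact: oneDsqrV_near (le_trans cx t1).
  apply: (@le_trans _ _ (\int[mu]_x (`|u (x - t)| + `|u x|))).
    apply: le_Rint => //; first by apply: bddintD => //; exact: bddint_norm.
    by move=> x; exact: ler_normB.
  rewrite RintD//; last exact: bddint_norm.
  rewrite (Rintegral_shift (- t) (bddint_measurable bn)).
  by move: L1; nra.
move=> r r0.
have bD : bddint (fun x => A / r * (oneDsqr x)^-1) by exact: bddintZ.
have mD := measurable_norm_ge r.
apply: (@le_trans _ _ (\int[mu]_(x in [set x | (r <= `|x|)%R]) (A / r * (oneDsqr x)^-1)%:E)%E).
  apply: ge0_le_integral => //.
  - by apply/measurable_EFinP; apply: measurable_funTS; exact: bddint_measurable bn.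
  - by apply/measurable_EFinP; apply: measurable_funTS; exact: bddint_measurable bD.
  move=> x /= rx; rewrite lee_fin mulrAC ler_pdivlMr// mulrC.
  by apply: le_trans (xu x); rewrite ler_wpM2r.
apply: (@le_trans _ _ (\int[mu]_x (A / r * (oneDsqr x)^-1)%:E)%E).
  apply: ge0_subset_integral => //.
  - by apply/measurable_EFinP; exact: bddint_measurable bD.
  - move=> x _; rewrite lee_fin; have /andP[q0 _] := Q1 x.
    by rewrite mulr_ge0// divr_ge0// ltW.
rewrite -(EFin_Rintegral (bddint_integrable bD)) RintZ// lee_fin.
rewrite mulrAC; apply: ler_wpM2r; first by rewrite invr_ge0 ltW.
by move: AI; rewrite /I; move: (_ * _) => z z0; lra.
Qed.

Lemma schwartzR_decay u (n : nat) : schwartzR u ->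
  exists2 A, 0 <= A & forall x, `|(u^`(n))%classic x| <= A * (oneDsqr x)^-1 /\
    `|x| * `|(u^`(n))%classic x| <= A * (oneDsqr x)^-1.
Proof.
move=> [_ H].
have [M0 h0] := H 0%N n; have [M1 h1] := H 1%N n.
have [M2 h2] := H 2%N n; have [M3 h3] := H 3%N n.
have A0 : 0 <= M0 by apply: le_trans (h0 0); rewrite expr0 mul1r.
have A1 : 0 <= M1 by apply: le_trans (h1 0); rewrite mulr_ge0.
have A2 : 0 <= M2 by apply: le_trans (h2 0); rewrite mulr_ge0// exprn_ge0.
have A3 : 0 <= M3 by apply: le_trans (h3 0); rewrite mulr_ge0// exprn_ge0.
exists (M0 + M1 + M2 + M3); first lra.
move=> x; have x0 := oneDsqr_gt0 x.
have := h0 x; have := h1 x; have := h2 x; have := h3 x.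
rewrite !ler_pdivlMr// /oneDsqr -(real_normK (num_real x)).
move: (normr_ge0 x) (normr_ge0 ((u^`(n))%classic x)).
move: (`|x|) (`|_|) => t v t0 v0; rewrite !exprS expr0 !mulr1 mul1r => *.
by split; lra.
Qed.

Lemma schwartzR_profile u : schwartzR u ->
  exists C M : R, profile u C /\ forall x y, `|u x - u y| <= M * `|x - y|.
Proof.
move=> su; have [A A0 hA] := schwartzR_decay 0 su.
have [B B0 hB] := schwartzR_decay 1 su.
have Q0 (x : R) : 0 <= (oneDsqr x)^-1 by rewrite invr_ge0 ltW// oneDsqr_gt0.
have AQ x : A * (oneDsqr x)^-1 <= (A + B) * (oneDsqr x)^-1.
  by apply: ler_wpM2r => //; lra.
have BQ x : B * (oneDsqr x)^-1 <= (A + B) * (oneDsqr x)^-1.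
  by apply: ler_wpM2r => //; lra.
have [C pC lC] := @profile_of_decay u (A + B) (addr_ge0 A0 B0) (su.1 0%N)
  (fun x => le_trans (hA x).1 (AQ x)) (fun x => le_trans (hB x).1 (BQ x))
  (fun x => le_trans (hA x).2 (AQ x)).
by exists C, (A + B).
Qed.

End schwartz_profiles.

(** * Complex Fourier transforms and dilations *)

Section dilations.
Context {R : realType}.
Local Notation mu := (@lebesgue_measure R).
Implicit Types (f g Phi : R -> R[i]) (u : R -> R).

Definition cosint u (xi : R) : R := \int[mu]_x (u x * cos (xi * x)).
Definition sinint u (xi : R) : R := \int[mu]_x (u x * sin (xi * x)).

Lemma cosintN u xi : cosint u (- xi) = cosint u xi.
Proof. by apply: eq_Rintegral => x _; rewrite mulNr cosN. Qed.

Lemma sinintN u xi : bddint u -> sinint u (- xi) = - sinint u xi.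
Proof.
move=> bu; rewrite /sinint -[RHS]mulN1r -RintZ; last exact: bddint_sin0.
by apply: eq_Rintegral => x _; rewrite mulNr sinN; ring.
Qed.

Lemma fourierE g xi : bddint (fun x => complex.Re (g x)) ->
  bddint (fun x => complex.Im (g x)) ->
  fourier g xi = Complex
    (cosint (fun x => complex.Re (g x)) (2 * pi * xi) +
     sinint (fun x => complex.Im (g x)) (2 * pi * xi))
    (cosint (fun x => complex.Im (g x)) (2 * pi * xi) -
     sinint (fun x => complex.Re (g x)) (2 * pi * xi)).
Proof.
move=> br bi; rewrite /fourier /cintegral.
have c0 u := @bddint_cos0 R u (2 * pi * xi).
have s0 u := @bddint_sin0 R u (2 * pi * xi).
rewrite /cosint /sinint -RintD; [|exact: c0|exact: s0].
rewrite -RintB; [|exact: c0|exact: s0].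
congr Complex; apply: eq_Rintegral => x _; rewrite /expi mulrAC cosN sinN;
  by case: (g x) => a b /=; ring.
Qed.

(** The values at xi and - xi separate the transforms of the real and the
    imaginary part. *)
Lemma fourier_vanishes_ReIm g xi : bddint (fun x => complex.Re (g x)) ->
  bddint (fun x => complex.Im (g x)) ->
  fourier g xi = 0 -> fourier g (- xi) = 0 ->
  fourier_vanishes (fun x => complex.Re (g x)) (2 * pi * xi) /\
  fourier_vanishes (fun x => complex.Im (g x)) (2 * pi * xi).
Proof.
move=> br bi; rewrite !fourierE// mulrN !cosintN !sinintN//.
case=> e1 e2 [e3 e4]; rewrite /fourier_vanishes -!/(cosint _ _) -!/(sinint _ _).
by split; split; lra.
Qed.

Lemma fourier_vanishes_annulus Phi X : bddint (fun x => complex.Re (Phi x)) ->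
  bddint (fun x => complex.Im (Phi x)) ->
  fourier_supported_in Phi (@annulus R) ->
  `|X| < pi \/ 4 * pi < `|X| ->
  fourier_vanishes (fun x => complex.Re (Phi x)) X /\
  fourier_vanishes (fun x => complex.Im (Phi x)) X.
Proof.
move=> br bi sP HX; have p0 := pi_gt0 R.
have out xi : `|xi| < 1 / 2 \/ 2 < `|xi| -> fourier Phi xi = 0.
  move=> xi_out; apply: contrapT => /eqP xi0.
  have /sP : closure [set xi | fourier Phi xi != 0] xi by exact: subset_closure.
  by rewrite /annulus/= => /andP[]; lra.
have XE : X = 2 * pi * (X / (2 * pi)) by rewrite mulrC divfK// mulf_neq0// gt_eqF.
have Hxi : `|X / (2 * pi)| < 1 / 2 \/ 2 < `|X / (2 * pi)|.
  rewrite normrM normfV (gtr0_norm (x := 2 * pi)); last by lra.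
  rewrite ltr_pdivrMr ?ltr_pdivlMr; [|lra|lra].
  by case: HX => ?; [left|right]; lra.
rewrite XE; apply: fourier_vanishes_ReIm; [exact: br|exact: bi|exact: out|].
by apply: out; rewrite normrN.
Qed.

Lemma cosint_dilate u s xi : 0 < s -> bddint u ->
  cosint (dilate u s 0) xi = cosint u (xi / s).
Proof.
move=> s0 bu; have b1 := bddint_cos0 (xi / s) bu.
have := Rintegral_affine 0 s0 (bddint_integrable (bddintZ s b1)).
rewrite (RintZ s b1) mulKf; last exact: lt0r_neq0.
rewrite /cosint => <-; apply: eq_Rintegral => x _.
rewrite /dilate subr0 addr0 mulrA.
by congr (_ * cos _); field; exact: lt0r_neq0.
Qed.

Lemma sinint_dilate u s xi : 0 < s -> bddint u ->
  sinint (dilate u s 0) xi = sinint u (xi / s).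
Proof.
move=> s0 bu; have b1 := bddint_sin0 (xi / s) bu.
have := Rintegral_affine 0 s0 (bddint_integrable (bddintZ s b1)).
rewrite (RintZ s b1) mulKf; last exact: lt0r_neq0.
rewrite /sinint => <-; apply: eq_Rintegral => x _.
rewrite /dilate subr0 addr0 mulrA.
by congr (_ * sin _); field; exact: lt0r_neq0.
Qed.

Lemma cosintB u v xi : bddint u -> bddint v ->
  cosint (fun x => u x - v x) xi = cosint u xi - cosint v xi.
Proof.
move=> bu bv; rewrite /cosint -RintB; [|exact: bddint_cos0..].
by apply: eq_Rintegral => x _; rewrite mulrBl.
Qed.

Lemma sinintB u v xi : bddint u -> bddint v ->
  sinint (fun x => u x - v x) xi = sinint u xi - sinint v xi.
Proof.
move=> bu bv; rewrite /sinint -RintB; [|exact: bddint_sin0..].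
by apply: eq_Rintegral => x _; rewrite mulrBl.
Qed.

(** The dilate of Phi has the prescribed transform, so by fourier_injective it
    is the only continuous bounded integrable function that does. *)
Lemma is_dilationE Phi (s : R) g : 0 < s -> schwartz Phi -> is_dilation Phi s g ->
  forall x, complex.Re (g x) = dilate (fun x => complex.Re (Phi x)) s 0 x /\
    complex.Im (g x) = dilate (fun x => complex.Im (Phi x)) s 0 x.
Proof.
move=> s0 [/schwartzR_profile[C1 [M1 [[b1 _ _ _] l1]]]
  /schwartzR_profile[C2 [M2 [[b2 _ _ _] l2]]]].
move=> [[/schwartzR_profile[C3 [M3 [[b3 _ _ _] l3]]]
  /schwartzR_profile[C4 [M4 [[b4 _ _ _] l4]]]] FE].
have bd1 := bddint_dilate 0 s0 b1; have bd2 := bddint_dilate 0 s0 b2.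
pose h x := Complex (complex.Re (g x) - dilate (fun x => complex.Re (Phi x)) s 0 x)
  (complex.Im (g x) - dilate (fun x => complex.Im (Phi x)) s 0 x).
have bh1 : bddint (fun x => complex.Re (h x)) by exact: bddintB.
have bh2 : bddint (fun x => complex.Im (h x)) by exact: bddintB.
have Fh xi : fourier h xi = 0.
  have := FE xi; rewrite !fourierE// => -[e1 e2].
  rewrite /h/= !cosintB// !sinintB// !cosint_dilate// !sinint_dilate//.
  rewrite [2 * pi * xi / s](_ : _ = 2 * pi * (xi / s)); last by ring.
  by congr Complex; lra.
have lipc (u : R -> R) (M : R) : (forall x y, `|u x - u y| <= M * `|x - y|) ->
    continuous (dilate u s 0).
  move=> lu; apply: (@lipschitz_continuous _ _ (s * (M * s))) => x y.
  rewrite /dilate -mulrBr normrM gtr0_norm// -!mulrA ler_wpM2l//; first exact: ltW.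
  rewrite (le_trans (lu _ _))// !subr0 -mulrBr normrM (gtr0_norm s0).
  by [].
have c1 : continuous (fun x => complex.Re (h x)).
  move=> x; apply: cvgB; first exact: (lipschitz_continuous l3).
  exact: (lipc _ _ l1).
have c2 : continuous (fun x => complex.Im (h x)).
  move=> x; apply: cvgB; first exact: (lipschitz_continuous l4).
  exact: (lipc _ _ l2).
have fv X : fourier_vanishes (fun x => complex.Re (h x)) X /\
    fourier_vanishes (fun x => complex.Im (h x)) X.
  have -> : X = 2 * pi * (X / (2 * pi)).
    by rewrite mulrC divfK// mulf_neq0// gt_eqF// pi_gt0.
  exact: fourier_vanishes_ReIm.
move=> x; split; apply/eqP; rewrite -subr_eq0; apply/eqP.
  exact: (fourier_injective bh1 c1 (fun X => (fv X).1)).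
exact: (fourier_injective bh2 c2 (fun X => (fv X).2)).
Qed.

End dilations.

(** * Sums over the integers *)

Section bilateral_sums.
Context {R : realType}.
Local Notation mu := (@lebesgue_measure R).

Definition window (N : nat) : seq int :=
  [seq i%:Z - N%:Z | i <- iota 0 (N + N).+1].

Lemma mem_window N (k : int) : (k \in window N) = (`|k| <= N)%N.
Proof.
apply/mapP/idP => [ [i iN ->] | kN]; first by move: iN; rewrite mem_iota; lia.
by exists (absz (k + N%:Z)); rewrite ?mem_iota; lia.
Qed.

Lemma uniq_window N : uniq (window N).
Proof. by rewrite map_inj_uniq ?iota_uniq// => i j; lia. Qed.

Lemma fsum_window N (a : int -> R) :
  (\sum_(k \in [set` window N]) (a k)%:E =
   (\sum_(i < (N + N).+1) a (i%:Z - N%:Z))%:E)%E.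
Proof.
rewrite -fsbig_seq ?uniq_window// sumEFin; congr EFin.
by rewrite big_map -{1}(subn0 (N + N).+1) -/(index_iota 0 _) big_mkord.
Qed.

Lemma finite_set_window (A : set int) : finite_set A ->
  exists N, A `<=` [set` window N].
Proof.
move=> /finite_seqP[s ->]; exists (\max_(k <- s) `|k|)%N => k /= ks.
by rewrite mem_window; exact: (@leq_bigmax_seq _ s xpredT absz).
Qed.

(** The symmetric windows exhaust the finite subsets of the integers, and the
    q-th power is increasing with increasing inverse. *)
Lemma esum_int_poweR (a : int -> R) (q : R) : 0 < q -> (forall k, 0 <= a k) ->
  (esum setT (fun k => (a k)%:E) `^ q =
   ereal_sup (range (fun N => ((\sum_(i < (N + N).+1) a (i%:Z - N%:Z)) `^ q)%:E)))%E.
Proof.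
move=> q0 a0; set E := esum _ _; set L := ereal_sup _.
have S0 N : 0 <= \sum_(i < (N + N).+1) a (i%:Z - N%:Z) by exact: sumr_ge0.
have E0 : (0 <= E)%E by apply: esum_ge0 => k _; rewrite lee_fin.
have L0 : (0 <= L)%E.
  apply: (@le_trans _ _ ((\sum_(i < (0 + 0).+1) a (i%:Z - 0%:Z)) `^ q)%:E).
    by rewrite lee_fin powR_ge0.
  by apply: ereal_sup_ubound; exists 0%N.
have mono (x y : \bar R) (r : R) : 0 <= r -> (0 <= x -> x <= y -> x `^ r <= y `^ r)%E.
  move=> r0 x0 xy; apply: gt0_ler_poweR => //; rewrite in_itv/= leey andbT//.
  exact: le_trans xy.
apply/eqP; rewrite eq_le; apply/andP; split.
  (* taking the q-th root of the supremum avoids any continuity of the power at +oo *)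
  suff EL : (E <= L `^ q^-1)%E.
    have := mono _ _ q (ltW q0) E0 EL.
    by rewrite -poweRrM mulVf ?gt_eqF// poweRe1.
  rewrite /E /esum; apply: ge_ereal_sup => _ [A [fA _] <-].
  have [N AN] := finite_set_window fA.
  apply: (@le_trans _ _ (\sum_(k \in [set` window N]) (a k)%:E)%E).
    apply: lee_fsum_nneg_subset; [exact: fA|exact: finite_seq| |].
    - by move=> k; rewrite !inE => /AN.
    - by move=> k _; rewrite lee_fin.
  rewrite fsum_window; set S := \sum_(i < _) _.
  have -> : S%:E = ((S `^ q)%:E `^ q^-1)%E.
    by rewrite poweR_EFin -powRrM mulfV ?gt_eqF// powRr1// S0.
  apply: mono; first by rewrite invr_ge0 ltW.
    by rewrite lee_fin powR_ge0.
  by apply: ereal_sup_ubound; exists N.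
apply: ge_ereal_sup => _ [N _ <-]; rewrite -poweR_EFin; apply: mono.
- exact: ltW.
- by rewrite lee_fin S0.
- apply: esum_ge; exists [set` window N]; last by rewrite fsum_window.
  by split => //; exact: finite_seq.
Qed.

(** Monotone convergence along the symmetric windows. *)
Lemma integral_esum_int_le (w : int -> R -> R) (q : R) (B : \bar R) : 0 < q ->
  (forall k x, 0 <= w k x) -> (forall k, measurable_fun setT (w k)) ->
  (forall N, \int[mu]_x ((\sum_(i < (N + N).+1) w (i%:Z - N%:Z)%R x) `^ q)%:E <= B)%E ->
  (\int[mu]_x (esum setT (fun k => (w k x)%:E) `^ q) <= B)%E.
Proof.
move=> q0 w0 mw HB.
pose G N x := \sum_(i < (N + N).+1) w (i%:Z - N%:Z) x.
have GS N x : G N x <= G N.+1 x.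
  have -> : G N.+1 x = w (- N.+1%:Z) x + (G N x + w N.+1%:Z x).
    rewrite /G addSn addnS big_ord_recl big_ord_recr/=; congr (w _ x + (_ + w _ x)).
    - by rewrite sub0r.
    - by apply: eq_bigr => i _; congr (w _ x); rewrite /bump/=; lia.
    - by rewrite /bump/=; lia.
  by rewrite addrCA lerDl addr_ge0.
have G0 N x : 0 <= G N x by exact: sumr_ge0.
have nd x : nondecreasing_seq (fun N => ((G N x) `^ q)%:E).
  apply/nondecreasing_seqP => N; rewrite lee_fin.
  by apply: ge0_ler_powR; rewrite ?nnegrE// ltW.
have mG N : measurable_fun setT (fun x : R => ((G N x) `^ q)%:E).
  apply/measurable_EFinP; apply: (measurableT_comp (measurable_powR q)).
  by apply: measurable_sum => i.
have E x : (esum setT (fun k => (w k x)%:E) `^ q = limn (fun N => ((G N x) `^ q)%:E))%E.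
  rewrite esum_int_poweR//; apply/esym/cvg_lim => //.
  exact: ereal_nondecreasing_cvgn.
under eq_integral do rewrite E.
rewrite monotone_convergence//.
- apply: lime_le; last by apply: nearW => N; exact: HB.
  apply: ereal_nondecreasing_is_cvgn => m n mn.
  apply: ge0_le_integral; [exact: measurableT| |exact: mG|exact: mG|].
    by move=> x _; rewrite lee_fin powR_ge0.
  by move=> x _; exact: nd.
- by move=> N x _; rewrite lee_fin powR_ge0.
Qed.

End bilateral_sums.

(** * The complex square function *)

Section complex_square_function.
Context {R : realType}.
Local Notation mu := (@lebesgue_measure R).
Local Notation normc := ComplexField.Normc.normc.
Variable p : R.
Hypothesis p1 : 1 < p.

Lemma sqr_normc (z : R[i]) :
  normc z ^+ 2 = complex.Re z ^+ 2 + complex.Im z ^+ 2.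
Proof. by case: z => a b; rewrite sqr_sqrtr// addr_ge0// sqr_ge0. Qed.

Lemma normc_ge0 (z : R[i]) : 0 <= normc z.
Proof. by case: z => a b; exact: sqrtr_ge0. Qed.

Lemma norm_Re_le (z : R[i]) : `|complex.Re z| <= normc z.
Proof.
rewrite -[leRHS]ger0_norm ?normc_ge0// -ler_sqr ?nnegrE//.
by rewrite !real_normK ?num_real// sqr_normc lerDl sqr_ge0.
Qed.

Lemma norm_Im_le (z : R[i]) : `|complex.Im z| <= normc z.
Proof.
rewrite -[leRHS]ger0_norm ?normc_ge0// -ler_sqr ?nnegrE//.
by rewrite !real_normK ?num_real// sqr_normc lerDr sqr_ge0.
Qed.

Lemma measurable_normc (f : R -> R[i]) :
  measurable_fun setT (fun x => complex.Re (f x)) ->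
  measurable_fun setT (fun x => complex.Im (f x)) ->
  measurable_fun setT (fun x => normc (f x)).
Proof.
move=> mr mi; rewrite (_ : (fun x => _) =
    (fun x : R => Num.sqrt (complex.Re (f x) ^+ 2 + complex.Im (f x) ^+ 2))).
  apply: (measurableT_comp (f := @Num.sqrt R)).
    by apply: continuous_measurable_fun; exact: sqrt_continuous.
  by apply: measurable_funD; exact: measurable_funX.
by apply/funext => x; case: (f x).
Qed.

Lemma measurable_conv_Lp k (u : R -> R) : bddint k -> measurable_fun setT u ->
  (\int[mu]_y (`|u y| `^ p)%:E < +oo)%E -> measurable_fun setT (conv k u).
Proof.
move=> bk mu' up.
apply: (@measurable_fun_cvg _ _ _ setT (fun n => conv k (truncate u n))) => [n|x _].
  exact: bddint_measurable (bddint_conv bk (bddint_truncate n mu')).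
exact: (conv_truncate_cvg (p := p) (ltW p1)).
Qed.

(** Translating by s^-1 * beta turns the rescaled Phi into dilate with shift
    beta, and the complex product gives four real convolutions. *)
Lemma convolution_dilation Phi (s beta : R) (g f : R -> R[i]) (x : R) : 0 < s ->
  schwartz Phi -> is_dilation Phi s g ->
  measurable_fun setT (fun y => complex.Re (f y)) ->
  measurable_fun setT (fun y => complex.Im (f y)) ->
  (\int[mu]_y (`|complex.Re (f y)| `^ p)%:E < +oo)%E ->
  (\int[mu]_y (`|complex.Im (f y)| `^ p)%:E < +oo)%E ->
  let A := dilate (fun x => complex.Re (Phi x)) s beta in
  let B := dilate (fun x => complex.Im (Phi x)) s beta in
  let u y := complex.Re (f y) in let v y := complex.Im (f y) in
  convolution f g (x - s^-1 * beta) =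
  Complex (conv A u x - conv B v x) (conv B u x + conv A v x).
Proof.
move=> s0 sP dg mu' mv up vp A B u v.
have gE y : complex.Re (g (x - s^-1 * beta - y)) = A (x - y) /\
    complex.Im (g (x - s^-1 * beta - y)) = B (x - y).
  have [-> ->] := is_dilationE s0 sP dg (x - s^-1 * beta - y).
  rewrite /dilate subr0.
  rewrite (_ : s * (x - s^-1 * beta - y) = s * (x - y) - beta)//.
  by rewrite mulrBr mulrBr mulVKf ?gt_eqF// mulrBr addrAC.
have [C1 [_ [[b1 _ _ _] _]]] := schwartzR_profile sP.1.
have [C2 [_ [[b2 _ _ _] _]]] := schwartzR_profile sP.2.
have bA : bddint A by exact: bddint_dilate.
have bB : bddint B by exact: bddint_dilate.
have p1' := ltW p1.
have IAu := integrable_conv_Lp p1' x bA mu' up.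
have IBu := integrable_conv_Lp p1' x bB mu' up.
have IAv := integrable_conv_Lp p1' x bA mv vp.
have IBv := integrable_conv_Lp p1' x bB mv vp.
rewrite /convolution /cintegral /conv -RintegralB// -RintegralD//.
congr Complex; apply: eq_Rintegral => y _; have [<- <-] := gE y;
  rewrite /u /v; case: (f y) (g _) => [a b] [c d] /=; ring.
Qed.

Lemma powRD_le (q a b : R) : 0 <= q -> 0 <= a -> 0 <= b ->
  (a + b) `^ q <= 2 `^ q * (a `^ q + b `^ q).
Proof.
move=> q0 a0 b0.
have H c d : 0 <= c -> c <= d -> (c + d) `^ q <= 2 `^ q * (c `^ q + d `^ q).
  move=> c0 cd; have d0 := le_trans c0 cd.
  apply: (@le_trans _ _ ((2 * d) `^ q)).
    by apply: ge0_ler_powR; rewrite ?nnegrE ?addr_ge0 ?mulr_ge0//; lra.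
  by rewrite powRM// ler_wpM2l ?powR_ge0// lerDr powR_ge0.
have [ab|/ltW ba] := leP a b; first exact: H.
by rewrite addrC [X in _ * X]addrC; exact: H.
Qed.

Lemma powR_sum4_le (q t a b c d : R) : 0 <= q -> 0 <= t ->
  0 <= a -> 0 <= b -> 0 <= c -> 0 <= d -> t <= 2 * ((a + b) + (c + d)) ->
  t `^ q <= (2 `^ q) ^+ 3 * ((a `^ q + b `^ q) + (c `^ q + d `^ q)).
Proof.
move=> q0 t0 a0 b0 c0 d0 H.
have ab := addr_ge0 a0 b0; have cd := addr_ge0 c0 d0.
apply: (@le_trans _ _ ((2 * ((a + b) + (c + d))) `^ q)).
  by apply: ge0_ler_powR; rewrite ?nnegrE//; exact: le_trans H.
have S0 : 0 <= a + b + (c + d) by exact: addr_ge0.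
rewrite powRM//.
have E0 := powR_ge0 2 q.
have H1 := powRD_le q0 ab cd.
have H2 := powRD_le q0 a0 b0; have H3 := powRD_le q0 c0 d0.
move: (2 `^ q) E0 H1 H2 H3 => E E0 H1 H2 H3.
rewrite exprS -mulrA; apply: ler_wpM2l => //; apply: (le_trans H1).
rewrite expr2 -mulrA; apply: ler_wpM2l => //.
by rewrite mulrDr; exact: lerD.
Qed.

Lemma integral_sum4 (h a b c d : R -> R) (E A B C D : R) (W : \bar R) : 0 <= E ->
  measurable_fun setT h -> measurable_fun setT a -> measurable_fun setT b ->
  measurable_fun setT c -> measurable_fun setT d ->
  (forall x, 0 <= h x) -> (forall x, 0 <= a x) -> (forall x, 0 <= b x) ->
  (forall x, 0 <= c x) -> (forall x, 0 <= d x) ->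
  (forall x, h x <= E * ((a x + b x) + (c x + d x))) ->
  0 <= A -> 0 <= B -> 0 <= C -> 0 <= D -> (0 <= W)%E ->
  (\int[mu]_x (a x)%:E <= A%:E * W)%E -> (\int[mu]_x (b x)%:E <= B%:E * W)%E ->
  (\int[mu]_x (c x)%:E <= C%:E * W)%E -> (\int[mu]_x (d x)%:E <= D%:E * W)%E ->
  (\int[mu]_x (h x)%:E <= (E * ((A + B) + (C + D)))%:E * W)%E.
Proof.
move=> E0 mh ma mb mc md h0 a0 b0 c0 d0 H A0 B0 C0 D0 W0 HA HB HC HD.
have mab : measurable_fun setT (fun x => a x + b x) by exact: measurable_funD.
have mcd : measurable_fun setT (fun x => c x + d x) by exact: measurable_funD.
have ab0 x : 0 <= a x + b x by exact: addr_ge0.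
have cd0 x : 0 <= c x + d x by exact: addr_ge0.
have D2 (k l : R -> R) : measurable_fun setT k -> measurable_fun setT l ->
    (forall x, 0 <= k x) -> (forall x, 0 <= l x) ->
    (\int[mu]_x (k x + l x)%:E = \int[mu]_x (k x)%:E + \int[mu]_x (l x)%:E)%E.
  move=> mk ml k0 l0; under eq_integral do rewrite EFinD.
  rewrite ge0_integralD//.
  - by move=> x _; rewrite lee_fin.
  - exact/measurable_EFinP.
  - by move=> x _; rewrite lee_fin.
  - exact/measurable_EFinP.
apply: (@le_trans _ _ (\int[mu]_x (E%:E * ((a x + b x) + (c x + d x))%:E))%E).
  apply: ge0_le_integral => //.
  - by move=> x _; rewrite lee_fin.
  - exact/measurable_EFinP.
  - by apply/measurable_EFinP; apply: measurable_funM => //; exact: measurable_funD.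
  - by move=> x _; rewrite -EFinM lee_fin.
rewrite ge0_integralZl_EFin//; last 2 first.
- by move=> x _; rewrite lee_fin addr_ge0.
- by apply/measurable_EFinP; exact: measurable_funD.
rewrite EFinM -muleA; apply: lee_wpmul2l; first by rewrite lee_fin.
rewrite (D2 _ _ mab mcd ab0 cd0) (D2 _ _ ma mb a0 b0) (D2 _ _ mc md c0 d0).
rewrite !EFinD !ge0_muleDl ?adde_ge0 ?lee_fin//.
by apply: leeD; apply: leeD.
Qed.

End complex_square_function.

(** * The final estimate *)

Section final_estimate.
Context {R : realType}.
Local Notation mu := (@lebesgue_measure R).
Local Notation normc := ComplexField.Normc.normc.
Variable p : R.
Hypothesis p1 : 1 < p.

Definition window_scale (mj : nat) (delta : R) (N : nat) (i : nat) : R :=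
  2 ^ (mj%:Z * (i%:Z - N%:Z)) * delta.

Lemma window_scale_gt0 mj delta N i : 0 < delta -> 0 < window_scale mj delta N i.
Proof. by move=> d0; rewrite mulr_gt0// exprz_gt0. Qed.

Lemma window_scale_lacunary mj delta N i : (0 < mj)%N -> 0 < delta ->
  2 * window_scale mj delta N i <= window_scale mj delta N i.+1.
Proof.
move=> m0 d0; rewrite /window_scale mulrA; apply: ler_wpM2r; first exact: ltW.
rewrite (_ : mj%:Z * (i.+1%:Z - N%:Z) = mj%:Z + mj%:Z * (i%:Z - N%:Z)); last first.
  by rewrite -[i.+1]addn1 PoszD; ring.
rewrite expfzDr ?pnatr_eq0//; apply: ler_wpM2r; first by rewrite exprz_ge0.
by rewrite -exprnP -[X in X <= _]expr1 ler_eXn2l// ltr1n.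
Qed.

(** The squared modulus of each term is at most twice the sum of the squares
    of four real convolutions, each of which has its square function bounded
    by square_function_Lp with one of the profiles Re Phi and Im Phi. The
    support of the transform in the annulus gives orthogonality with r = pi,
    and the scales at least double because mj >= 1. *)
Lemma square_function_window (Phi : R -> R[i]) : schwartz Phi ->
  fourier_supported_in Phi (@annulus R) ->
  exists2 K : R, 0 <= K & forall (beta : R) (mj : nat) (delta : R),
    (0 < mj)%N -> 0 < delta ->
  forall Phijd : int -> R -> R[i],
    (forall k : int, is_dilation Phi (2 ^ (mj%:Z * k) * delta) (Phijd k)) ->
  forall (f : R -> R[i]) (W : \bar R),
  measurable_fun setT (fun x => complex.Re (f x)) ->
  measurable_fun setT (fun x => complex.Im (f x)) ->
  (\int[mu]_x (`|complex.Re (f x)| `^ p)%:E <= W)%E ->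
  (\int[mu]_x (`|complex.Im (f x)| `^ p)%:E <= W)%E -> (0 <= W < +oo)%E ->
  let w (k : int) (x : R) := normc (convolution f (Phijd k)
     (x - 2 ^ (- (mj%:Z * k)) * delta^-1 * beta)) ^+ 2 in
  (forall k, measurable_fun setT (w k)) /\
  forall N, (\int[mu]_x ((\sum_(i < (N + N).+1) w (i%:Z - N%:Z)%R x) `^ (p / 2))%:E <=
    (K * ln (10 + `|beta|) `^ p)%:E * W)%E.
Proof.
move=> sP suppP.
have [C1 [M1 [pa la]]] := schwartzR_profile sP.1.
have [C2 [M2 [pb lb]]] := schwartzR_profile sP.2.
set a := fun x => complex.Re (Phi x) in pa la.
set b := fun x => complex.Im (Phi x) in pb lb.
have [K1 K10 HK1] := square_function_Lp p1 pa.
have [K2 K20 HK2] := square_function_Lp p1 pb.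
have [ba _ _ _] := pa; have [bb _ _ _] := pb.
have va := fourier_vanishes_annulus ba bb suppP.
have q0 : 0 <= p / 2 by rewrite divr_ge0// ltW// (lt_trans ltr01).
exists ((2 `^ (p / 2)) ^+ 3 * ((K1 + K2) + (K2 + K1))).
  by rewrite mulr_ge0 ?exprn_ge0 ?powR_ge0 ?addr_ge0.
move=> beta mj delta m0 d0 Phijd HPhi f W mu' mv uW vW /andP[W0 Wfin] w.
set u := fun x => complex.Re (f x) in mu' uW.
set v := fun x => complex.Im (f x) in mv vW.
have ufin := le_lt_trans uW Wfin; have vfin := le_lt_trans vW Wfin.
pose s k : R := 2 ^ (mj%:Z * k) * delta.
have s0 k : 0 < s k by rewrite mulr_gt0// exprz_gt0.
have bA k : bddint (dilate a (s k) beta) by exact: bddint_dilate.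
have bB k : bddint (dilate b (s k) beta) by exact: bddint_dilate.
pose T (phi z : R -> R) k := conv (dilate phi (s k) beta) z.
have mAu k : measurable_fun setT (T a u k) by exact: measurable_conv_Lp (bA k) mu' ufin.
have mBu k : measurable_fun setT (T b u k) by exact: measurable_conv_Lp (bB k) mu' ufin.
have mAv k : measurable_fun setT (T a v k) by exact: measurable_conv_Lp (bA k) mv vfin.
have mBv k : measurable_fun setT (T b v k) by exact: measurable_conv_Lp (bB k) mv vfin.
have wE k x : w k x = (T a u k x - T b v k x) ^+ 2 + (T b u k x + T a v k x) ^+ 2.
  rewrite /w.
  have -> : 2 ^ (- (mj%:Z * k)) * delta^-1 = (s k)^-1 by rewrite /s invfM invr_expz.
  by rewrite (convolution_dilation p1 beta x (s0 k) sP (HPhi k) mu' mv ufin vfin) sqr_normc.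
have mw k : measurable_fun setT (w k).
  rewrite (_ : w k = fun x => (T a u k x - T b v k x) ^+ 2 +
      (T b u k x + T a v k x) ^+ 2); last by apply/funext => x; exact: wE.
  by apply: measurable_funD; apply: measurable_funX;
    [exact: measurable_funB|exact: measurable_funD].
split=> // N.
pose S (phi z : R -> R) x := \sum_(i < (N + N).+1) T phi z (i%:Z - N%:Z) x ^+ 2.
have S0 phi z x : 0 <= S phi z x by apply: sumr_ge0 => i _; exact: sqr_ge0.
set L := ln (10 + `|beta|) `^ p.
have L0 : 0 <= L by exact: powR_ge0.
have pos := fun i => window_scale_gt0 mj N i d0.
have lac := fun i => window_scale_lacunary N i m0 d0.
have oa : orthogonal_scales a (window_scale mj delta N) beta.
  apply: (orthogonal_scales_of_annulus (r := pi) beta ba la) => //; first exact: pi_gt0.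
  by move=> xi /va[].
have ob : orthogonal_scales b (window_scale mj delta N) beta.
  apply: (orthogonal_scales_of_annulus (r := pi) beta bb lb) => //; first exact: pi_gt0.
  by move=> xi /va[].
have bound K (phi z : R -> R) : 0 <= K ->
    (\int[mu]_x (S phi z x `^ (p / 2))%:E <=
      (K * L)%:E * \int[mu]_x (`|z x| `^ p)%:E)%E ->
    (\int[mu]_x (`|z x| `^ p)%:E <= W)%E ->
    (\int[mu]_x (S phi z x `^ (p / 2))%:E <= (K * L)%:E * W)%E.
  move=> K0 H zW; apply: (le_trans H); apply: lee_wpmul2l => //.
  by rewrite lee_fin mulr_ge0.
have HAu := bound _ _ _ K10 (HK1 beta _ (N + N).+1 u pos lac oa mu' ufin) uW.
have HAv := bound _ _ _ K10 (HK1 beta _ (N + N).+1 v pos lac oa mv vfin) vW.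
have HBu := bound _ _ _ K20 (HK2 beta _ (N + N).+1 u pos lac ob mu' ufin) uW.
have HBv := bound _ _ _ K20 (HK2 beta _ (N + N).+1 v pos lac ob mv vfin) vW.
have mS (phi z : R -> R) : (forall k, measurable_fun setT (T phi z k)) ->
    measurable_fun setT (fun x => S phi z x `^ (p / 2)).
  move=> mT; apply: (measurableT_comp (measurable_powR (p / 2))).
  by apply: measurable_sum => i; exact: measurable_funX.
rewrite [X in X%:E](_ : _ = (2 `^ (p / 2)) ^+ 3 *
   ((K1 * L + K2 * L) + (K2 * L + K1 * L))); last first.
  by move: (2 `^ _) => t; ring.
apply: (integral_sum4 (h := fun x => (\sum_(i < (N + N).+1) w (i%:Z - N%:Z) x) `^ (p / 2))
  (a := fun x => S a u x `^ (p / 2)) (b := fun x => S b v x `^ (p / 2))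
  (c := fun x => S b u x `^ (p / 2)) (d := fun x => S a v x `^ (p / 2))).
- by rewrite exprn_ge0 ?powR_ge0.
- apply: (measurableT_comp (measurable_powR (p / 2))).
  by apply: measurable_sum => i; exact: mw.
- exact: mS.
- exact: mS.
- exact: mS.
- exact: mS.
- by move=> x; exact: powR_ge0.
- by move=> x; exact: powR_ge0.
- by move=> x; exact: powR_ge0.
- by move=> x; exact: powR_ge0.
- by move=> x; exact: powR_ge0.
- move=> x; apply: powR_sum4_le; rewrite ?S0//.
    by apply: sumr_ge0 => i _; exact: sqr_ge0.
  rewrite /S -!big_split/= mulr_sumr; apply: ler_sum => i _; rewrite wE.
  move: (T a u _ x) (T b v _ x) (T b u _ x) (T a v _ x) => A B C D.
  have := sqr_ge0 (A + B); have := sqr_ge0 (C - D).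
  by rewrite !expr2; lra.
- exact: mulr_ge0.
- exact: mulr_ge0.
- exact: mulr_ge0.
- exact: mulr_ge0.
- exact: W0.
- exact: HAu.
- exact: HBv.
- exact: HBu.
- exact: HAv.
Qed.

End final_estimate.

Theorem theorem5p1 (R : realType) (Phi : R -> R[i])
    (Phi_schwartz : schwartz Phi)
    (Phi_supp : fourier_supported_in Phi (@annulus R))
    (p : R) (p_gt1 : 1 < p) :
  exists C : R,
    forall (beta : R) (mj : nat) (delta : R),
      (0 < mj)%N -> dyadic delta ->
    forall Phijd : int -> R -> R[i],
      (forall k : int, is_dilation Phi (2 ^ (mj%:Z * k) * delta) (Phijd k)) ->
    forall f : R -> R[i], in_Lp p f ->
      (Lnorm (@lebesgue_measure R) p%:E
         (square_function (fun (k : int) (x : R) =>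
            convolution f (Phijd k)
              (x - 2 ^ (- (mj%:Z * k)) * delta^-1 * beta)))
       <= (C * ln (10 + `|beta|))%:E * Lp_norm p f)%E.
Proof.
have p0 : 0 < p := lt_trans ltr01 p_gt1.
have [K K0 HK] := square_function_window p_gt1 Phi_schwartz Phi_supp.
exists (K `^ p^-1) => beta mj delta m0 [l dl] Phijd HPhi f [mr mi fp].
have d0 : 0 < delta by rewrite dl exprz_gt0.
set W := (\int[@lebesgue_measure R]_x (`|(ComplexField.Normc.normc (f x))%:E| `^ p))%E.
have LW : Lp_norm p f = (W `^ p^-1)%E by rewrite /Lp_norm unlock.
have WE : W = (\int[@lebesgue_measure R]_x (ComplexField.Normc.normc (f x) `^ p)%:E)%E.
  by apply: eq_integral => x _; rewrite abse_EFin poweR_EFin ger0_norm ?normc_ge0.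
have W0 : (0 <= W)%E by apply: integral_ge0 => x _; exact: poweR_ge0.
have Wfin : (W < +oo)%E.
  by apply: (@lty_poweRy _ _ p^-1); rewrite ?invr_neq0 ?gt_eqF// -LW.
have mN : measurable_fun setT (fun x => (ComplexField.Normc.normc (f x) `^ p)%:E).
  apply/measurable_EFinP; apply: (measurableT_comp (measurable_powR p)).
  exact: measurable_normc.
have part (z : R -> R) : measurable_fun setT z ->
    (forall x, `|z x| <= ComplexField.Normc.normc (f x)) ->
    (\int[@lebesgue_measure R]_x (`|z x| `^ p)%:E <= W)%E.
  move=> mz zf; rewrite WE; apply: ge0_le_integral => //.
  - apply/measurable_EFinP; apply: (measurableT_comp (measurable_powR p)).
    exact: measurableT_comp.
  - move=> x _; rewrite lee_fin; apply: ge0_ler_powR => //.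
    + exact: ltW.
    + by rewrite nnegrE normc_ge0.
have [mw HN] := HK beta mj delta m0 d0 Phijd HPhi f W mr mi
  (part _ mr (fun x => norm_Re_le (f x))) (part _ mi (fun x => norm_Im_le (f x)))
  (introT andP (conj W0 Wfin)).
have q0 : 0 < p / 2 by rewrite divr_gt0.
have H := integral_esum_int_le q0 (fun k x => sqr_ge0 _) mw HN.
have L1 : 0 <= ln (10 + `|beta|) by apply: le_trans (ln10_ge1 (normr_ge0 beta)).
rewrite unlock LW.
have -> : ((K `^ p^-1 * ln (10 + `|beta|))%:E =
    ((K * ln (10 + `|beta|) `^ p)%:E `^ p^-1))%E.
  rewrite poweR_EFin powRM ?powR_ge0// -powRrM mulfV ?gt_eqF// powRr1//.
rewrite -poweRM ?lee_fin ?mulr_ge0 ?powR_ge0//.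
have I0 (F : R -> \bar R) : (0 <= \int[@lebesgue_measure R]_x (`|F x| `^ p))%E.
  by apply: integral_ge0 => x _; exact: poweR_ge0.
apply: gt0_ler_poweR.
- by rewrite invr_ge0 ltW.
- by rewrite in_itv/= leey andbT.
- by rewrite in_itv/= leey andbT mule_ge0// lee_fin mulr_ge0 ?powR_ge0.
apply: le_trans H; rewrite le_eqVlt; apply/orP; left; apply/eqP.
apply: eq_integral => x _; rewrite /square_function.
set E := esum _ _.
have E0 : (0 <= E)%E by apply: esum_ge0 => k _; rewrite lee_fin sqr_ge0.
by rewrite -poweR12_sqrt// gee0_abs ?poweR_ge0// -poweRrM [2^-1 * p]mulrC.
Qed.
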